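(* Let $f$ satisfy $\|f(u)\|\le c(1+\|u\|)$ and $\|f(u)-f(v)\|\le c\|u-v\|$ for all $u,v\in H$, with some constant $c>0$. Let $s>\frac{1-H_1}{2}$, $2H_2+(H_1-1)\alpha>0$, and, for small $\epsilon>0$, let $2\sigma\in\big[0,\min\{1-2H_1,\ \frac{4sH_2}{\alpha}-1,\ \frac{1+\epsilon}{2}\}\big)$. Let $u$ be the solution of $$\partial_t u+\lambda\,\partial_t^{1-\beta}u+\mu\,\partial_t^{1-\alpha}A^s u=f(u)+\gamma(t)\,\xi^{H_1,H_2}\ \text{in } D\times(0,T],\quad u=0\ \text{on }\partial D\times(0,T],\quad u=0\ \text{in } D\times\{t=0\},$$ and let $u_W$ be the solution of the same problem with $\xi^{H_1,H_2}$ replaced by its Wong-Zakai approximation $\xi_W^{H_1,H_2}$ with time step $\tau$ and space step $h$. Then there is a constant $c$, independent of $t\in[0,T]$, $h$ and $\tau$, such that $$\mathbb E\|u(t)-u_W(t)\|^2\le c\big(h^{2\sigma+2H_1-1}+h^{2H_1-1}\tau^{2H_2-\frac{\alpha}{2s}-\epsilon}\big).$$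
   Context: Let $l,T>0$, $D=(0,l)$, $I=[0,T]$, and $H=L^2(D)$ with norm $\|\cdot\|$ and inner product $(\cdot,\cdot)$. $A=-\Delta$ is the Dirichlet Laplacian on $D$, with nondecreasing positive eigenvalues $\rho_k$ and eigenfunctions $e_k$ ($k=1,2,\dots$) forming an orthonormal basis of $H$; $A^sv=\sum_k\rho_k^s(v,e_k)e_k$. Parameters: $0<\beta\le\alpha<1$, $s\in(0,1)$, $\mu>0$, $\lambda\ge0$, $H_1,H_2\in(0,\frac12]$, $\gamma\in C^1([0,T])$ with $\gamma(0)=0$. For $\eta\in(0,1)$, $\partial_t^\eta y(x,t)=\frac1{\Gamma(1-\eta)}\partial_t\int_0^t(t-r)^{-\eta}y(x,r)\,dr$ is the Riemann-Liouville derivative. Noise: $\xi^{H_1,H_2}=\frac{\partial^2W^{H_1,H_2}}{\partial x\,\partial t}$, where $W^{H_1,H_2}$ is a fractional Brownian sheet on a stochastic basis $(\Omega,\mathcal F,(\mathcal F_t)_{t\in I},\mathbb P)$, i.e. a centered Gaussian field with $\mathbb E(W^{H_1,H_2}(x,t)W^{H_1,H_2}(y,r))=R_{H_1}(x,y)R_{H_2}(t,r)$, $R_K(x,y)=\frac12(|x|^{2K}+|y|^{2K}-|x-y|^{2K})$. Integrals of deterministic functions against $\xi^{H_1,H_2}(dy,d\upsilon)$ are Wiener integrals with respect to $W^{H_1,H_2}$. Wong-Zakai approximation: let $\tau=T/m$, $h=l/m'$ with $m,m'\in\mathbb N$, $t_i=i\tau$, $x_j=jh$, $I_i=(t_i,t_{i+1}]$,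 $D_j=(x_j,x_{j+1}]$, $\chi_{i,j}$ the characteristic function of $I_i\times D_j$ (i.e. of $t\in I_i$, $x\in D_j$), and $$\xi_W^{H_1,H_2}(x,t)=\sum_{i=0}^{m-1}\sum_{j=0}^{m'-1}\Big(\frac1{\tau h}\int_{I_i}\int_{D_j}\xi^{H_1,H_2}(dy,d\upsilon)\Big)\chi_{i,j}(x,t).$$ Let $h(z)=\mu^{-1}z^\alpha(1+\lambda z^{-\beta})$ (a function of $z\in\mathbb C$, not the mesh size $h$) and, for $\theta\in(0,\pi/2)$ and $\kappa>0$, let $\Gamma_{\kappa,\pi-\theta}=\{re^{-i(\pi-\theta)}:r\ge\kappa\}\cup\{\kappa e^{i\psi}:|\psi|\le\pi-\theta\}\cup\{re^{i(\pi-\theta)}:r\ge\kappa\}$, oriented with increasing imaginary part. Set $$S(t)=\frac1{2\pi i}\int_{\Gamma_{\kappa,\pi-\theta}}e^{zt}\mu^{-1}z^{\alpha-1}(h(z)I+A^s)^{-1}dz,\qquad u_k(t)=\frac1{2\pi i}\int_{\Gamma_{\kappa,\pi-\theta}}e^{zt}\mu^{-1}z^{\alpha-1}(h(z)+\rho_k^s)^{-1}dz,$$ and $F(t,x,y)=\sum_{k\ge1}u_k(t)e_k(x)e_k(y)$. Solutions are mild solutions in $C(I;L^2(\Omega;H))$: for $t\in I$, $$u(t)=\int_0^tS(t-\upsilon)f(u(\upsilon))\,d\upsilon+\int_0^t\int_DF(t-\upsilon,x,y)\gamma(\upsilon)\,\xi^{H_1,H_2}(dy,d\upsilon),$$ $$u_W(t)=\int_0^tS(t-\upsilon)f(u_W(\upsilon))\,d\upsilon+\int_0^t\int_DF(t-\upsilon,x,y)\gamma(\upsilon)\,\xi_W^{H_1,H_2}(y,\upsilon)\,dy\,d\upsilon.$$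 *)

(* Defs.v *)
From HB Require Import structures.
From mathcomp Require Import all_boot all_order all_algebra.
From mathcomp Require Import complex.
From mathcomp Require Import all_classical all_reals all_analysis.

Set Implicit Arguments.
Unset Strict Implicit.
Unset Printing Implicit Defensive.
Import Order.TTheory GRing.Theory Num.Theory.
Import numFieldNormedType.Exports.
Local Open Scope classical_set_scope.
Local Open Scope ring_scope.
Local Open Scope complex_scope.

Section L2_of_D.
Context {R : realType}.
Variable l : R.

Definition muD : {measure set (measurableTypeR R) -> \bar R} :=
  mrestr (@lebesgue_measure R) (measurable_itv `]0, l[).

(* Square-integrable functions for Lebesgue measure on (0, l), as
   representatives: equality in L^2(0, l) is [eqH]. *)
Definition L2D := LfunType muD (lee1n 2).

Definition eqH (v w : L2D) : Prop := v = w %[ae muD].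

Definition normH (v : L2D) : R := fine ('N[muD]_2%:E[EFin \o v]).

Definition inner (v w : L2D) : R := \int[muD]_x (v x * w x).

Definition cvgH (v_ : nat -> L2D) (v : L2D) : Prop :=
  normH (v_ n - v) @[n --> \oo] --> (0 : R).

End L2_of_D.

Section Dirichlet_Laplacian.
Context {R : realType}.
Variable l : R.

(* - v'' = r v on (0, l) in the classical sense, with zero boundary values. *)
Definition dirichlet_eigenfunction (r : R) (v : R -> R) : Prop :=
  [/\ {within `[0, l], continuous v}, v 0 = 0, v l = 0 &
      forall x, x \in `]0, l[ ->
        [/\ derivable v x 1, derivable (derive1 v) x 1 &
            - derive1 (derive1 v) x = r * v x]].

(* Indices start at 0: [rho k], [e k] are the (k+1)-st eigenpair. *)
Definition dirichlet_eigensystem (rho : nat -> R) (e : nat -> L2D l) : Prop :=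
  [/\ (forall k, 0 < rho k) /\ {homo rho : i j / (i <= j)%N >-> i <= j},
      forall k, dirichlet_eigenfunction (rho k) (e k),
      forall i j, inner (e i) (e j) = (i == j)%:R &
      forall v : L2D l, cvgH (fun n => \sum_(k < n) inner v (e k) *: e k) v].

(* [v] is in the domain of A^s and A^s v = w. *)
Definition frac_laplacian (rho : nat -> R) (e : nat -> L2D l) (s : R)
    (v w : L2D l) : Prop :=
  cvgH (fun n => \sum_(k < n) (rho k `^ s * inner v (e k)) *: e k) w.

(* g = g.1 + i g.2 is (zeta I + A^s)^{-1} v in the complexification of
   L^2(0, l), where A^s acts on real and imaginary parts; [v] is real. *)
Definition is_resolvent (rho : nat -> R) (e : nat -> L2D l) (s : R)
    (zeta : R[i]) (v : L2D l) (g : L2D l * L2D l) : Prop :=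
  exists a : L2D l * L2D l,
    [/\ frac_laplacian rho e s g.1 a.1, frac_laplacian rho e s g.2 a.2,
        eqH (complex.Re zeta *: g.1 - complex.Im zeta *: g.2 + a.1) v &
        eqH (complex.Im zeta *: g.1 + complex.Re zeta *: g.2 + a.2) 0].

End Dirichlet_Laplacian.

Section Contour.
Context {R : realType}.

Definition polar (r psi : R) : R[i] := (r * cos psi) +i* (r * sin psi).

Definition cexp (z : R[i]) : R[i] := polar (expR (complex.Re z)) (complex.Im z).

(* Principal argument, in (-pi, pi] for z <> 0. *)
Definition carg (z : R[i]) : R :=
  let a := acos (complex.Re z / ComplexField.Normc.normc z) in
  if 0 <= complex.Im z then a else - a.

(* Principal branch of z^a. *)
Definition cpow (z : R[i]) (a : R) : R[i] :=
  polar (ComplexField.Normc.normc z `^ a) (a * carg z).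

Definition Cintegral (D : set R) (g : R -> R[i]) : R[i] :=
  (\int[@lebesgue_measure R]_(x in D) complex.Re (g x))
    +i* (\int[@lebesgue_measure R]_(x in D) complex.Im (g x)).

Definition contour (kappa theta : R) : set R[i] :=
  [set z | (exists2 r, kappa <= r &
              z = polar r (pi - theta) \/ z = polar r (- (pi - theta)))
        \/ (exists2 psi, `|psi| <= pi - theta & z = polar kappa psi)].

(* The three terms are the lower ray (run from infinity inwards), the arc
   (dz = i kappa e^{i psi} d psi) and the upper ray. *)
Definition contour_integral (kappa theta : R) (g : R[i] -> R[i]) : R[i] :=
  - Cintegral `[kappa, +oo[
      (fun r => g (polar r (- (pi - theta))) * polar 1 (- (pi - theta)))
  + Cintegral `[- (pi - theta), pi - theta]
      (fun psi => g (polar kappa psi) * ('i%C * polar kappa psi))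
  + Cintegral `[kappa, +oo[
      (fun r => g (polar r (pi - theta)) * polar 1 (pi - theta)).

End Contour.

Section Solution_operators.
Context {R : realType}.
Variables (l alpha beta s mu lambda : R).
Variables (rho : nat -> R) (e : nat -> L2D l) (kappa theta : R).

Definition hfun (z : R[i]) : R[i] :=
  (mu^-1)%:C * cpow z alpha * (1 + lambda%:C * cpow z (- beta)).

Definition laplace_weight (t : R) (z : R[i]) : R[i] :=
  cexp (z * t%:C) * (mu^-1)%:C * cpow z (alpha - 1).

(* S(t) for t > 0; the integral of the resolvent is tested against every
   element of L^2(0, l).  The weak form determines S(t) v since the integral
   converges absolutely in operator norm. *)
Definition solution_operator (S : R -> L2D l -> L2D l) : Prop :=
  forall t v, 0 < t -> exists G : R[i] -> L2D l * L2D l,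
    (forall z, contour kappa theta z -> is_resolvent rho e s (hfun z) v (G z))
    /\ forall w : L2D l,
      (inner (S t v) w)%:C =
      (2 * pi%:C * 'i%C)^-1 * contour_integral kappa theta
        (fun z => laplace_weight t z * (inner (G z).1 w +i* inner (G z).2 w)).

(* The contour integral is real because the contour is symmetric and the
   integrand commutes with conjugation. *)
Definition ufun (k : nat) (t : R) : R :=
  complex.Re ((2 * pi%:C * 'i%C)^-1 * contour_integral kappa theta
        (fun z => laplace_weight t z * (hfun z + (rho k `^ s)%:C)^-1)).

(* F(t, x, y) = sum_k u_k(t) e_k(x) e_k(y) for t > 0 and x in D, the series
   being summed in L^2(D) with respect to y (pointwise it need not converge
   absolutely). *)
Definition green_kernel (F : R -> R -> R -> R) : Prop :=
  measurable_fun
    ([set` `]0, +oo[] `*` [set` `]0, l[] `*` [set` `]0, l[]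
      : set (measurableTypeR R * measurableTypeR R * measurableTypeR R))
    (fun p : measurableTypeR R * measurableTypeR R * measurableTypeR R =>
       F p.1.1 p.1.2 p.2) /\
  forall t x, 0 < t -> x \in `]0, l[ ->
    (\int[muD l]_y
       ((\sum_(k < n) ufun k t * e k x * e k y - F t x y) ^+ 2)%R%:E)%E
      @[n --> \oo] --> 0%E.

End Solution_operators.

(* gamma in C^1([0, T]): the interior derivative extends continuously to
   the closed interval. *)
Definition C1_on {R : realType} (T : R) (gamma : R -> R) : Prop :=
  {within `[0, T], continuous gamma} /\
  exists2 dgamma : R -> R, {within `[0, T], continuous dgamma} &
    forall t, t \in `]0, T[ -> is_derive t 1 gamma (dgamma t).

Section Noise.
Context {R : realType} {d : measure_display} {Om : measurableType d}.
Variable P : probability Om R.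
Variables (l T : R).

Definition fbm_cov (K x y : R) : R :=
  2^-1 * (`|x| `^ (2 * K) + `|y| `^ (2 * K) - `|x - y| `^ (2 * K)).

(* Centered normal law, possibly degenerate.  The library's [normal_prob m 0]
   is not a Dirac mass, whence the case distinction. *)
Definition centered_gaussian (X : Om -> R) : Prop :=
  exists sd : R, forall B : set (measurableTypeR R), measurable B ->
    P (X @^-1` B) = if sd == 0 then \d_(0 : R) B else normal_prob 0 sd B.

(* W x t, with the space variable first. *)
Definition fractional_brownian_sheet (H1 H2 : R)
    (W : R -> R -> {RV P >-> R}) : Prop :=
  (forall n (a x t : 'I_n -> R),
     (forall i, x i \in `[0, l] /\ t i \in `[0, T]) ->
     centered_gaussian (fun om => \sum_(i < n) a i * W (x i) (t i) om)) /\
  (forall x t y r, x \in `[0, l] -> t \in `[0, T] ->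
     y \in `[0, l] -> r \in `[0, T] ->
     ('E_P[fun om => (W x t om * W y r om)%R] =
       (fbm_cov H1 x y * fbm_cov H2 t r)%R%:E)%E).

Variable W : R -> R -> {RV P >-> R}.

(* (x1, x2, t1, t2) encodes the cell (x1, x2] x (t1, t2]. *)
Definition cell : Type := R * R * R * R.

Definition cell_valid (q : cell) : bool :=
  let: (x1, x2, t1, t2) := q in
  [&& 0 <= x1, x1 <= x2, x2 <= l, 0 <= t1, t1 <= t2 & t2 <= T].

Definition cell_indic (q : cell) (y v : R) : R :=
  let: (x1, x2, t1, t2) := q in
  \1_`]x1, x2]%classic y * \1_`]t1, t2]%classic v.

(* The integral of the indicator of a cell against the noise. *)
Definition cell_noise (q : cell) (om : Om) : R :=
  let: (x1, x2, t1, t2) := q in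
  W x2 t2 om - W x1 t2 om - W x2 t1 om + W x1 t1 om.

Definition DxI : set (measurableTypeR R * measurableTypeR R) :=
  [set` `]0, l[] `*` [set` `]0, T[].

(* [X] is the Wiener integral over D x I of the deterministic [phi]: the
   closure, in L^2(D x I) x L^2(Om), of the elementary integral on step
   functions.  For H1, H2 <= 1/2 the norm E|elementary integral|^2 of a step
   function dominates its L^2(D x I) norm up to a constant, so the completion
   of the step functions under the former is a space of functions, namely the
   domain of this closure, and the value is unique almost surely. *)
Definition wiener_integral (phi : R -> R -> R) (X : Om -> R) : Prop :=
  [/\ measurable_fun DxI
        (fun p : measurableTypeR R * measurableTypeR R => phi p.1 p.2),
      measurable_fun setT X &
      exists s_ : nat -> seq (R * cell),
        [/\ forall n, all (fun aq => cell_valid aq.2) (s_ n),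
            (\int[(@lebesgue_measure R \x @lebesgue_measure R)%E]_(p in DxI)
              ((\sum_(aq <- s_ n) aq.1 * cell_indic aq.2 p.1 p.2
                - phi p.1 p.2) ^+ 2)%R%:E)%E @[n --> \oo] --> 0%E &
            ('E_P[fun om =>
              ((\sum_(aq <- s_ n) aq.1 * cell_noise aq.2 om - X om) ^+ 2)%R])%E
              @[n --> \oo] --> 0%E]].

(* The cell D_j x I_i for the steps tau = T / m, h = l / m'. *)
Definition mesh_cell (m m' i j : nat) : cell :=
  (j%:R * (l / m'%:R), j.+1%:R * (l / m'%:R),
   i%:R * (T / m%:R), i.+1%:R * (T / m%:R)).

Definition wong_zakai (m m' : nat) (om : Om) (x t : R) : R :=
  \sum_(i < m) \sum_(j < m')
    (T / m%:R * (l / m'%:R))^-1 * cell_noise (mesh_cell m m' i j) om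
    * cell_indic (mesh_cell m m' i j) x t.

End Noise.

Section Mild_solutions.
Context {R : realType} {d : measure_display} {Om : measurableType d}.
Variable P : probability Om R.
Variables (l T : R).

(* X in L^2(Om; L^2(D)); as L^2(D) is separable, measurability is tested
   weakly. *)
Definition L2Om (X : Om -> L2D l) : Prop :=
  (forall w : L2D l, measurable_fun setT (fun om => inner (X om) w)) /\
  ('E_P[fun om => (normH (X om) ^+ 2)%R] < +oo)%E.

Definition continuous_L2Om (u : R -> Om -> L2D l) : Prop :=
  (forall t, t \in `[0, T] -> L2Om (u t)) /\
  forall t0, t0 \in `[0, T] ->
    ('E_P[fun om => (normH (u t om - u t0 om) ^+ 2)%R])%E
      @[t --> within `[0, T]%classic (nbhs t0)] --> 0%E.

(* J is the integral of g over A in L^2(Om; L^2(D)), in the weak sense; the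
   integrands below are continuous and bounded in norm on A, so that it is also
   their Bochner integral.  It does not depend on the choice of versions of
   the g v. *)
Definition L2Om_integral (A : set R) (g : R -> Om -> L2D l)
    (J : Om -> L2D l) : Prop :=
  L2Om J /\
  forall psi : Om -> L2D l, L2Om psi ->
    (@lebesgue_measure R).-integrable A
      (fun v => (\int[P]_om inner (g v om) (psi om))%R%:E) /\
    \int[P]_om inner (J om) (psi om) =
      \int[@lebesgue_measure R]_(v in A) \int[P]_om inner (g v om) (psi om).

(* [conv t Z] says that Z is the noise convolution term at time t. *)
Definition mild_solution (S : R -> L2D l -> L2D l) (f : L2D l -> L2D l)
    (conv : R -> (Om -> L2D l) -> Prop) (u : R -> Om -> L2D l) : Prop :=
  continuous_L2Om u /\
  forall t, t \in `[0, T] -> exists J Z : Om -> L2D l,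
    [/\ L2Om_integral `]0, t[ (fun v om => S (t - v) (f (u v om))) J,
        L2Om Z, conv t Z &
        {ae P, forall om, eqH (u t om) (J om + Z om)}].

Variables (F : R -> R -> R -> R) (gamma : R -> R).
Variable W : R -> R -> {RV P >-> R}.

(* The Wiener integral is taken for almost every fixed x; joint measurability
   in (om, x) makes Z unique in L^2(Om; L^2(D)). *)
Definition noise_convolution (t : R) (Z : Om -> L2D l) : Prop :=
  measurable_fun setT (fun p : Om * measurableTypeR R => Z p.1 p.2) /\
  {ae muD l, forall x,
    wiener_integral l T W
      (fun y v => F (t - v) x y * gamma v * \1_`]0, t[%classic v)
      (fun om => Z om x)}.

Definition wong_zakai_convolution (m m' : nat) (t : R)
    (Z : Om -> L2D l) : Prop :=
  {ae P, forall om, {ae muD l, forall x,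
    Z om x = \int[@lebesgue_measure R]_(v in `]0, t[)
               \int[@lebesgue_measure R]_(y in `]0, l[)
                 (F (t - v) x y * gamma v * wong_zakai l T W m m' om y v)}}.

End Mild_solutions.

(* Main.v *)
Require Import Defs.
From HB Require Import structures.
From mathcomp Require Import all_boot all_order all_algebra.
From mathcomp Require Import complex.
From mathcomp Require Import all_classical all_reals all_analysis.
From mathcomp Require Import measurable_realfun.
From mathcomp Require Import ring lra.
Import Order.TTheory GRing.Theory Num.Theory.
Import numFieldNormedType.Exports.
Local Open Scope classical_set_scope.
Local Open Scope ring_scope.
Set Implicit Arguments.
Unset Strict Implicit.
Unset Printing Implicit Defensive.

(** The exponent [2 * sigma + 2 * H1 - 1] of the mesh size is negative, because
  [2 * sigma < 1 - 2 * H1], and the mesh size is at most [l].  The first term on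
  the right is therefore bounded below by a positive constant, and it suffices to
  bound the second moment of [u t - uW t] by the second moments of [u t] and
  [uW t].  That of [u t] is bounded on the time interval by continuity and
  compactness ([continuous_L2Om_bounded]).  What has to be shown is that the
  second moment of [uW t] grows at most like this power of the mesh size,
  uniformly in both steps.

  In the eigenbasis the solution operator is diagonal, with entries given by
  scalar contour integrals ([solution_operator_coeff]).  A sector estimate for
  the resolvent bounds these entries by [rr `^ (- th) * t `^ (- q)], and their
  increments in time by one more power of [t], for every [q > alpha * th]
  ([relaxation_bounds]).

  The noise term of [uW] has the explicit coefficients
  [sum_i sum_j A i * B j * cell_noise], where [A] collects averages in time of the
  entry times [gamma], and [B] averages in space of the eigenfunction
  ([noise_coeff]).  As the covariance of the sheet is a product, the variance of
  such a coefficient is the product of a time part and of a space part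
  ([sheet_variance]).  In time, summation by parts and pinning the fractional
  Brownian motion at [t] give a bound uniform in the step, since the singularity
  [q] is weaker than [H2] ([time_variance_bound]).  In space, the increments are
  negatively correlated, and the variance becomes a discrete fractional seminorm
  of [B], for which the eigenfunctions, which are sines, pay a power [2 * sigma] of
  the frequency ([space_variance_mode]).  The conditions on [s], [sigma] and [H2]
  leave room for a [th] for which the sum over the modes converges
  ([modal_exponents], [wong_zakai_second_moment]).

  A Gronwall argument in an exponentially weighted supremum norm carries the bound
  from the noise term to [uW] ([mild_mean_sqr_bound]). *)

(** * Power inequalities *)

Section PowerInequalities.
Context {R : realType}.
Implicit Types a b c d p q x y H : R.

(** Concavity, as Young's inequality for the conjugate exponents [1 / p] and
  [1 / (1 - p)]. *)
Lemma powR_le_tangent y p : 0 <= y -> 0 <= p <= 1 -> y `^ p <= 1 + p * (y - 1).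
Proof.
move=> y0 /andP[p0 p1].
have [->|pn0] := eqVneq p 0; first by rewrite powRr0 mul0r addr0.
have [->|pn1] := eqVneq p 1; first by rewrite powRr1//; lra.
have {pn0}p0 : 0 < p by rewrite lt_def pn0.
have {pn1}p1 : 0 < 1 - p by rewrite subr_gt0 lt_neqAle pn1.
have := @conjugate_powR R (y `^ p) 1 p^-1 (1 - p)^-1.
rewrite powR_ge0 ler01 !invr_gt0 p0 p1 !invrK powR1 -powRrM mulfV ?gt_eqF//.
rewrite powRr1//.
move=> /(_ isT isT isT isT) => E.
apply: (le_trans (y := y `^ p * 1)); first by rewrite mulr1.
apply: (le_trans (E _)); lra.
Qed.

(** Each summand is at least its share of the power of the sum, since a number
  in the unit interval is at most its power [p]. *)
Lemma powR_subadd x y p : 0 <= x -> 0 <= y -> 0 <= p <= 1 ->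
  (x + y) `^ p <= x `^ p + y `^ p.
Proof.
move=> x0 y0 /andP[p0 p1].
have [s0|sn0] := eqVneq (x + y) 0.
  have -> : x = 0 by lra.
  have -> : y = 0 by lra.
  by rewrite addr0 lerDl powR_ge0.
have s0 : 0 < x + y by rewrite lt_def sn0 addr_ge0.
have key z : 0 <= z -> z <= x + y -> z / (x + y) * (x + y) `^ p <= z `^ p.
  move=> z0 zs; have [->|zn0] := eqVneq z 0; first by rewrite !mul0r powR_ge0.
  have zp : 0 < z by rewrite lt_def zn0.
  have -> : z `^ p = (z / (x + y)) `^ p * (x + y) `^ p.
    by rewrite -powRM ?divr_ge0 ?(ltW s0)// divfK.
  rewrite ler_wpM2r ?powR_ge0// ger1_powR//.
  by rewrite divr_gt0//= ler_pdivrMr// mul1r.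
have -> : (x + y) `^ p = x / (x + y) * (x + y) `^ p + y / (x + y) * (x + y) `^ p.
  by rewrite -mulrDl -mulrDl divff// mul1r.
by rewrite lerD// key// ?lerDl ?lerDr.
Qed.

Lemma powR_dist a b p : 0 <= a -> 0 <= b -> 0 <= p <= 1 ->
  `|a `^ p - b `^ p| <= `|a - b| `^ p.
Proof.
move=> a0 b0 hp; have p0 : 0 <= p by case/andP: hp.
wlog ba : a b a0 b0 / b <= a.
  move=> W; have [ba|ab] := leP b a; first exact: W.
  by rewrite distrC [X in _ <= X `^ _]distrC W// ltW.
rewrite !ger0_norm ?subr_ge0//; last by rewrite ge0_ler_powR.
rewrite lerBlDr -{1}(subrK b a); apply: powR_subadd => //.
by rewrite subr_ge0.
Qed.

Lemma sqr_powR x p : 0 <= x -> (x `^ p) ^+ 2 = x `^ (2 * p).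
Proof. by move=> x0; rewrite mulrC powRrM powR_mulrn ?powR_ge0. Qed.

(** The covariance of a fractional Brownian motion pinned at 0 is at most the
  product of the standard deviations; for an index at most 1/2 this follows
  from the subadditivity of the powers [H] and [2 * H]. *)
Lemma fbm_kernel_bound x y H : 0 <= H <= 2^-1 ->
  `| `|x| `^ (2 * H) + `|y| `^ (2 * H) - `|x - y| `^ (2 * H) |
    <= 2 * (`|x| `^ H * `|y| `^ H).
Proof.
move=> /andP[H0 H12].
have hp : 0 <= 2 * H <= 1 by apply/andP; split; lra.
have hH : 0 <= H <= 1 by apply/andP; split; lra.
have nn : 0 <= `|x| `^ H * `|y| `^ H by rewrite mulr_ge0 ?powR_ge0.
have U : `|x - y| `^ (2 * H) <= `|x| `^ (2 * H) + `|y| `^ (2 * H).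
  apply: le_trans (powR_subadd (normr_ge0 x) (normr_ge0 y) hp).
  by rewrite ge0_ler_powR ?nnegrE ?addr_ge0 ?ler_normB//; case/andP: hp.
have L : (`|x| `^ H - `|y| `^ H) ^+ 2 <= `|x - y| `^ (2 * H).
  rewrite -sqr_powR// -real_normK ?num_real//.
  rewrite lerXn2r ?nnegrE ?powR_ge0//.
  apply: le_trans (powR_dist (normr_ge0 x) (normr_ge0 y) hH) _.
  by rewrite ge0_ler_powR ?nnegrE ?ler_dist_dist.
rewrite sqrrB !sqr_powR// in L.
by rewrite ler_norml; apply/andP; split; lra.
Qed.

Lemma powR_succ_sub x p : 0 < x -> 0 <= p <= 1 ->
  (x + 1) `^ p - x `^ p <= x `^ (p - 1).
Proof.
move=> x0 hp; have xn0 : x != 0 by rewrite gt_eqF.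
have -> : x + 1 = x * (1 + x^-1) by rewrite mulrDr mulr1 mulfV.
have V0 : 0 <= x^-1 by rewrite invr_ge0 ltW.
rewrite powRM ?addr_ge0 ?(ltW x0)//.
rewrite powRB ?xn0 ?implybT// powRr1 ?(ltW x0)//.
have := @powR_le_tangent (1 + x^-1) p; rewrite addr_ge0// => /(_ isT hp).
rewrite [1 + _ - 1]addrAC subrr add0r => B.
have P0 := powR_ge0 x p.
have h1 : p * x^-1 <= x^-1 by rewrite ler_piMl//; case/andP: hp.
rewrite lerBlDl -{2}[x `^ p]mulr1 -mulrDr ler_wpM2l//.
by apply: le_trans B _; rewrite lerD2l.
Qed.

Lemma powR_pred_sub x a : 1 <= x -> 0 <= a <= 1 ->
  a * x `^ (a - 1) <= x `^ a - (x - 1) `^ a.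
Proof.
move=> x1 ha; have x0 : 0 < x by lra.
have xn0 : x != 0 by rewrite gt_eqF.
have V0 : 0 <= x^-1 by rewrite invr_ge0 ltW.
have V1 : x^-1 <= 1 by rewrite invf_le1.
have -> : x - 1 = x * (1 - x^-1) by rewrite mulrBr mulr1 mulfV.
rewrite powRM ?(ltW x0)//; last by rewrite subr_ge0.
have := @powR_le_tangent (1 - x^-1) a; rewrite subr_ge0 => /(_ V1 ha) B.
rewrite powRB ?xn0 ?implybT// powRr1 ?(ltW x0)//.
have : x `^ a * (1 - x^-1) `^ a <= x `^ a * (1 + a * (1 - x^-1 - 1)).
  by rewrite ler_wpM2l// powR_ge0.
lra.
Qed.

(** Concavity of the power [a] makes the sum telescope. *)
Lemma sum_powR_le a n : 0 < a <= 1 ->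
  \sum_(1 <= i < n.+1) i%:R `^ (a - 1) <= n%:R `^ a / a.
Proof.
move=> /andP[a0 a1]; elim: n => [|n IH].
  by rewrite big_geq// divr_ge0 ?powR_ge0// ltW.
rewrite big_nat_recr//=.
have := @powR_pred_sub n.+1%:R a; rewrite ler1n (ltW a0) a1 => /(_ isT isT).
rewrite -[X in _ - (X - 1) `^ _]natr1 addrK.
rewrite -ler_pdivlMl// => B.
apply: le_trans (lerD IH B) _.
by rewrite [_^-1 * _]mulrC mulrBl addrC subrK.
Qed.

Lemma powR_neg_pred_sub x d : 1 < x -> 0 < d <= 1 ->
  d * x `^ (- 1 - d) <= (x - 1) `^ (- d) - x `^ (- d).
Proof.
move=> x1 /andP[d0 d1]; have x0 : 0 < x by lra.
have xn0 : x != 0 by rewrite gt_eqF.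
have V0 : 0 < x^-1 by rewrite invr_gt0.
have V1 : x^-1 < 1 by rewrite invf_lt1.
have -> : x - 1 = x * (1 - x^-1) by rewrite mulrBr mulr1 mulfV.
have W0 : 0 < 1 - x^-1 by rewrite subr_gt0.
rewrite powRM ?(ltW x0) ?(ltW W0)//.
have := @powR_le_tangent (1 - x^-1) d; rewrite (ltW W0) (ltW d0) d1.
move=> /(_ isT isT) B.
have P0 : 0 < (1 - x^-1) `^ d by rewrite powR_gt0.
have -> : - 1 - d = - d - 1 :> R by lra.
rewrite powRB ?xn0 ?implybT// powRr1 ?(ltW x0)//.
have E : 1 + d * x^-1 <= (1 - x^-1) `^ (- d).
  rewrite powRN -[X in _ <= X]mul1r ler_pdivlMr//.
  have dv : 0 <= d * x^-1 by rewrite mulr_ge0// ltW.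
  apply: le_trans (_ : (1 + d * x^-1) * (1 + d * (1 - x^-1 - 1)) <= _).
    by rewrite ler_wpM2l// addr_ge0.
  have : 0 <= (d * x^-1) * (d * x^-1) by rewrite mulr_ge0.
  lra.
have Q0 : 0 <= x `^ (- d) by rewrite powR_ge0.
have := ler_wpM2l Q0 E.
lra.
Qed.

(** Convexity of the power [- d] makes the sum telescope. *)
Lemma sum_powR_neg_le d n : 0 < d <= 1 ->
  \sum_(1 <= i < n) i%:R `^ (- 1 - d) <= 1 + d^-1.
Proof.
move=> hd; have /andP[d0 d1] := hd.
have D0 : 0 < d^-1 by rewrite invr_gt0.
case: n => [|n]; first by rewrite big_geq// addr_ge0// ltW.
suff : \sum_(1 <= i < n.+1) i%:R `^ (- 1 - d) <= 1 + d^-1 - n%:R `^ (- d) / d.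
  move=> /le_trans; apply; rewrite gerBl divr_ge0 ?powR_ge0// ltW//.
elim: n => [|n IH].
  by rewrite big_geq// powR0 ?mul0r ?subr0 ?addr_ge0 ?(ltW D0)// oppr_eq0 gt_eqF.
rewrite big_nat_recr//=.
case: n IH => [|n] IH.
  by rewrite big_geq// !powR1 add0r mul1r; lra.
have := @powR_neg_pred_sub n.+2%:R d; rewrite ltr1n => /(_ isT hd).
rewrite -[X in (X - 1) `^ _ - _]natr1 addrK -ler_pdivlMl// => B.
apply: le_trans (lerD IH B) _.
by rewrite [_^-1 * _]mulrC mulrBl; lra.
Qed.

(** The factor 4 comes from [expR y >= (1 + y / 2) ^+ 2], which handles all powers
  up to 2 at once. *)
Lemma expRN_le_powR y q : 0 < y -> 0 <= q <= 2 -> expR (- y) <= 4 * y `^ (- q).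
Proof.
move=> y0 /andP[q0 q2]; rewrite expRN powRN.
rewrite -[X in _ <= X]invrK invfM invrK lef_pV2 ?posrE ?expR_gt0//; last first.
  by rewrite mulr_gt0 ?powR_gt0// invr_gt0.
rewrite mulrC ler_pdivrMr//.
have [y1|y1] := leP y 1.
  have : y `^ q <= 1.
    by rewrite -(powRr0 y) ger_powR ?y0.
  have : 1 <= expR y by rewrite -expR0 ler_expR ltW.
  lra.
have e2 : expR y = expR (y / 2) ^+ 2 by rewrite -expRM_natl; congr expR; lra.
have : (1 + y / 2) ^+ 2 <= expR (y / 2) ^+ 2.
  rewrite lerXn2r ?nnegrE ?expR_ge0 ?expR_ge1Dx//; lra.
rewrite -e2 => E.
have : y `^ q <= y ^+ 2 by rewrite -powR_mulrn ?ler_powR ?(ltW y1)// ltW.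
move: E; rewrite !expr2; lra.
Qed.

Lemma geom_mean_le x y th : 0 <= x -> 0 <= y -> 0 <= th <= 1 ->
  x `^ (1 - th) * y `^ th <= x + y.
Proof.
move=> x0 y0 /andP[t0 t1].
have [s0|sn0] := eqVneq (x + y) 0.
  have -> : x = 0 by lra.
  have -> : y = 0 by lra.
  rewrite -powRD ?subrK; first by rewrite powRr1// addr0.
  by rewrite oner_eq0.
have s0 : 0 < x + y by rewrite lt_def sn0 addr_ge0.
apply: le_trans (_ : (x + y) `^ (1 - th) * (x + y) `^ th <= _).
  rewrite ler_pM ?powR_ge0// ge0_ler_powR ?nnegrE ?subr_ge0 ?lerDl ?lerDr//.
  - by rewrite addr_ge0.
  - by rewrite addr_ge0.
rewrite -powRD ?subrK; first by rewrite powRr1// ltW.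
by rewrite sn0 implybT.
Qed.

End PowerInequalities.

(** * Integrals without measurability of the integrand *)

Section IntegralBounds.
Context {dd : measure_display} {T : measurableType dd} {R : realType}.
Variable mu : {measure set T -> \bar R}.
Implicit Types (D : set T).

(** The integral of a nonnegative function is a supremum over the simple
  functions below it, so monotonicity involves no measurability. *)
Lemma ge0_le_integral_dom D (f g : T -> \bar R) :
  (forall x, D x -> (0 <= f x)%E) -> (forall x, D x -> (f x <= g x)%E) ->
  (\int[mu]_(x in D) f x <= \int[mu]_(x in D) g x)%E.
Proof.
move=> f0 fg; have g0 x : D x -> (0 <= g x)%E.
  by move=> Dx; exact: le_trans (f0 x Dx) (fg x Dx).
rewrite !ge0_integralE//; apply: ereal_sup_le => _ [h hf <-]; exists h => //.
move=> x; apply: le_trans (hf x) _; rewrite !patchE.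
by case: ifPn => // /set_mem; exact: fg.
Qed.

(** Domination bounds the positive and the negative part separately; this serves
  integrands whose measurability is unknown. *)
Lemma le_abs_Rintegral_dom D (f b : T -> R) : measurable D ->
  mu.-integrable D (EFin \o b) -> (forall x, D x -> `|f x| <= b x) ->
  `|\int[mu]_(x in D) f x| <= \int[mu]_(x in D) b x.
Proof.
move=> mD ib fb.
have bE : (\int[mu]_(x in D) (b x)%:E)%E = (\int[mu]_(x in D) b x)%:E.
  by rewrite /Rintegral fineK// integrable_fin_num.
have b0 x : D x -> 0 <= b x by move=> Dx; exact: le_trans (fb x Dx).
have P : (\int[mu]_(x in D) (EFin \o f)^\+ x <= (\int[mu]_(x in D) b x)%:E)%E.
  rewrite -bE; apply: ge0_le_integral_dom => // x Dx; rewrite funeposE/=.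
  rewrite -EFin_max lee_fin ge_max b0// andbT.
  exact: le_trans (ler_norm _) (fb x Dx).
have N : (\int[mu]_(x in D) (EFin \o f)^\- x <= (\int[mu]_(x in D) b x)%:E)%E.
  rewrite -bE; apply: ge0_le_integral_dom => // x Dx; rewrite funenegE/=.
  rewrite -EFin_max lee_fin ge_max b0// andbT.
  by apply: le_trans (fb x Dx); rewrite -normrN ler_norm.
have P0 : (0 <= \int[mu]_(x in D) (EFin \o f)^\+ x)%E by exact: integral_ge0.
have N0 : (0 <= \int[mu]_(x in D) (EFin \o f)^\- x)%E by exact: integral_ge0.
rewrite {1}/Rintegral integralE.
move: P0 N0 P N; set p := integral _ _ _; set n := integral _ _ _.
case: p => [p||]//; case: n => [n||]//; rewrite /= !lee_fin => p0 n0 P N.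
by rewrite ler_norml; apply/andP; split; lra.
Qed.

Lemma integrable_dom D (f : T -> R) (b : T -> R) : measurable D ->
  measurable_fun D f -> mu.-integrable D (EFin \o b) ->
  (forall x, D x -> `|f x| <= b x) -> mu.-integrable D (EFin \o f).
Proof.
move=> mD mf ib fb; apply: le_integrable ib => //; first exact/measurable_EFinP.
move=> x Dx; rewrite /= lee_fin; apply: le_trans (fb x Dx) _; exact: ler_norm.
Qed.

Lemma integrable_scale D (A : R) (f : T -> R) : measurable D ->
  mu.-integrable D (EFin \o f) -> mu.-integrable D (EFin \o (fun x => A * f x)).
Proof.
by move=> mD /(integrableZl mD A); apply: eq_integrable => // x _; rewrite /= EFinM.
Qed.

End IntegralBounds.

Section RestrictedLebesgue.
Context {R : realType}.
Variable l : R.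
Notation mu := (@lebesgue_measure R).

Lemma integral_muD_itv (f : R -> \bar R) :
  (\int[muD l]_(x in `]0%R, l[) f x = \int[mu]_(x in `]0%R, l[) f x)%E.
Proof.
apply: eq_measure_integral => A mA A01.
by rewrite /muD /= /mrestr setIidl.
Qed.

Lemma ae_muD_itv (Q : R -> Prop) : (forall x, x \in `]0, l[ -> Q x) ->
  {ae muD l, forall x, Q x}.
Proof.
move=> H; exists (~` [set` `]0, l[]); split.
- exact: measurableC.
- by rewrite /muD /= /mrestr setICl measure0.
- by move=> x /= nQ xin; apply: nQ; exact: H.
Qed.

Lemma integral_muD (f : R -> \bar R) : measurable_fun setT f ->
  (\int[muD l]_x f x = \int[mu]_(x in `]0%R, l[) f x)%E.
Proof.
move=> mf; rewrite -integral_muD_itv [RHS]integral_mkcond.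
apply: ae_eq_integral => //.
  by apply/(measurable_restrictT _ _).1 => //; exact: measurable_funTS.
apply: ae_muD_itv => x xin _.
by rewrite patchE mem_set.
Qed.

Lemma ge0_integral_muD_ge (f : R -> \bar R) : (forall x, (0 <= f x)%E) ->
  (\int[mu]_(x in `]0%R, l[) f x <= \int[muD l]_x f x)%E.
Proof.
move=> f0; rewrite -integral_muD_itv integral_mkcond.
apply: ge0_le_integral_dom => x _; rewrite patchE; case: ifPn => //.
Qed.

Lemma muD_fin : (muD l setT < +oo)%E.
Proof.
by rewrite /muD /= /mrestr setTI lebesgue_measure_itv/=; case: ifP; rewrite ltry.
Qed.

End RestrictedLebesgue.

Section PowerIntegrals.
Context {R : realType}.
Notation mu := (@lebesgue_measure R).

Lemma is_derive_powR (x p : R) : 0 < x ->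
  is_derive x 1 (fun y : R => y `^ p) (p * x `^ (p - 1)).
Proof. exact: is_derive1_powR. Qed.

Lemma continuous_powR_gt0 (x p : R) : 0 < x -> {for x, continuous (fun y : R => y `^ p)}.
Proof.
move=> x0; apply: differentiable_continuous; apply/derivable1_diffP.
by have [] := is_derive_powR p x0.
Qed.

Lemma integrable_powR_tail (k d : R) : 0 < k -> 0 < d ->
  mu.-integrable `[k, +oo[ (EFin \o (fun x => x `^ (- 1 - d))).
Proof.
move=> k0 d0; apply/integrableP; split.
  apply/measurable_EFinP; apply: measurable_funTS; exact: measurable_powR.
under eq_integral do rewrite /= ger0_norm ?powR_ge0//.
pose F : R -> R := fun x : R => - d^-1 * x `^ (- d).
have dF (x : R) : 0 < x -> is_derive x (1 : R) F (x `^ (- 1 - d)).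
  move=> x0; have := is_derive_powR (- d) x0 => ?.
  apply: is_derive_eq.
  by rewrite /GRing.scale/= mulrA mulrNN mulVf ?gt_eqF// mul1r; congr (_ `^ _); lra.
rewrite (@ge0_continuous_FTC2y _ _ F k 0).
- by rewrite -EFinB ltry.
- by move=> x _; exact: powR_ge0.
- apply: continuous_in_subspaceT => x /set_mem/=; rewrite in_itv/= andbT => kx.
  by apply: continuous_powR_gt0; exact: lt_le_trans kx.
- rewrite -(mulr0 (- d^-1)); apply: cvgM; first exact: cvg_cst.
  apply/cvgrPdist_le => e e0; near=> x.
  have x0 : 0 < x by near: x; apply: nbhs_pinfty_gt; rewrite num_real.
  have xe : e^-1 `^ d^-1 <= x by near: x; apply: nbhs_pinfty_ge; rewrite num_real.
  rewrite sub0r normrN ger0_norm ?powR_ge0// powRN.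
  rewrite -[X in _ <= X]invrK lef_pV2 ?posrE ?powR_gt0 ?invr_gt0//.
  have -> : e^-1 = (e^-1 `^ d^-1) `^ d.
    by rewrite -powRrM mulVf ?gt_eqF// powRr1// invr_ge0 ltW.
  rewrite ge0_ler_powR ?nnegrE ?powR_ge0 ?(ltW d0) ?(ltW x0)//.
- by move=> x kx; have [] := dF x (lt_trans k0 kx).
- apply: cvg_at_right_filter; apply: differentiable_continuous.
  by apply/derivable1_diffP; have [] := dF k k0.
- move=> x; rewrite in_itv/= andbT => kx.
  by have x0 := lt_trans k0 kx; rewrite derive1E; have [_ ->] := dF x x0.
Unshelve. all: by end_near. Qed.

End PowerIntegrals.

(** * Weakly singular integrals *)

Section SingularIntegrals.
Context {R : realType}.
Notation mu := (@lebesgue_measure R).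

Lemma measurable_powR_sub (t q : R) (D : set R) :
  measurable_fun D (fun v : R => (t - v) `^ q).
Proof.
apply: measurable_funTS; apply: (measurableT_comp (measurable_powR q)).
exact: measurable_funB.
Qed.

Lemma integral_powR_sub_le (a b t q : R) : a < b -> b < t -> 0 <= q < 1 ->
  (\int[mu]_(v in `[a, b]) ((t - v) `^ (- q))%:E
     <= ((t - a) `^ (1 - q) / (1 - q))%:E)%E.
Proof.
move=> ab bt /andP[q0 q1].
have p0 : 0 < 1 - q by rewrite subr_gt0.
pose F : R -> R := fun v : R => - (1 - q)^-1 * (t - v) `^ (1 - q).
have dF (x : R) : x < t -> is_derive x (1 : R) F ((t - x) `^ (- q)).
  move=> xt; have tx : 0 < t - x by rewrite subr_gt0.
  have D1 : is_derive x 1 (fun v : R => t - v) (-1 : R).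
    by apply: is_derive_eq; rewrite add0r mul1r.
  have D2 := is_derive_powR (1 - q) tx.
  have D3 := @is_derive1_comp _ (fun y => y `^ (1 - q)) (fun v : R => t - v) x _ _ D2 D1.
  rewrite /comp in D3; apply: is_derive_eq.
  have -> : 1 - q - 1 = - q by lra.
  by rewrite /GRing.scale/=; field; rewrite gt_eqF.
have cF (x : R) : x < t -> {for x, continuous F}.
  move=> xt; apply: differentiable_continuous; apply/derivable1_diffP.
  by have [] := dF x xt.
rewrite (@continuous_FTC2 _ _ F).
- rewrite -EFinB lee_fin /F.
  have : 0 <= (1 - q)^-1 * (t - b) `^ (1 - q).
    by rewrite mulr_ge0 ?powR_ge0// invr_ge0 ltW.
  rewrite [X in _ <= X]mulrC; lra.
- exact: ab.
- apply: continuous_in_subspaceT => x /set_mem/=; rewrite in_itv/= => /andP[_ xb].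
  have tx : 0 < t - x by rewrite subr_gt0 (le_lt_trans xb).
  have := @continuous_comp _ _ _ (fun v : R => t - v) (fun y : R => y `^ (- q)) x.
  apply; last exact: continuous_powR_gt0.
  by apply: continuousB; [exact: cst_continuous|exact: cvg_id].
- split.
  + move=> x; rewrite in_itv/= => /andP[_ xb].
    by have [] := dF x (lt_trans xb bt).
  + by apply: cvg_at_right_filter; exact: (cF a (lt_trans ab bt)).
  + by apply: cvg_at_left_filter; exact: (cF b bt).
- move=> x; rewrite in_itv/= => /andP[_ xb].
  by rewrite derive1E; have [_ ->] := dF x (lt_trans xb bt).
Qed.

(** The explicit primitive is available on closed intervals ending before the
  singularity, and these exhaust the interval. *)
Lemma integral_powR_sing (a t q : R) : a < t -> 0 <= q < 1 ->
  (\int[mu]_(v in `]a, t[) ((t - v) `^ (- q))%:E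
     <= ((t - a) `^ (1 - q) / (1 - q))%:E)%E.
Proof.
move=> at0 hq; have d0 : 0 < t - a by rewrite subr_gt0.
pose F (n : nat) : set R := [set` `[a, t - (t - a) / n.+2%:R]].
have mpow D : measurable_fun D (fun v : R => ((t - v) `^ (- q))%:E).
  by apply/measurable_EFinP; apply: measurable_powR_sub.
have FU : `]a, t[%classic `<=` \bigcup_n F n.
  move=> v /=; rewrite in_itv/= => /andP[av vt].
  exists (Num.truncn ((t - a) / (t - v))) => //.
  rewrite /F/= in_itv/= (ltW av)/= lerBrDr -lerBrDl.
  rewrite ler_pdivrMr// -ler_pdivrMl ?subr_gt0// mulrC.
  have : (t - a) / (t - v) < (Num.truncn ((t - a) / (t - v))).+1%:R.
    by rewrite truncnS_gt.
  move=> /ltW H; apply: le_trans H _; by rewrite ler_nat.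
apply: (@le_trans _ _ (\int[mu]_(v in \bigcup_n F n) ((t - v) `^ (- q))%:E)%E).
  apply: ge0_subset_integral => //.
  - by apply: bigcup_measurable => n _; rewrite /F; exact: measurable_itv.
  - exact: mpow.
  - by move=> v _; rewrite lee_fin powR_ge0.
have CV : (\int[mu]_(v in F n) ((t - v) `^ (- q))%:E)%E @[n --> \oo] -->
    (\int[mu]_(v in \bigcup_n F n) ((t - v) `^ (- q))%:E)%E.
  apply: ge0_nondecreasing_set_cvg_integral.
  - move=> n m nm; apply/subsetPset => v; rewrite /F/= !in_itv/=.
    move=> /andP[-> /= H]; apply: le_trans H _; rewrite lerD2l lerN2.
    by rewrite ler_wpM2l ?(ltW d0)// lef_pV2 ?posrE// ler_nat.
  - by move=> n; exact: measurable_itv.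
  - by move=> n; exact: mpow.
  - by move=> n v _; rewrite lee_fin powR_ge0.
rewrite -(cvg_lim _ CV)//; apply: lime_le; first by apply/cvg_ex; eexists; exact: CV.
apply: nearW => n; apply: integral_powR_sub_le => //.
  rewrite -subr_gt0; have -> : t - (t - a) / n.+2%:R - a = (t - a) * (1 - n.+2%:R^-1).
    by ring.
  by rewrite mulr_gt0// subr_gt0 invf_lt1// ltr1n.
by rewrite -subr_gt0 opprB addrC subrK divr_gt0.
Qed.

Lemma integrable_powR_sing (a b t q : R) : b <= t -> 0 <= q < 1 ->
  mu.-integrable `]a, b[ (EFin \o (fun v => (t - v) `^ (- q))).
Proof.
move=> bt hq; have [ba|ab] := leP b a.
  by rewrite set_itv_ge -?leNgt ?bnd_simp//; exact: integrable_set0.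
apply/integrableP; split; first (by apply/measurable_EFinP; apply: measurable_powR_sub).
under eq_integral do rewrite /= ger0_norm ?powR_ge0//.
apply: le_lt_trans (_ : _ <= \int[mu]_(v in `]a, t[) ((t - v) `^ (- q))%:E)%E _.
  apply: ge0_subset_integral => //.
  - by apply/measurable_EFinP; apply: measurable_powR_sub.
  - by move=> v _; rewrite lee_fin powR_ge0.
  - by apply: subset_itvl; rewrite bnd_simp.
by apply: le_lt_trans (integral_powR_sing (lt_le_trans ab bt) hq) _; rewrite ltry.
Qed.

Lemma Rintegral_powR_sing (a b t q : R) : a < b -> b <= t -> 0 <= q < 1 ->
  \int[mu]_(v in `]a, b[) (t - v) `^ (- q) <= (b - a) `^ (1 - q) / (1 - q).
Proof.
move=> ab bt hq; have /andP[q0 q1] := hq.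
rewrite /Rintegral -lee_fin fineK; last first.
  by apply: integrable_fin_num => //; exact: integrable_powR_sing.
apply: le_trans (integral_powR_sing ab hq).
apply: ge0_le_integral_dom => v; rewrite /= in_itv/= => /andP[_ vb].
  by rewrite lee_fin powR_ge0.
rewrite lee_fin !powRN lef_pV2 ?posrE ?powR_gt0 ?subr_gt0//; last first.
  exact: lt_le_trans bt.
rewrite ge0_ler_powR ?nnegrE ?subr_ge0 ?(ltW vb)//.
- exact: ltW (lt_le_trans vb bt).
- by rewrite lerD2r.
Qed.

End SingularIntegrals.

(** * Lipschitz bounds and complex polar coordinates *)

Local Notation normc := ComplexField.Normc.normc.

Section MeanValueBounds.
Context {R : realType}.

Lemma lipschitz_of_derive (f df : R -> R) (a b K : R) : a <= b ->
  (forall x : R, x \in `]a, b[ -> is_derive x (1 : R) f (df x)) ->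
  {within `[a, b], continuous f} ->
  (forall x : R, x \in `]a, b[ -> `|df x| <= K) -> `|f b - f a| <= K * (b - a).
Proof.
rewrite le_eqVlt => /predU1P[->|ab] fd fc dK; first by rewrite !subrr normr0 mulr0.
have [c cab ->] := MVT ab fd fc.
rewrite normrM [`|b - a|]ger0_norm ?subr_ge0 ?(ltW ab)//.
by rewrite ler_wpM2r ?subr_ge0 ?(ltW ab)// dK.
Qed.

Lemma lipschitz_of_derive_all (f df : R -> R) (K : R) :
  (forall x, is_derive x (1 : R) f (df x)) -> (forall x, `|df x| <= K) ->
  forall x y, `|f x - f y| <= K * `|x - y|.
Proof.
move=> fd dK x y; wlog yx : x y / y <= x.
  move=> W; have [yx|/ltW xy] := leP y x; first exact: W.
  by rewrite distrC [`|x - y|]distrC W.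
rewrite [`|x - y|]ger0_norm ?subr_ge0//.
apply: (@lipschitz_of_derive f df) => // z.
apply: continuous_subspaceT => {}z; apply: differentiable_continuous.
by apply/derivable1_diffP; have [] := fd z.
Qed.

Lemma sin_lip (x y : R) : `|sin x - sin y| <= `|x - y|.
Proof.
rewrite -[X in _ <= X]mul1r.
apply: (@lipschitz_of_derive_all sin cos) => z.
by rewrite ler_norml cos_geN1 cos_le1.
Qed.

Lemma cos_lip (x y : R) : `|cos x - cos y| <= `|x - y|.
Proof.
rewrite -[X in _ <= X]mul1r.
apply: (@lipschitz_of_derive_all cos (fun z => - sin z)) => z.
by rewrite normrN ler_norml sin_geN1 sin_le1.
Qed.

Lemma expR_sub1_le (u : R) : `|1 - expR u| <= `|u| * expR (Num.max u 0).
Proof.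
have [u0|u0] := leP u 0.
  rewrite expR0 mulr1 ger0_norm; last by rewrite subr_ge0 -expR0 ler_expR.
  rewrite ler0_norm//; have := expR_ge1Dx u; lra.
rewrite ler0_norm; last by rewrite subr_le0 -expR0 ler_expR ltW.
rewrite gtr0_norm// opprB.
have := expR_ge1Dx (- u) => H.
have E : expR u * expR (- u) = 1 by rewrite -expRD subrr expR0.
have := ler_wpM2l (expR_ge0 u) H.
rewrite E; lra.
Qed.

End MeanValueBounds.

Section PolarForm.
Context {R : realType}.
Local Open Scope complex_scope.
Implicit Types (r psi a w : R) (z : R[i]).

Lemma normcE_ReIm z :
  normc z = Num.sqrt (complex.Re z ^+ 2 + complex.Im z ^+ 2).
Proof. by case: z. Qed.

Lemma normc_ge0 z : 0 <= normc z.
Proof. by rewrite normcE_ReIm sqrtr_ge0. Qed.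

Lemma ler_Re_normc z : `|complex.Re z| <= normc z.
Proof. by rewrite normcE_ReIm -sqrtr_sqr ler_wsqrtr// lerDl sqr_ge0. Qed.

Lemma ler_Im_normc z : `|complex.Im z| <= normc z.
Proof. by rewrite normcE_ReIm -sqrtr_sqr ler_wsqrtr// lerDr sqr_ge0. Qed.

Lemma normc_le_ReIm z : normc z <= `|complex.Re z| + `|complex.Im z|.
Proof.
rewrite normcE_ReIm -(@ger0_norm _ (`|complex.Re z| + _)) ?addr_ge0//.
rewrite -sqrtr_sqr ler_wsqrtr// sqrrD !real_normK ?num_real//.
have : 0 <= `|complex.Re z| * `|complex.Im z| by rewrite mulr_ge0.
lra.
Qed.

(** A complex number is at least as large as its component in any direction;
  choosing the direction well gives lower bounds in sectors. *)
Lemma proj_le_normc z w :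
  complex.Re z * cos w + complex.Im z * sin w <= normc z.
Proof.
rewrite normcE_ReIm; apply: le_trans (ler_norm _) _.
rewrite -sqrtr_sqr ler_wsqrtr//.
have cs := cos2Dsin2 w.
move: (complex.Re z) (complex.Im z) cs => x y.
set c := cos w; set d := sin w => cs.
have -> : x ^+ 2 + y ^+ 2 = (x ^+ 2 + y ^+ 2) * (c ^+ 2 + d ^+ 2) by rewrite cs mulr1.
have := sqr_ge0 (x * d - y * c); rewrite !expr2; lra.
Qed.

Lemma normc_real a : normc a%:C = `|a|.
Proof. by rewrite normcE_ReIm/= expr0n/= addr0 sqrtr_sqr. Qed.

Lemma normc_polar r psi : 0 <= r -> normc (polar r psi) = r.
Proof.
move=> r0; rewrite normcE_ReIm/= !exprMn -mulrDr cos2Dsin2 mulr1 sqrtr_sqr.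
by rewrite ger0_norm.
Qed.

Lemma carg_polar r psi : 0 < r -> `|psi| < pi -> carg (polar r psi) = psi.
Proof.
move=> r0; rewrite ltr_norml => /andP[p1 p2].
rewrite /carg normc_polar ?(ltW r0)//= mulrAC mulfV ?gt_eqF// mul1r.
have [p0|p0] := leP 0 psi.
  rewrite pmulr_rge0// sin_ge0_pi ?p0 ?(ltW p2)//.
  by rewrite cosK// in_itv/= p0 ltW.
rewrite pmulr_rge0// leNgt.
have -> : sin psi < 0.
  by rewrite -oppr_gt0 -sinN sin_gt0_pi// oppr_gt0 p0 ltrNl.
by rewrite /= cosKN ?opprK// (ltW p0) (ltW p1).
Qed.

Lemma cpow_polar r psi a : 0 < r -> `|psi| < pi ->
  cpow (polar r psi) a = polar (r `^ a) (a * psi).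
Proof. by move=> r0 pp; rewrite /cpow carg_polar// normc_polar// ltW. Qed.

Lemma normc_cexp z : normc (cexp z) = expR (complex.Re z).
Proof. by rewrite normc_polar// expR_ge0. Qed.

Lemma cexpD z (w : R[i]) : cexp (z + w) = cexp z * cexp w.
Proof.
case: z => x y; case: w => a b; rewrite /cexp /polar/= expRD cosD sinD.
by apply/eqP; rewrite eq_complex/=; apply/andP; split; apply/eqP; ring.
Qed.

(** The factor 3 counts the increments of [expR], [cos] and [sin]; the maximum
  accounts for exponents with positive real part. *)
Lemma normc_1Bcexp z :
  normc (1 - cexp z) <= 3 * normc z * expR (Num.max (complex.Re z) 0).
Proof.
set E := expR _; have E1 : 1 <= E by rewrite -expR0 ler_expR le_max lexx orbT.
have Ex : expR (complex.Re z) <= E by rewrite ler_expR le_max lexx.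
have E0 := expR_ge0 (complex.Re z).
have H1 := expR_sub1_le (complex.Re z).
have H2 : `|1 - cos (complex.Im z)| <= `|complex.Im z|.
  by have := cos_lip 0 (complex.Im z); rewrite cos0 sub0r normrN.
have H3 : `|sin (complex.Im z)| <= `|complex.Im z|.
  by have := sin_lip (complex.Im z) 0; rewrite sin0 !subr0.
have X := ler_Re_normc z; have Y := ler_Im_normc z.
have N0 := normc_ge0 z.
apply: le_trans (normc_le_ReIm _) _.
case: z H1 H2 H3 X Y N0 @E E1 Ex E0 => x y /= H1 H2 H3 X Y N0 E1 Ex E0.
set E := expR (Num.max x 0) in H1 E1 Ex *; set N := Num.sqrt _ in X Y N0 *.
have -> : 1 - expR x * cos y = (1 - expR x) + expR x * (1 - cos y) by ring.
have A1 : `|1 - expR x| <= N * E.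
  by apply: le_trans H1 _; rewrite ler_wpM2r// (le_trans ler01).
have A2 : `|expR x * (1 - cos y)| <= N * E.
  rewrite normrM ger0_norm// mulrC ler_pM//; exact: le_trans H2 Y.
have A3 : `|expR x * sin y| <= N * E.
  rewrite normrM ger0_norm// mulrC ler_pM//; exact: le_trans H3 Y.
rewrite sub0r normrN.
have := ler_normD (1 - expR x) (expR x * (1 - cos y)).
lra.
Qed.

End PolarForm.

(** * Integrals over the contour *)

Section ComplexMeasurability.
Context {R : realType}.
Local Open Scope complex_scope.
Implicit Types (D : set R) (G : R -> R[i]).

Definition cmeasurable D G :=
  measurable_fun D (fun x => complex.Re (G x)) /\
  measurable_fun D (fun x => complex.Im (G x)).

Lemma cmeasurable_eq D G1 G2 : (forall x, D x -> G1 x = G2 x) ->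
  cmeasurable D G1 -> cmeasurable D G2.
Proof.
move=> E [m1 m2]; split.
- by apply: eq_measurable_fun m1 => x /set_mem /E ->.
- by apply: eq_measurable_fun m2 => x /set_mem /E ->.
Qed.

Lemma cmeasurable_cst D (c : R[i]) : cmeasurable D (fun=> c).
Proof. by split; exact: measurable_cst. Qed.

Lemma cmeasurableD D G1 G2 : cmeasurable D G1 -> cmeasurable D G2 ->
  cmeasurable D (fun x => G1 x + G2 x).
Proof.
move=> [m1 m2] [n1 n2]; split.
- apply: (eq_measurable_fun (fun x => complex.Re (G1 x) + complex.Re (G2 x))).
    by move=> x _; case: (G1 x) (G2 x) => ? ? [].
  exact: measurable_funD.
- apply: (eq_measurable_fun (fun x => complex.Im (G1 x) + complex.Im (G2 x))).
    by move=> x _; case: (G1 x) (G2 x) => ? ? [].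
  exact: measurable_funD.
Qed.

Lemma cmeasurableM D G1 G2 : cmeasurable D G1 -> cmeasurable D G2 ->
  cmeasurable D (fun x => G1 x * G2 x).
Proof.
move=> [m1 m2] [n1 n2]; split.
- apply: (eq_measurable_fun (fun x => complex.Re (G1 x) * complex.Re (G2 x)
     - complex.Im (G1 x) * complex.Im (G2 x))).
    by move=> x _; case: (G1 x) (G2 x) => ? ? [].
  by apply: measurable_funB; exact: measurable_funM.
- apply: (eq_measurable_fun (fun x => complex.Re (G1 x) * complex.Im (G2 x)
     + complex.Im (G1 x) * complex.Re (G2 x))).
    by move=> x _; case: (G1 x) (G2 x) => ? ? [].
  by apply: measurable_funD; exact: measurable_funM.
Qed.

Lemma cmeasurableV D G : cmeasurable D G -> cmeasurable D (fun x => (G x)^-1).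
Proof.
move=> [m1 m2].
pose N x := (complex.Re (G x) * complex.Re (G x)
             + complex.Im (G x) * complex.Im (G x)) `^ (-1).
have NE x : N x = (complex.Re (G x) ^+ 2 + complex.Im (G x) ^+ 2)^-1.
  by rewrite /N powR_inv1 -?expr2// addr_ge0 ?sqr_ge0.
have mN : measurable_fun D N.
  apply: (measurableT_comp (measurable_powR (-1))).
  by apply: measurable_funD; exact: measurable_funM.
split.
- apply: (eq_measurable_fun (fun x => complex.Re (G x) * N x)).
    by move=> x _; rewrite NE; case: (G x).
  exact: measurable_funM.
- apply: (eq_measurable_fun (fun x => -1 * complex.Im (G x) * N x)).
    by move=> x _; rewrite NE mulN1r mulNr; case: (G x).
  by apply: measurable_funM => //; apply: measurable_funM => //; exact: measurable_cst.
Qed.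

Lemma cmeasurable_polar D (a b : R -> R) :
  measurable_fun D a -> measurable_fun D b ->
  cmeasurable D (fun x => polar (a x) (b x)).
Proof.
move=> ma mb; split; apply: measurable_funM => //.
- apply: measurableT_comp mb; apply: continuous_measurable_fun.
  exact: continuous_cos.
- apply: measurableT_comp mb; apply: continuous_measurable_fun.
  exact: continuous_sin.
Qed.

Lemma cmeasurable_cexp D G : cmeasurable D G ->
  cmeasurable D (fun x => cexp (G x)).
Proof.
move=> [m1 m2]; apply: cmeasurable_polar => //.
exact: (measurableT_comp (@measurable_expR R)).
Qed.

End ComplexMeasurability.

Lemma pi_sub_gt0 (R : realType) (theta : R) : theta < pi / 2 -> 0 < pi - theta.
Proof. by move=> h; have := pi_gt0 R; lra. Qed.

Section ContourIntegrals.
Context {R : realType}.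
Local Open Scope complex_scope.
Notation mu := (@lebesgue_measure R).

Implicit Types (D : set R) (G : R -> R[i]).

Definition cintegrable (D : set R) (G : R -> R[i]) :=
  mu.-integrable D (EFin \o (fun x => complex.Re (G x))) /\
  mu.-integrable D (EFin \o (fun x => complex.Im (G x))).

Lemma cintegrable_dom D G (b : R -> R) : measurable D -> cmeasurable D G ->
  mu.-integrable D (EFin \o b) -> (forall x, D x -> normc (G x) <= b x) ->
  cintegrable D G.
Proof.
move=> mD [m1 m2] ib Gb; split; apply: integrable_dom ib _ => // x Dx;
  apply: le_trans (Gb x Dx); [exact: ler_Re_normc|exact: ler_Im_normc].
Qed.

Lemma normc_Cintegral_le D G (b : R -> R) : measurable D ->
  mu.-integrable D (EFin \o b) -> (forall x, D x -> normc (G x) <= b x) ->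
  normc (Cintegral D G) <= 2 * \int[mu]_(x in D) b x.
Proof.
move=> mD ib Gb; apply: le_trans (normc_le_ReIm _) _ => /=.
rewrite mulr2n mulrDl mul1r; apply: lerD; apply: le_abs_Rintegral_dom => // x Dx;
  apply: le_trans (Gb x Dx); [exact: ler_Re_normc|exact: ler_Im_normc].
Qed.

Lemma CintegralB D G1 G2 : measurable D -> cintegrable D G1 -> cintegrable D G2 ->
  Cintegral D G1 - Cintegral D G2 = Cintegral D (fun x => G1 x - G2 x).
Proof.
move=> mD [i1 i2] [j1 j2]; rewrite /Cintegral.
have -> : \int[mu]_(x in D) complex.Re (G1 x - G2 x) =
    \int[mu]_(x in D) complex.Re (G1 x) - \int[mu]_(x in D) complex.Re (G2 x).
  rewrite -RintegralB//; apply: eq_Rintegral => x _.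
  by case: (G1 x) (G2 x) => ? ? [].
have -> : \int[mu]_(x in D) complex.Im (G1 x - G2 x) =
    \int[mu]_(x in D) complex.Im (G1 x) - \int[mu]_(x in D) complex.Im (G2 x).
  rewrite -RintegralB//; apply: eq_Rintegral => x _.
  by case: (G1 x) (G2 x) => ? ? [].
by [].
Qed.

Lemma eq_Cintegral D G1 G2 : (forall x, D x -> G1 x = G2 x) ->
  Cintegral D G1 = Cintegral D G2.
Proof.
by move=> E; congr (_ +i* _); apply: eq_Rintegral => x /set_mem Dx; rewrite E.
Qed.

Variables kappa theta : R.
Notation phi := (pi - theta).

(** Each ray contributes a real and an imaginary part, whence the first factor 4;
  the second one is made of these two parts and of the two halves of the arc. *)
Lemma normc_contour_le (g : R[i] -> R[i]) (b : R -> R) (M : R) :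
  0 < kappa -> theta < pi / 2 ->
  mu.-integrable `[kappa, +oo[ (EFin \o b) -> 
  (forall r psi, kappa <= r -> `|psi| = phi -> normc (g (polar r psi)) <= b r) ->
  (forall psi, `|psi| <= phi -> normc (g (polar kappa psi)) <= M) ->
  normc (contour_integral kappa theta g) <=
    4 * (\int[mu]_(x in `[kappa, +oo[) b x) + 4 * (kappa * M * phi).
Proof.
move=> kappa0 theta1 ib gb gM.
have phi0 : 0 <= phi.
  exact: ltW (pi_sub_gt0 theta1).
rewrite /contour_integral.
have H1 psi : `|psi| = phi -> normc (Cintegral `[kappa, +oo[
      (fun r => g (polar r psi) * polar 1 psi)) <=
    2 * \int[mu]_(x in `[kappa, +oo[) b x.
  move=> pp; apply: normc_Cintegral_le => // r; rewrite /= in_itv/= andbT => kr.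
  by rewrite ComplexField.Normc.normcM normc_polar// mulr1 gb.
have H2 : normc (Cintegral `[- phi, phi]
      (fun psi => g (polar kappa psi) * ('i%C * polar kappa psi))) <=
    2 * (kappa * M * (phi + phi)).
  have E : kappa * M * (phi + phi) = \int[mu]_(psi in `[- phi, phi]) (kappa * M).
    rewrite Rintegral_cst//= lebesgue_measure_itv/= lte_fin.
    case: ltP => [_|H]/=; first by rewrite opprK.
    by rewrite (_ : phi = 0) ?addr0 ?mulr0//; lra.
  rewrite E; apply: normc_Cintegral_le => //.
    apply/integrableP; split; first by apply/measurable_EFinP; exact: measurable_cst.
    rewrite (@integral_cst _ _ _ mu _ _ `|kappa * M|%:E)//= lebesgue_measure_itv/=.
    by case: ifP => _; rewrite -?EFinB -?EFinM ?mule0 ltry.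
  move=> psi; rewrite /= in_itv/= -ler_norml => pp.
  rewrite !ComplexField.Normc.normcM normc_polar ?(ltW kappa0)//.
  have -> : normc ('i%C : R[i]) = 1 by rewrite normcE_ReIm/= expr0n/= expr1n add0r sqrtr1.
  by rewrite mul1r mulrC ler_wpM2l ?(ltW kappa0)// gM.
have T := ComplexField.Normc.normcM.
have TD (x y : R[i]) : normc (x + y) <= normc x + normc y by exact: le_normcD.
have TN (x : R[i]) : normc (- x) = normc x by exact: normcN.
apply: le_trans (TD _ _) _.
apply: le_trans (lerD (TD _ _) (lexx _)) _.
rewrite TN.
have A1 := H1 (- phi); rewrite normrN ger0_norm// in A1.
have A2 := H1 phi; rewrite ger0_norm// in A2.
have := A1 erefl; have := A2 erefl; lra.
Qed.

Definition contour_integrable (g : R[i] -> R[i]) :=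
  [/\ cintegrable `[kappa, +oo[ (fun r => g (polar r (- phi)) * polar 1 (- phi)),
      cintegrable `[kappa, +oo[ (fun r => g (polar r phi) * polar 1 phi) &
      cintegrable `[- phi, phi]
        (fun psi => g (polar kappa psi) * ('i%C * polar kappa psi))].

Lemma contour_integralB (g1 g2 : R[i] -> R[i]) :
  contour_integrable g1 -> contour_integrable g2 ->
  contour_integral kappa theta g1 - contour_integral kappa theta g2 =
  contour_integral kappa theta (fun z => g1 z - g2 z).
Proof.
move=> [i1 i2 i3] [j1 j2 j3]; rewrite /contour_integral.
have -> : Cintegral `[kappa, +oo[
    (fun r => (g1 (polar r (- phi)) - g2 (polar r (- phi))) * polar 1 (- phi)) =
  Cintegral `[kappa, +oo[ (fun r => g1 (polar r (- phi)) * polar 1 (- phi)) -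
  Cintegral `[kappa, +oo[ (fun r => g2 (polar r (- phi)) * polar 1 (- phi)).
  by rewrite CintegralB//; apply: eq_Cintegral => x _; rewrite mulrBl.
have -> : Cintegral `[kappa, +oo[
    (fun r => (g1 (polar r phi) - g2 (polar r phi)) * polar 1 phi) =
  Cintegral `[kappa, +oo[ (fun r => g1 (polar r phi) * polar 1 phi) -
  Cintegral `[kappa, +oo[ (fun r => g2 (polar r phi) * polar 1 phi).
  by rewrite CintegralB//; apply: eq_Cintegral => x _; rewrite mulrBl.
have -> : Cintegral `[- phi, phi]
    (fun psi => (g1 (polar kappa psi) - g2 (polar kappa psi)) *
       ('i%C * polar kappa psi)) =
  Cintegral `[- phi, phi]
    (fun psi => g1 (polar kappa psi) * ('i%C * polar kappa psi)) -
  Cintegral `[- phi, phi]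
    (fun psi => g2 (polar kappa psi) * ('i%C * polar kappa psi)).
  by rewrite CintegralB//; apply: eq_Cintegral => x _; rewrite mulrBl.
by ring.
Qed.

End ContourIntegrals.

(** * The resolvent kernel on the contour *)

Section ResolventKernel.
Context {R : realType}.
Local Open Scope complex_scope.
Notation leb := (@lebesgue_measure R).
Variables alpha beta mu lambda : R.

Definition kernel (t rr : R) (z : R[i]) : R[i] :=
  laplace_weight alpha mu t z * (hfun alpha beta mu lambda z + rr%:C)^-1.

(** [hfun] in polar coordinates, where its measurability is visible. *)
Definition hpolar (r psi : R) : R[i] :=
  (mu^-1)%:C * polar (r `^ alpha) (alpha * psi) *
    (1 + lambda%:C * polar (r `^ (- beta)) (- beta * psi)).

Lemma hfun_polar (r psi : R) : 0 < r -> `|psi| < pi ->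
  hfun alpha beta mu lambda (polar r psi) = hpolar r psi.
Proof. by move=> r0 pp; rewrite /hfun !cpow_polar. Qed.

(** The numbers [z ^ alpha], [z ^ (alpha - beta)] and [rr] all make an angle of
  at most [alpha * phi / 2] with the direction [alpha * psi / 2]; this is less
  than a right angle, so that their components in this direction add up without
  cancellation. *)
Lemma hpolar_sector (r psi phi rr : R) :
  0 < beta -> beta <= alpha -> alpha < 1 -> 0 < mu -> 0 <= lambda ->
  0 < r -> `|psi| <= phi -> phi < pi -> 0 <= rr ->
  cos (alpha * phi / 2) * (mu^-1 * r `^ alpha + rr) <=
    normc (hpolar r psi + rr%:C).
Proof.
move=> b0 ba a1 mu0 la0 r0 pp phipi rr0.
have phi0 : 0 <= phi by exact: le_trans pp.
have a0 : 0 < alpha by lra.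
pose w := alpha * psi / 2.
apply: le_trans (proj_le_normc _ w).
pose X := mu^-1 * r `^ alpha; pose Y := X * lambda * r `^ (- beta).
have X0 : 0 <= X by rewrite mulr_ge0 ?powR_ge0// invr_ge0 ltW.
have Y0 : 0 <= Y by rewrite mulr_ge0 ?powR_ge0// mulr_ge0.
have -> : complex.Re (hpolar r psi + rr%:C) * cos w
          + complex.Im (hpolar r psi + rr%:C) * sin w =
    X * cos (alpha * psi - w) + Y * cos (alpha * psi - beta * psi - w)
      + rr * cos w.
  rewrite !(cosB, sinB) /hpolar /polar /=.
  rewrite !mulNr !cosN !sinN /Y /X; ring.
have key (a : R) : `|a| <= alpha * `|psi| / 2 -> cos (alpha * phi / 2) <= cos a.
  move=> ha; rewrite -[cos a]cos_norm.
  have aphi : alpha * `|psi| <= alpha * phi by rewrite ler_wpM2l// ltW.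
  have aphi1 : alpha * phi <= phi by rewrite ler_piMl// ltW.
  have L : 0 <= alpha * phi / 2 by rewrite divr_ge0// mulr_ge0// ltW.
  by rewrite leNgt ltr_cos ?in_itv/= ?normr_ge0 ?L//= -?leNgt; lra.
have w1 : `|w| <= alpha * `|psi| / 2.
  by rewrite /w !normrM (gtr0_norm a0) [`|2^-1|]ger0_norm.
have w2 : `|alpha * psi - w| <= alpha * `|psi| / 2.
  have -> : alpha * psi - w = w by rewrite /w; lra.
  exact: w1.
have w3 : `|alpha * psi - beta * psi - w| <= alpha * `|psi| / 2.
  have -> : alpha * psi - beta * psi - w = (alpha / 2 - beta) * psi.
    by rewrite /w; lra.
  rewrite normrM mulrAC ler_wpM2r// ler_norml; apply/andP; split; lra.
have k1 := ler_wpM2l X0 (key _ w2).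
have k2 := ler_wpM2l Y0 (key _ w3).
have k3 := ler_wpM2l rr0 (key _ w1).
have : 0 <= cos (alpha * phi / 2).
  apply: cos_ge0_pihalf; apply/andP; split.
    apply: le_trans (_ : 0 <= _); first by rewrite oppr_le0 divr_ge0// pi_ge0.
    by rewrite divr_ge0// mulr_ge0// ltW.
  rewrite ler_pdivrMr// divfK//.
  apply: le_trans (ltW phipi); by rewrite ler_piMl// ltW.
move=> c0; have : 0 <= cos (alpha * phi / 2) * Y by rewrite mulr_ge0.
rewrite -/X; lra.
Qed.

Lemma cos_half_gt0 (phi : R) : 0 < alpha -> alpha < 1 -> 0 <= phi -> phi < pi ->
  0 < cos (alpha * phi / 2).
Proof.
move=> a0 a1 phi0 phipi; apply: cos_gt0_pihalf; apply/andP; split.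
  apply: lt_le_trans (_ : 0 <= _); first by rewrite oppr_lt0 divr_gt0// pi_gt0.
  by rewrite divr_ge0// mulr_ge0// ltW.
rewrite ltr_pdivrMr// divfK//.
by apply: le_lt_trans phipi; rewrite ler_piMl// ltW.
Qed.

(** A weighted geometric mean splits the decay of the resolvent between
  [r `^ alpha] and the spectral parameter; [th] is the share of the latter. *)
Lemma kernel_polar_le (r psi phi rr t th : R) :
  0 < beta -> beta <= alpha -> alpha < 1 -> 0 < mu -> 0 <= lambda ->
  0 < r -> `|psi| <= phi -> phi < pi -> 0 < rr -> 0 <= th <= 1 ->
  normc ((mu^-1)%:C * cpow (polar r psi) (alpha - 1) *
     (hfun alpha beta mu lambda (polar r psi) + rr%:C)^-1) <=
  mu^-1 / (cos (alpha * phi / 2) * mu^-1 `^ (1 - th)) *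
    r `^ (alpha * th - 1) * rr `^ (- th).
Proof.
move=> b0 ba a1 mu0 la0 r0 pp phipi rr0 th01.
have pp' : `|psi| < pi by exact: le_lt_trans phipi.
have phi0 : 0 <= phi by exact: le_trans pp.
have a0 : 0 < alpha by lra.
have S := hpolar_sector b0 ba a1 mu0 la0 r0 pp phipi (ltW rr0).
have c0 := cos_half_gt0 a0 a1 phi0 phipi.
rewrite hfun_polar// cpow_polar// !ComplexField.Normc.normcM.
rewrite ComplexField.Normc.normcV normc_real normc_polar ?powR_ge0//.
have m0 : 0 < mu^-1 by rewrite invr_gt0.
rewrite gtr0_norm//.
have ra0 : 0 < r `^ alpha by exact: powR_gt0.
have G := geom_mean_le (ltW (mulr_gt0 m0 ra0)) (ltW rr0) th01.
have G0 : 0 < (mu^-1 * r `^ alpha) `^ (1 - th) * rr `^ th.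
  by rewrite mulr_gt0 ?powR_gt0// mulr_gt0.
have L : cos (alpha * phi / 2) * ((mu^-1 * r `^ alpha) `^ (1 - th) * rr `^ th)
    <= normc (hpolar r psi + rr%:C).
  by apply: le_trans S; rewrite ler_wpM2l ?(ltW c0).
have L0 := mulr_gt0 c0 G0.
have LV : (normc (hpolar r psi + rr%:C))^-1 <=
    (cos (alpha * phi / 2) * ((mu^-1 * r `^ alpha) `^ (1 - th) * rr `^ th))^-1.
  by rewrite lef_pV2 ?posrE//; exact: lt_le_trans L.
apply: le_trans (ler_wpM2l _ LV) _.
  by rewrite mulr_ge0 ?powR_ge0// ltW.
rewrite powRM ?(ltW m0) ?(ltW ra0)// -powRrM powRN.
have -> : alpha * th - 1 = (alpha - 1) - alpha * (1 - th) by lra.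
rewrite [r `^ (alpha - 1 - _)]powRB; last by rewrite (gt_eqF r0) implybT.
rewrite le_eqVlt; apply/orP; left; apply/eqP.
have p1 : mu^-1 `^ (1 - th) != 0 by rewrite gt_eqF// powR_gt0.
have p2 : r `^ (alpha * (1 - th)) != 0 by rewrite gt_eqF// powR_gt0.
have p3 : rr `^ th != 0 by rewrite gt_eqF// powR_gt0.
have p4 := lt0r_neq0 c0; have p5 := lt0r_neq0 mu0.
by field; rewrite p1 p2 p3 p4 p5.
Qed.

Lemma kernel_measurable (D : set R) (a b : R -> R) (t rr : R) :
  (forall x, D x -> 0 < a x /\ `|b x| < pi) ->
  measurable_fun D a -> measurable_fun D b ->
  cmeasurable D (fun x => kernel t rr (polar (a x) (b x))).
Proof.
move=> ab ma mb.
have mpow (p : R) : measurable_fun D (fun x => a x `^ p).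
  exact: (measurableT_comp (measurable_powR p)).
have mM (c : R) : measurable_fun D (fun x => c * b x).
  by apply: measurable_funM => //; exact: measurable_cst.
apply: (@cmeasurable_eq _ _ (fun x => cexp (polar (a x) (b x) * t%:C) *
   (mu^-1)%:C * polar (a x `^ (alpha - 1)) ((alpha - 1) * b x) *
   (hpolar (a x) (b x) + rr%:C)^-1)).
  move=> x /ab[a0 b1]; rewrite /kernel /laplace_weight hfun_polar// cpow_polar//.
apply: cmeasurableM.
  apply: cmeasurableM; last exact: cmeasurable_polar.
  apply: cmeasurableM; last exact: cmeasurable_cst.
  apply: cmeasurable_cexp; apply: cmeasurableM; last exact: cmeasurable_cst.
  exact: cmeasurable_polar.
apply: cmeasurableV; apply: cmeasurableD; last exact: cmeasurable_cst.
apply: cmeasurableM.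
  by apply: cmeasurableM; [exact: cmeasurable_cst|exact: cmeasurable_polar].
apply: cmeasurableD; first exact: cmeasurable_cst.
by apply: cmeasurableM; [exact: cmeasurable_cst|exact: cmeasurable_polar].
Qed.

End ResolventKernel.

(** * Decay and regularity of the relaxation functions *)

Section RelaxationFunctions.
Context {R : realType}.
Local Open Scope complex_scope.
Notation leb := (@lebesgue_measure R).

(** [ufun] as a function of the spectral parameter [rr = rho k `^ s]. *)
Definition relaxation (alpha beta mu lambda kappa theta rr t : R) : R :=
  complex.Re ((2 * pi%:C * 'i%C)^-1 *
    contour_integral kappa theta (kernel alpha beta mu lambda t rr)).

Lemma cos_ray (theta psi : R) : 0 <= pi - theta -> `|psi| = pi - theta ->
  cos psi = - cos theta.
Proof.
by move=> p0 pp; rewrite -cos_norm pp cosB cospi sinpi mul0r addr0 mulN1r.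
Qed.

Lemma integrable_cst_itv (a b c : R) :
  leb.-integrable `[a, b] (EFin \o cst c).
Proof.
apply/integrableP; split; first by apply/measurable_EFinP; exact: measurable_cst.
rewrite (@integral_cst _ _ _ leb _ _ `|c|%:E)//= lebesgue_measure_itv/=.
by case: ifP => _; rewrite -?EFinB -?EFinM ?mule0 ltry.
Qed.

Lemma le1_powR_ratio (t T p : R) : 0 < t -> t <= T -> 0 <= p ->
  1 <= T `^ p * t `^ (- p).
Proof.
move=> t0 tT p0; rewrite powRN ler_pdivlMr ?powR_gt0// mul1r.
by rewrite ge0_ler_powR ?nnegrE ?(ltW t0) ?(ltW (lt_le_trans t0 tT)).
Qed.

Lemma decay_le (r c t p : R) : 0 < r -> 0 < c -> 0 < t -> 0 <= p <= 2 ->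
  expR (- (r * c * t)) <= 4 * c `^ (- p) * t `^ (- p) * r `^ (- p).
Proof.
move=> r0 c0 t0 p02.
have y0 : 0 < r * c * t by rewrite !mulr_gt0.
apply: le_trans (expRN_le_powR y0 p02) _.
rewrite !powRM ?mulr_ge0 ?(ltW r0) ?(ltW c0) ?(ltW t0)//.
by rewrite le_eqVlt; apply/orP; left; apply/eqP; ring.
Qed.

Section Bounds.
Variables alpha beta mu lambda kappa theta T th q : R.
Implicit Types (r psi rr t p : R).
Hypothesis beta0 : 0 < beta.
Hypothesis beta_alpha : beta <= alpha.
Hypothesis alpha1 : alpha < 1.
Hypothesis mu0 : 0 < mu.
Hypothesis lambda0 : 0 <= lambda.
Hypothesis kappa0 : 0 < kappa.
Hypothesis theta0 : 0 < theta.
Hypothesis theta_pi : theta < pi / 2.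
Hypothesis T0 : 0 < T.
Hypothesis th01 : 0 <= th <= 1.
Hypothesis thq : alpha * th < q.
Hypothesis q01 : 0 <= q <= 1.

Let phi := pi - theta.
Let phi_pi : phi < pi. Proof. by rewrite gtrBl. Qed.
Let phi0 : 0 <= phi. Proof. exact: ltW (pi_sub_gt0 theta_pi). Qed.
Let delta := q - alpha * th.
Let K0 := mu^-1 / (cos (alpha * phi / 2) * mu^-1 `^ (1 - th)).
Let c := cos theta.
Let c0 : 0 < c.
Proof.
apply: cos_gt0_pihalf; rewrite theta_pi andbT.
by apply: lt_trans theta0; rewrite oppr_lt0 divr_gt0// pi_gt0.
Qed.
Let K0_ge0 : 0 <= K0.
Proof.
apply: divr_ge0; first by rewrite invr_ge0 ltW.
apply: mulr_ge0; last exact: powR_ge0.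
apply/ltW; apply: cos_half_gt0 => //; exact: lt_le_trans beta_alpha.
Qed.
Let delta0 : 0 < delta. Proof. by rewrite subr_gt0. Qed.

Notation ker := (kernel alpha beta mu lambda).
Notation U := (relaxation alpha beta mu lambda kappa theta).

Let amp z rr := (mu^-1)%:C * cpow z (alpha - 1) *
     (hfun alpha beta mu lambda z + rr%:C)^-1.

Let kerE t rr z : ker t rr z = cexp (z * t%:C) * amp z rr.
Proof. by rewrite /kernel /laplace_weight /amp !mulrA. Qed.

Let amp_le r psi rr : 0 < r -> `|psi| <= phi -> 0 < rr ->
  normc (amp (polar r psi) rr) <= K0 * r `^ (alpha * th - 1) * rr `^ (- th).
Proof. by move=> r0 pp rr0; exact: kernel_polar_le. Qed.

Let ReM r psi t : complex.Re (polar r psi * t%:C) = r * cos psi * t.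
Proof. by rewrite /polar/= mulr0 subr0. Qed.

Let ray_le t rr r psi p : 0 < t -> 0 < rr -> kappa <= r -> `|psi| = phi ->
  0 <= p <= 2 ->
  normc (cexp (polar r psi * t%:C) * amp (polar r psi) rr) <=
  4 * c `^ (- p) * K0 * rr `^ (- th) * t `^ (- p) * r `^ (alpha * th - 1 - p).
Proof.
move=> t0 rr0 kr pp p02; have r0 : 0 < r by exact: lt_le_trans kr.
rewrite ComplexField.Normc.normcM normc_cexp ReM (cos_ray phi0 pp).
rewrite mulrN mulNr.
have E := decay_le r0 c0 t0 p02.
have A := amp_le r0 _ rr0.
have {}A := A psi; rewrite pp lexx in A; have {}A := A isT.
apply: le_trans (ler_pM (expR_ge0 _) (normc_ge0 _) E A) _.
rewrite [r `^ (_ - p)]powRD ?(gt_eqF r0) ?implybT//.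
by rewrite le_eqVlt; apply/orP; left; apply/eqP; ring.
Qed.

Let arc_le t rr psi : 0 < t -> t <= T -> 0 < rr -> `|psi| <= phi ->
  normc (cexp (polar kappa psi * t%:C) * amp (polar kappa psi) rr) <=
  expR (kappa * T) * (K0 * kappa `^ (alpha * th - 1) * rr `^ (- th)).
Proof.
move=> t0 tT rr0 pp.
rewrite ComplexField.Normc.normcM normc_cexp ReM.
apply: ler_pM; [exact: expR_ge0|exact: normc_ge0| |exact: amp_le].
rewrite ler_expR; apply: le_trans (_ : kappa * 1 * t <= _).
  by rewrite ler_wpM2r ?(ltW t0)// ler_wpM2l ?(ltW kappa0)// cos_le1.
by rewrite mulr1 ler_wpM2l ?(ltW kappa0).
Qed.

Lemma kernel_integrable t rr : 0 < t -> t <= T -> 0 < rr ->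
  contour_integrable kappa theta (ker t rr).
Proof.
move=> t0 tT rr0.
have ray psi : `|psi| = phi ->
    cintegrable `[kappa, +oo[ (fun r => ker t rr (polar r psi) * polar 1 psi).
  move=> pp; pose b r := 4 * c `^ (- q) * K0 * rr `^ (- th) * t `^ (- q) *
     r `^ (- 1 - delta).
  apply: (@cintegrable_dom _ _ _ b) => //.
  - apply: cmeasurableM; last exact: cmeasurable_cst.
    apply: (@kernel_measurable _ _ _ _ _ _ (fun r => r) (fun=> psi)).
    + move=> r; rewrite /= in_itv/= andbT => kr; rewrite pp; split=> //.
      exact: lt_le_trans kr.
    + exact: measurable_id.
    + exact: measurable_cst.
  - by rewrite /b; apply: integrable_scale => //; exact: integrable_powR_tail.
  - move=> r rin; have kr : kappa <= r by move: rin; rewrite /= in_itv/= andbT.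
    rewrite ComplexField.Normc.normcM normc_polar// mulr1 kerE.
    have q02 : 0 <= q <= 2 by move: q01 => /andP[-> q1]/=; rewrite (le_trans q1)// ler1n.
    apply: le_trans (ray_le t0 rr0 kr pp q02) _.
    rewrite /b (_ : alpha * th - 1 - q = - 1 - delta)//.
    by rewrite /delta; ring.
split.
- by apply: ray; rewrite normrN ger0_norm.
- by apply: ray; rewrite ger0_norm.
- apply: (@cintegrable_dom _ _ _ (fun=> expR (kappa * T) *
     (K0 * kappa `^ (alpha * th - 1) * rr `^ (- th)) * kappa)) => //.
  + apply: cmeasurableM.
      apply: (@kernel_measurable _ _ _ _ _ _ (fun=> kappa) (fun r => r)).
      * move=> r; rewrite /= in_itv/= -ler_norml => rp; split=> //.
        exact: le_lt_trans rp _.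
      * exact: measurable_cst.
      * exact: measurable_id.
    apply: cmeasurableM; first exact: cmeasurable_cst.
    by apply: cmeasurable_polar; [exact: measurable_cst|exact: measurable_id].
  + exact: integrable_cst_itv.
  + move=> psi psin.
    have pp : `|psi| <= phi by move: psin; rewrite /= in_itv/= -ler_norml.
    have iE : normc ('i%C * polar kappa psi) = kappa.
      rewrite ComplexField.Normc.normcM normc_polar ?(ltW kappa0)//.
      by rewrite normcE_ReIm/= expr0n/= expr1n add0r sqrtr1 mul1r.
    rewrite ComplexField.Normc.normcM iE kerE.
    by rewrite ler_wpM2r ?(ltW kappa0)// arc_le.
Qed.

Let c2 := normc ((2 * pi%:C * 'i%C)^-1 : R[i]).
Let I0 := \int[leb]_(r in `[kappa, +oo[) r `^ (- 1 - delta).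
Let I0_ge0 : 0 <= I0.
Proof. by apply: Rintegral_ge0 => r _; exact: powR_ge0. Qed.

Let contour_power_le (g : R[i] -> R[i]) (A M : R) :
  (forall r psi, kappa <= r -> `|psi| = phi ->
    normc (g (polar r psi)) <= A * r `^ (- 1 - delta)) ->
  (forall psi, `|psi| <= phi -> normc (g (polar kappa psi)) <= M) ->
  `|complex.Re ((2 * pi%:C * 'i%C)^-1 * contour_integral kappa theta g)| <=
  c2 * (4 * (A * I0) + 4 * (kappa * M * phi)).
Proof.
move=> gA gM; apply: le_trans (ler_Re_normc _) _.
rewrite ComplexField.Normc.normcM; apply: ler_wpM2l; first exact: normc_ge0.
have iA := integrable_powR_tail kappa0 delta0.
rewrite /I0 -RintegralZl//; apply: normc_contour_le => //.
exact: integrable_scale.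
Qed.

Let C0 := c2 * (4 * (4 * c `^ (- q) * K0 * I0) +
  4 * (kappa * (expR (kappa * T) * (K0 * kappa `^ (alpha * th - 1)) * T `^ q) * phi)).

Let C1 := c2 * (4 * (3 * (4 * c `^ (- (1 + q)) * K0) * I0) +
  4 * (kappa * (3 * kappa * expR (kappa * T) * (expR (kappa * T) *
     (K0 * kappa `^ (alpha * th - 1))) * T `^ (1 + q)) * phi)).

Let C0_ge0 : 0 <= C0.
Proof.
have ? := ltW kappa0.
rewrite /C0.
by do ![exact: normc_ge0 | exact: powR_ge0 | exact: expR_ge0 | by []
  | apply: addr_ge0 | apply: mulr_ge0].
Qed.

Let C1_ge0 : 0 <= C1.
Proof.
have ? := ltW kappa0.
rewrite /C1.
by do ![exact: normc_ge0 | exact: powR_ge0 | exact: expR_ge0 | by []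
  | apply: addr_ge0 | apply: mulr_ge0].
Qed.

Let relaxation_le rr t : 0 < rr -> 0 < t -> t <= T ->
  `|U rr t| <= C0 * rr `^ (- th) * t `^ (- q).
Proof.
move=> rr0 t0 tT.
have q02 : 0 <= q <= 2 by move: q01 => /andP[-> q1]/=; rewrite (le_trans q1)// ler1n.
pose A := 4 * c `^ (- q) * K0 * rr `^ (- th) * t `^ (- q).
pose M := expR (kappa * T) * (K0 * kappa `^ (alpha * th - 1) * rr `^ (- th)) *
  (T `^ q * t `^ (- q)).
apply: le_trans (@contour_power_le _ A M _ _) _.
- move=> r psi kr pp; rewrite kerE; apply: le_trans (ray_le t0 rr0 kr pp q02) _.
  rewrite (_ : alpha * th - 1 - q = - 1 - delta)//.
  by rewrite /delta; ring.
- move=> psi pp; rewrite kerE; apply: le_trans (arc_le t0 tT rr0 pp) _.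
  rewrite /M ler_peMr ?le1_powR_ratio//; last by case/andP: q01.
  by do ![exact: normc_ge0 | exact: powR_ge0 | exact: expR_ge0 | by []
  | apply: addr_ge0 | apply: mulr_ge0].
- by rewrite le_eqVlt; apply/orP; left; apply/eqP; rewrite /A /M /C0; ring.
Qed.

Let relaxation_lip rr t1 t2 : 0 < rr -> 0 < t1 -> t1 <= t2 -> t2 <= T ->
  `|U rr t1 - U rr t2| <= C1 * rr `^ (- th) * t1 `^ (- (1 + q)) * (t2 - t1).
Proof.
move=> rr0 t10 t12 t2T.
have q02 : 0 <= 1 + q <= 2.
  by move: q01 => /andP[q0 q1]; rewrite addr_ge0//= -[2]/(1 + 1) lerD2l.
have t1T := le_trans t12 t2T; have t20 := lt_le_trans t10 t12.
have d0 : 0 <= t2 - t1 by rewrite subr_ge0.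
have UE : U rr t1 - U rr t2 = complex.Re ((2 * pi%:C * 'i%C)^-1 *
    contour_integral kappa theta (fun z => ker t1 rr z - ker t2 rr z)).
  have ReB (x y : R[i]) : complex.Re x - complex.Re y = complex.Re (x - y).
    by case: x y => ? ? [].
  rewrite /relaxation ReB -mulrBr contour_integralB//; apply: kernel_integrable => //.
have kE z : ker t1 rr z - ker t2 rr z =
    (1 - cexp (z * (t2 - t1)%:C)) * (cexp (z * t1%:C) * amp z rr).
  rewrite !kerE.
  have -> : cexp (z * t2%:C) = cexp (z * (t2 - t1)%:C) * cexp (z * t1%:C).
    by rewrite -cexpD -mulrDr -rmorphD/= subrK.
  by ring.
have N z : normc (1 - cexp (z * (t2 - t1)%:C)) <=
    3 * (normc z * (t2 - t1)) * expR (Num.max (complex.Re z * (t2 - t1)) 0).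
  have := normc_1Bcexp (z * (t2 - t1)%:C).
  rewrite ComplexField.Normc.normcM normc_real (ger0_norm d0).
  by case: z => x y; rewrite /= mulr0 subr0.
pose A := 3 * (4 * c `^ (- (1 + q)) * K0) * rr `^ (- th) * t1 `^ (- (1 + q)) * (t2 - t1).
pose M := 3 * kappa * expR (kappa * T) * (expR (kappa * T) *
  (K0 * kappa `^ (alpha * th - 1) * rr `^ (- th))) *
  (T `^ (1 + q) * t1 `^ (- (1 + q))) * (t2 - t1).
rewrite UE; apply: le_trans (@contour_power_le _ A M _ _) _.
- move=> r psi kr pp; have r0 : 0 < r by exact: lt_le_trans kr.
  rewrite kE ComplexField.Normc.normcM.
  have H1 := N (polar r psi); rewrite normc_polar ?(ltW r0)// in H1.
  rewrite [complex.Re (polar r psi)]/= (cos_ray phi0 pp) in H1.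
  have neg : r * - cos theta * (t2 - t1) <= 0.
    by rewrite mulrN mulNr oppr_le0 !mulr_ge0// ltW// c0.
  rewrite (max_idPr neg) expR0 mulr1 in H1.
  apply: le_trans (ler_pM (normc_ge0 _) (normc_ge0 _) H1 (ray_le t10 rr0 kr pp q02)) _.
  have -> : r `^ (- 1 - delta) = r * r `^ (alpha * th - 1 - (1 + q)).
    rewrite -{2}(powRr1 (ltW r0)) -powRD ?(gt_eqF r0) ?implybT//.
    congr (_ `^ _); rewrite /delta; ring.
  by rewrite le_eqVlt; apply/orP; left; apply/eqP; rewrite /A; ring.
- move=> psi pp; rewrite kE ComplexField.Normc.normcM.
  have H1 := N (polar kappa psi); rewrite normc_polar ?(ltW kappa0)// in H1.
  have mx : expR (Num.max (complex.Re (polar kappa psi) * (t2 - t1)) 0)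
      <= expR (kappa * T).
    rewrite ler_expR ge_max mulr_ge0 ?(ltW kappa0) ?(ltW T0)// andbT.
    apply: le_trans (_ : kappa * (t2 - t1) <= _).
      by rewrite ler_wpM2r//= ler_piMr ?(ltW kappa0)// cos_le1.
    rewrite ler_wpM2l ?(ltW kappa0)//; apply: le_trans t2T.
    by rewrite gerBl ltW.
  have {}H1 : normc (1 - cexp (polar kappa psi * (t2 - t1)%:C)) <=
      3 * (kappa * (t2 - t1)) * expR (kappa * T).
    apply: le_trans H1 _; rewrite ler_wpM2l// !mulr_ge0//; exact: ltW.
  have A2 := arc_le t10 t1T rr0 pp.
  apply: le_trans (ler_pM (normc_ge0 _) (normc_ge0 _) H1 A2) _.
  set L := (X in X <= _).
  have L0 : 0 <= L.
    have ? := ltW kappa0; rewrite /L.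
    by do ![exact: normc_ge0 | exact: powR_ge0 | exact: expR_ge0 | by []
  | apply: addr_ge0 | apply: mulr_ge0].
  have q10 : 0 <= 1 + q by case/andP: q02.
  apply: le_trans (ler_peMr L0 (le1_powR_ratio t10 t1T q10)) _.
  by rewrite le_eqVlt; apply/orP; left; apply/eqP; rewrite /L /M; ring.
- by rewrite le_eqVlt; apply/orP; left; apply/eqP; rewrite /A /M /C1; ring.
Qed.

(** On the rays the exponential is traded for the power [- q] of [r * t], or
  [- (1 + q)] for a difference in time, which brings down a factor [r]; the
  remaining power of [r] is integrable at infinity because [alpha * th < q].  The
  arc contributes bounded factors, absorbed into the powers of [t] by [t <= T]. *)
Lemma relaxation_bounds : exists2 C, 0 <= C & forall rr, 0 < rr ->
  (forall t, 0 < t -> t <= T -> `|U rr t| <= C * rr `^ (- th) * t `^ (- q)) /\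
  (forall t1 t2, 0 < t1 -> t1 <= t2 -> t2 <= T ->
    `|U rr t1 - U rr t2| <= C * rr `^ (- th) * t1 `^ (- (1 + q)) * (t2 - t1)).
Proof.
exists (C0 + C1); first by rewrite addr_ge0.
move=> rr rr0; split.
- move=> t t0 tT; apply: le_trans (relaxation_le rr0 t0 tT) _.
  by rewrite !ler_wpM2r ?powR_ge0// lerDl.
- move=> t1 t2 t10 t12 t2T; apply: le_trans (relaxation_lip rr0 t10 t12 t2T) _.
  by rewrite !ler_wpM2r ?powR_ge0 ?subr_ge0// lerDr.
Qed.

End Bounds.
End RelaxationFunctions.

(** * The Hilbert space of square-integrable functions *)

Section HilbertSpace.
Context {R : realType}.
Variable l : R.
Implicit Types (u v w : L2D l).

Lemma measurable_L2D v : measurable_fun setT v.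
Proof. exact: measurable_funPT. Qed.

Lemma L2D_mul_integrable v w : (muD l).-integrable setT (EFin \o (v \* w)).
Proof.
by apply/Lfun1_integrable; apply: Lfun2_mul_Lfun1; exact: LfunP.
Qed.

Lemma L2D_integrable v : (muD l).-integrable setT (EFin \o v).
Proof.
apply/Lfun1_integrable; apply: Lfun_subset12; last exact: LfunP.
rewrite ge0_fin_numE ?measure_ge0//; exact: muD_fin.
Qed.

Lemma innerC v w : inner v w = inner w v.
Proof. by apply: eq_Rintegral => x _; rewrite mulrC. Qed.

Lemma innerDl u v w : inner (u + v) w = inner u w + inner v w.
Proof.
rewrite /inner -RintegralD//; try exact: L2D_mul_integrable.
by apply: eq_Rintegral => x _; rewrite -mulrDl.
Qed.

Lemma innerZl (c : R) v w : inner (c *: v) w = c * inner v w.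
Proof.
rewrite /inner -RintegralZl//; last exact: L2D_mul_integrable.
by apply: eq_Rintegral => x _; rewrite mulrA.
Qed.

Lemma innerNl v w : inner (- v) w = - inner v w.
Proof. by rewrite -scaleN1r innerZl mulN1r. Qed.

Lemma innerBl u v w : inner (u - v) w = inner u w - inner v w.
Proof. by rewrite innerDl innerNl. Qed.

Lemma inner0l w : inner 0 w = 0.
Proof. by rewrite -(scale0r 0) innerZl mul0r. Qed.

Lemma innerDr u v w : inner w (u + v) = inner w u + inner w v.
Proof. by rewrite innerC innerDl ![inner _ w]innerC. Qed.

Lemma innerBr u v w : inner w (u - v) = inner w u - inner w v.
Proof. by rewrite innerC innerBl ![inner _ w]innerC. Qed.

Lemma inner_suml n (F : nat -> L2D l) w :
  inner (\sum_(k < n) F k) w = \sum_(k < n) inner (F k) w.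
Proof.
elim: n => [|n IH]; first by rewrite !big_ord0 inner0l.
by rewrite !big_ord_recr/= innerDl IH.
Qed.

Lemma eq_inner v v' w : eqH v v' -> inner v w = inner v' w.
Proof.
move=> vv'; congr fine; apply: ae_eq_integral => //.
- by case/integrableP: (L2D_mul_integrable v w).
- by case/integrableP: (L2D_mul_integrable v' w).
- by apply: filterS vv' => x /= E _; rewrite E.
Qed.

Lemma inner_ge0 v : 0 <= inner v v.
Proof. by apply: Rintegral_ge0 => x _; rewrite -expr2 sqr_ge0. Qed.

Lemma normH_ge0 v : 0 <= normH v.
Proof. by rewrite fine_ge0// Lnorm_ge0. Qed.

Lemma inner_EFin v w :
  (\int[muD l]_x ((v x * w x)%R)%:E = (inner v w)%:E)%E.
Proof.
rewrite /inner /Rintegral fineK//; apply: integrable_fin_num => //.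
exact: L2D_mul_integrable.
Qed.

Lemma normH_sqr v : normH v ^+ 2 = inner v v.
Proof.
rewrite /normH unlock /=.
have -> : (\int[muD l]_x `|(v x)%:E| `^ 2 = (inner v v)%:E)%E.
  rewrite -inner_EFin; apply: eq_integral => x _.
  by rewrite /= powR_mulrn// real_normK ?num_real// expr2.
by rewrite /= -powR_mulrn ?powR_ge0// -powRrM mulVf// powRr1// inner_ge0.
Qed.

Lemma cauchy_schwarz v w : `|inner v w| <= normH v * normH w.
Proof.
rewrite -(@ler_pXn2r _ 2)// ?nnegrE ?mulr_ge0 ?normH_ge0//.
rewrite real_normK ?num_real// exprMn !normH_sqr.
have key (a : R) : 0 <= inner v v - 2 * a * inner v w + a ^+ 2 * inner w w.
  have := inner_ge0 (v - a *: w).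
  rewrite innerBl !innerBr !innerZl ![inner _ (_ *: _)]innerC !innerZl.
  rewrite [inner w v]innerC; lra.
have [w0|w0] := eqVneq (inner w w) 0.
  suff -> : inner v w = 0 by rewrite expr0n w0 mulr0.
  apply/eqP; apply/negPn/negP => vw0.
  have := key ((inner v v + 1) / (2 * inner v w)).
  have -> : 2 * ((inner v v + 1) / (2 * inner v w)) * inner v w = inner v v + 1.
    by field.
  by rewrite w0; lra.
have wp : 0 < inner w w by rewrite lt_def w0 inner_ge0.
have := key (inner v w / inner w w).
have -> : inner v v - 2 * (inner v w / inner w w) * inner v w
    + (inner v w / inner w w) ^+ 2 * inner w w
    = inner v v - inner v w ^+ 2 / inner w w by field.
by rewrite subr_ge0 ler_pdivrMr.
Qed.

Lemma normH_sub_sqr_le v w :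
  normH (v - w) ^+ 2 <= 2 * normH v ^+ 2 + 2 * normH w ^+ 2.
Proof.
rewrite !normH_sqr; have := inner_ge0 (v + w).
by rewrite innerBl !innerBr innerDl !innerDr; lra.
Qed.

Lemma normH_add_sqr_le v w :
  normH (v + w) ^+ 2 <= 2 * normH v ^+ 2 + 2 * normH w ^+ 2.
Proof.
rewrite !normH_sqr; have := inner_ge0 (v - w).
by rewrite innerBl !innerBr innerDl !innerDr; lra.
Qed.

Lemma eqH_normH v w : eqH v w -> normH v = normH w.
Proof.
move=> vw; apply/eqP; rewrite -(@eqrXn2 _ 2) ?normH_ge0// !normH_sqr.
by rewrite (eq_inner v vw) innerC (eq_inner w vw).
Qed.

Lemma cvgH_inner (v_ : nat -> L2D l) v w : cvgH v_ v ->
  inner (v_ n) w @[n --> \oo] --> inner v w.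
Proof.
move=> vv; apply/subr_cvg0/norm_cvg0P.
apply: (@squeeze_cvgr _ _ _ _ (fun=> 0) (fun n => normH (v_ n - v) * normH w)).
- by apply: nearW => n; rewrite normr_ge0 -innerBl cauchy_schwarz.
- exact: cvg_cst.
- by rewrite -(mul0r (normH w)); apply: cvgMl.
Qed.

Section Basis.
Variable e : nat -> L2D l.
Hypothesis orth : forall i j, inner (e i) (e j) = (i == j)%:R.
Hypothesis complete :
  forall v, cvgH (fun n => \sum_(k < n) inner v (e k) *: e k) v.

Lemma inner_sum_basis (a : nat -> R) n j :
  inner (\sum_(k < n) a k *: e k) (e j) = if (j < n)%N then a j else 0.
Proof.
rewrite (inner_suml n (fun k => a k *: e k)).
under eq_bigr do rewrite innerZl orth.
case: ltnP => jn.
  rewrite (bigD1 (Ordinal jn))//= eqxx mulr1 big1 ?addr0// => i ij.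
  by rewrite (_ : (_ == _) = false) ?mulr0//; apply/negbTE.
by rewrite big1// => i _; rewrite ltn_eqF ?mulr0// (leq_trans (ltn_ord i)).
Qed.

Lemma normH_sum_basis (a : nat -> R) n :
  normH (\sum_(k < n) a k *: e k) ^+ 2 = \sum_(k < n) a k ^+ 2.
Proof.
rewrite normH_sqr {1}(inner_suml n (fun k => a k *: e k)).
apply: eq_bigr => k _; rewrite innerZl innerC (inner_sum_basis a) ltn_ord.
by rewrite expr2.
Qed.

(** The partial sums are squared norms of orthogonal projections, and the defect
  is the squared distance to them, which completeness sends to 0. *)
Lemma parseval v :
  \sum_(k < n) inner v (e k) ^+ 2 @[n --> \oo] --> normH v ^+ 2.
Proof.
have E n : \sum_(k < n) inner v (e k) ^+ 2 =
    normH v ^+ 2 - normH (\sum_(k < n) inner v (e k) *: e k - v) ^+ 2.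
  set S := \sum_(k < n) inner v (e k) *: e k.
  have SS : inner S S = \sum_(k < n) inner v (e k) ^+ 2.
    by rewrite -normH_sqr (normH_sum_basis (fun k => inner v (e k)) n).
  have Sv : inner S v = \sum_(k < n) inner v (e k) ^+ 2.
    rewrite (inner_suml n (fun k => inner v (e k) *: e k)).
    by apply: eq_bigr => k _; rewrite innerZl innerC expr2.
  by rewrite !normH_sqr innerBl !innerBr SS Sv [inner v S]innerC Sv; lra.
under eq_fun do rewrite E.
have H0 : normH (\sum_(k < n) inner v (e k) *: e k - v) ^+ 2 @[n --> \oo] --> (0 : R).
  by rewrite -(mulr0 (0 : R)); apply: cvgM; exact: complete.
have := cvgB (cvg_cst (normH v ^+ 2)) H0; rewrite subr0 => H; apply: H.
Qed.

Lemma bessel v n : \sum_(k < n) inner v (e k) ^+ 2 <= normH v ^+ 2.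
Proof.
have C : cvgn (fun n => \sum_(k < n) inner v (e k) ^+ 2).
  by apply/cvg_ex; eexists; exact: parseval.
rewrite -(cvg_lim _ (@parseval v))//; apply: (nondecreasing_cvgn_le _ C) => p q pq.
rewrite -!(big_mkord xpredT (fun k => inner v (e k) ^+ 2)).
rewrite [leRHS](big_cat_nat (n := p))//= lerDl sumr_ge0// => i _; exact: sqr_ge0.
Qed.

Lemma normH_le_of_coeff v w (M : R) : 0 <= M ->
  (forall k, `|inner v (e k)| <= M * `|inner w (e k)|) ->
  normH v <= M * normH w.
Proof.
move=> M0 H; rewrite -(@ler_pXn2r _ 2)// ?nnegrE ?mulr_ge0 ?normH_ge0//.
rewrite -(cvg_lim _ (@parseval v))//; apply: limr_le.
  by apply/cvg_ex; eexists; exact: parseval.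
apply: nearW => n; apply: le_trans (_ : M ^+ 2 * \sum_(k < n) inner w (e k) ^+ 2 <= _).
  rewrite mulr_sumr; apply: ler_sum => k _.
  rewrite -exprMn -[inner v _ ^+ 2]real_normK ?num_real//.
  rewrite -[(M * _) ^+ 2]real_normK ?num_real// lerXn2r ?nnegrE//.
  by rewrite normrM (ger0_norm M0).
by rewrite exprMn ler_wpM2l ?sqr_ge0// bessel.
Qed.

End Basis.
End HilbertSpace.

(** * Classical Dirichlet eigenfunctions are sines *)

Section SineEigenfunctions.
Context {R : realType}.
Notation leb := (@lebesgue_measure R).
Implicit Types (w x y a b l r : R).

Lemma is_derive_scale w x : is_derive x 1 (fun y : R => w * y) w.
Proof. by apply: is_derive_eq; rewrite /GRing.scale/= mulr1. Qed.

Lemma is_derive_sin_scale w x :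
  is_derive x 1 (fun y : R => sin (w * y)) (w * cos (w * x)).
Proof.
rewrite mulrC; apply: (@is_derive1_comp _ sin (fun y => w * y)).
exact: is_derive_scale.
Qed.

Lemma is_derive_cos_scale w x :
  is_derive x 1 (fun y : R => cos (w * y)) (- (w * sin (w * x))).
Proof.
rewrite mulrC -mulNr; apply: (@is_derive1_comp _ cos (fun y => w * y)).
exact: is_derive_scale.
Qed.

Lemma is_derive_continuous (f : R -> R) x (d : R) : is_derive x 1 f d ->
  {for x, continuous f}.
Proof.
by move=> [fd _]; apply: differentiable_continuous; apply/derivable1_diffP.
Qed.

Lemma Rintegral_FTC (f F : R -> R) a b : a < b ->
  (forall x, is_derive x (1 : R) F (f x)) -> continuous f ->
  leb.-integrable `]a, b[ (EFin \o f) /\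
  \int[leb]_(x in `]a, b[) f x = F b - F a.
Proof.
move=> ab dF cf.
have mf D : measurable_fun D f.
  by apply: measurable_funTS; exact: continuous_measurable_fun.
have E : (\int[leb]_(x in `]a, b[) (f x)%:E = (F b - F a)%:E)%E.
  rewrite integral_itv_bndo_bndc; last by apply/measurable_EFinP; exact: mf.
  rewrite integral_itv_obnd_cbnd; last by apply/measurable_EFinP; exact: mf.
  rewrite (@continuous_FTC2 _ _ F)//.
  - exact: continuous_subspaceT.
  - split=> [x _||]; first by have [] := dF x.
      apply: cvg_at_right_filter; exact: is_derive_continuous (dF a).
    apply: cvg_at_left_filter; exact: is_derive_continuous (dF b).
  - by move=> x _; rewrite derive1E; have [_ ->] := dF x.
split; last by rewrite /Rintegral E.
have icc : leb.-integrable `[a, b] (EFin \o f).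
  apply: continuous_compact_integrable; first exact: segment_compact.
  exact: continuous_subspaceT.
by apply: integrableS icc => //; apply: subset_itvW.
Qed.

Lemma sin_eq0_natpi y : 0 <= y -> sin y = 0 -> exists n : nat, y = n%:R * pi.
Proof.
move=> y0 sy; have pi0 := pi_gt0 R.
pose n := Num.truncn (y / pi); exists n.
have /andP[n1 n2] : n%:R <= y / pi < n.+1%:R by apply: truncn_itv; rewrite divr_ge0// ltW.
have Hs (m : nat) (z : R) : sin (z + m%:R * pi) = 0 -> sin z = 0.
  elim: m => [|m IH]; first by rewrite mul0r addr0.
  rewrite -natr1 mulrDl mul1r addrA sinDpi => /eqP; rewrite oppr_eq0 => /eqP.
  exact: IH.
have z0 : sin (y - n%:R * pi) = 0 by apply: (Hs n); rewrite subrK.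
rewrite ler_pdivlMr// in n1; rewrite ltr_pdivrMr// -natr1 mulrDl mul1r in n2.
apply/eqP; rewrite -subr_eq0; apply/negPn/negP => nz.
have := @sin_gt0_pi _ (y - n%:R * pi); rewrite z0 ltxx => H.
suff: false by []; apply: H; apply/andP; split.
  by rewrite lt_def nz subr_ge0.
by rewrite ltrBlDl.
Qed.

Lemma constant_of_derive0 (f : R -> R) l : 
  (forall x : R, x \in `]0, l[ -> is_derive x (1 : R) f 0) ->
  forall x y : R, x \in `]0, l[ -> y \in `]0, l[ -> f x = f y.
Proof.
move=> df x y; wlog xy : x y / x <= y.
  by move=> W xi yi; have [/W|/ltW/W H] := leP x y; [exact|rewrite H].
rewrite !in_itv/= => /andP[x0 xl] /andP[y0 yl].
have sub z : z \in `[x, y] -> z \in `]0, l[.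
  rewrite !in_itv/= => /andP[xz zy].
  by rewrite (lt_le_trans x0 xz) (le_lt_trans zy yl).
have K1 (z : R) : z \in `]x, y[ -> is_derive z (1 : R) f 0.
  by move=> zi; apply: df; apply: sub; move: z zi; apply: subset_itvW.
have K2 : {within `[x, y], continuous f}.
  apply: continuous_in_subspaceT => z /set_mem/= zi.
  exact: is_derive_continuous (df _ (sub _ zi)).
have K3 (z : R) : z \in `]x, y[ -> `|(0 : R)| <= (0 : R) by rewrite normr0.
have K := @lipschitz_of_derive R f (fun=> 0) x y 0 xy K1 K2 K3.
have {}K : `|f y - f x| <= 0 by rewrite mul0r in K.
by move: K; rewrite normr_le0 => /eqP/subr0_eq.
Qed.

(** Uniqueness for the oscillator equation: the two quadratures
  [w v cos (w x) - v' sin (w x)] and [w v sin (w x) + v' cos (w x)] have zero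
  derivative, and the boundary value at 0 kills the first. *)
Lemma dirichlet_sine l r (v : R -> R) : 0 < l -> 0 < r ->
  dirichlet_eigenfunction l r v ->
  exists A, forall x : R, x \in `[0, l] -> v x = A * sin (Num.sqrt r * x).
Proof.
move=> l0 r0 [cv v0 vl ode]; set w := Num.sqrt r.
have w0 : 0 < w by rewrite sqrtr_gt0.
have ww : r = w * w by rewrite -expr2 sqr_sqrtr// ltW.
pose a x := w * v x * cos (w * x) - derive1 v x * sin (w * x).
pose b x := w * v x * sin (w * x) + derive1 v x * cos (w * x).
have dv x : x \in `]0, l[ -> is_derive x (1 : R) v (derive1 v x).
  by move=> /ode[d1 _ _]; apply: DeriveDef => //; rewrite derive1E.
have ddv x : x \in `]0, l[ -> is_derive x (1 : R) (derive1 v) (- (r * v x)).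
  move=> /ode[_ d2 E]; apply: DeriveDef => //.
  by rewrite -derive1E -E opprK.
have da x : x \in `]0, l[ -> is_derive x (1 : R) a 0.
  move=> xi; have := dv x xi; have := ddv x xi => D2 D1.
  have D3 := is_derive_sin_scale w x; have D4 := is_derive_cos_scale w x.
  apply: is_derive_eq; rewrite /GRing.scale/= ww; ring.
have db x : x \in `]0, l[ -> is_derive x (1 : R) b 0.
  move=> xi; have := dv x xi; have := ddv x xi => D2 D1.
  have D3 := is_derive_sin_scale w x; have D4 := is_derive_cos_scale w x.
  apply: is_derive_eq; rewrite /GRing.scale/= ww; ring.
have hi : l / 2 \in `]0, l[ by rewrite in_itv/= divr_gt0//= gtr_pMr// invf_lt1// ltr1n.
set a0 := a (l / 2); set b0 := b (l / 2).
have E x : x \in `]0, l[ -> v x = w^-1 * (a0 * cos (w * x) + b0 * sin (w * x)).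
  move=> xi; rewrite /a0 /b0 -(constant_of_derive0 da xi hi).
  rewrite -(constant_of_derive0 db xi hi) /a /b.
  have cs := cos2Dsin2 (w * x).
  have -> : (w * v x * cos (w * x) - v^`()%classic x * sin (w * x)) * cos (w * x) +
      (w * v x * sin (w * x) + v^`()%classic x * cos (w * x)) * sin (w * x)
    = w * v x * (cos (w * x) ^+ 2 + sin (w * x) ^+ 2) by ring.
  by rewrite cs mulr1 mulKf// gt_eqF.
pose g x := w^-1 * (a0 * cos (w * x) + b0 * sin (w * x)).
have cg x : {for x, continuous g}.
  have D3 := is_derive_sin_scale w x; have D4 := is_derive_cos_scale w x.
  have D5 : is_derive x (1 : R) g
     (w^-1 * (a0 * - (w * sin (w * x)) + b0 * (w * cos (w * x)))).
    by apply: is_derive_eq; rewrite /GRing.scale/=; ring.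
  exact: is_derive_continuous D5.
have [_ cv0 cvl] := (continuous_within_itvP _ l0).1 cv.
have g0 : v 0 = g 0.
  apply: (cvg_unique _ cv0); first exact: norm_hausdorff.
  apply: cvg_trans (cvg_at_right_filter (cg 0)).
  apply: near_eq_cvg; near=> x; rewrite -E// in_itv/=; apply/andP; split.
    by near: x; exact: nbhs_right_gt.
  by near: x; exact: nbhs_right_lt.
have gl : v l = g l.
  apply: (cvg_unique _ cvl); first exact: norm_hausdorff.
  apply: cvg_trans (cvg_at_left_filter (cg l)).
  apply: near_eq_cvg; near=> x; rewrite -E// in_itv/=; apply/andP; split.
    by near: x; exact: nbhs_left_gt.
  by near: x; exact: nbhs_left_lt.
have az : a0 = 0.
  move: g0; rewrite v0 /g mulr0 cos0 sin0 mulr0 mulr1 addr0 => /esym/eqP.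
  by rewrite mulf_eq0 invr_eq0 gt_eqF//= => /eqP.
exists (w^-1 * b0) => x; rewrite in_itv/= => /andP[x0 xl].
have gE y : g y = w^-1 * b0 * sin (w * y) by rewrite /g az; ring.
rewrite -gE; move: x0; rewrite le_eqVlt => /predU1P[<-//|x0].
move: xl; rewrite le_eqVlt => /predU1P[->//|xl].
by rewrite E// in_itv/= x0.
Unshelve. all: by end_near. Qed.

Lemma integral_sin_sqr l w : 0 < l -> 0 < w -> sin (w * l) = 0 ->
  leb.-integrable `]0, l[ (EFin \o (fun x => sin (w * x) ^+ 2)) /\
  \int[leb]_(x in `]0, l[) sin (w * x) ^+ 2 = l / 2.
Proof.
move=> l0 w0 sl.
pose F x := x / 2 - (2 * w)^-1 * (sin (w * x) * cos (w * x)).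
have [||i E] := @Rintegral_FTC (fun x => sin (w * x) ^+ 2) F 0 l l0.
- move=> x; have D3 := is_derive_sin_scale w x; have D4 := is_derive_cos_scale w x.
  have cs := cos2Dsin2 (w * x).
  have D5 : is_derive x (1 : R) F (2^-1 - (2 * w)^-1 *
     (sin (w * x) * - (w * sin (w * x)) + w * cos (w * x) * cos (w * x))).
    by apply: is_derive_eq; rewrite /GRing.scale/=; ring.
  apply: is_derive_eq.
  have -> : 2^-1 = 2^-1 * (cos (w * x) ^+ 2 + sin (w * x) ^+ 2) :> R by rewrite cs mulr1.
  by field; rewrite gt_eqF.
- move=> x; have D3 := is_derive_sin_scale w x.
  apply: (@continuous_comp _ _ _ (fun y => sin (w * y)) (fun z : R => z ^+ 2)).
    exact: is_derive_continuous D3.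
  exact: exprn_continuous.
- by rewrite E /F sl !mul0r mulr0 !subr0 mulr0 sin0 mul0r mulr0 !subr0.
Qed.

Lemma integral_sin_le a b w : 0 < w -> a < b ->
  `|\int[leb]_(x in `]a, b[) sin (w * x)| <= 2 / w.
Proof.
move=> w0 ab.
pose F x := - w^-1 * cos (w * x).
have [||i ->] := @Rintegral_FTC (fun x => sin (w * x)) F a b ab.
- move=> x; have D4 := is_derive_cos_scale w x.
  by apply: is_derive_eq; rewrite /GRing.scale/=; field; rewrite gt_eqF.
- by move=> x; exact: is_derive_continuous (is_derive_sin_scale w x).
- have v0 : 0 <= w^-1 by rewrite invr_ge0 ltW.
  rewrite /F -mulrBr normrM normrN (ger0_norm v0) [2 / w]mulrC.
  apply: ler_wpM2l => //; apply: le_trans (ler_normB _ _) _.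
  have := cos_max (w * b); have := cos_max (w * a); lra.
Qed.

End SineEigenfunctions.

(** * Uniform estimates for the eigensystem *)

Section EigenEstimates.
Context {R : realType}.
Notation leb := (@lebesgue_measure R).
Implicit Types (l : R).

Lemma inner_itv l (v w : L2D l) :
  inner v w = \int[leb]_(x in `]0, l[) (v x * w x).
Proof.
rewrite /inner /Rintegral integral_muD//; apply/measurable_EFinP.
by apply: measurable_funM; exact: measurable_L2D.
Qed.

(** The boundary value at [l] quantizes the frequency, and the normalization
  fixes the amplitude. *)
Lemma eigen_sine l (v : L2D l) (r : R) : 0 < l -> 0 < r ->
  dirichlet_eigenfunction l r v -> inner v v = 1 ->
  exists A, [/\ A ^+ 2 = 2 / l,
    forall x : R, x \in `]0, l[ -> v x = A * sin (Num.sqrt r * x) &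
    exists n : nat, Num.sqrt r * l = n.+1%:R * pi].
Proof.
move=> l0 r0 dv vv; have [A vA] := dirichlet_sine l0 r0 dv.
set w := Num.sqrt r in vA *; have w0 : 0 < w by rewrite sqrtr_gt0.
have vAo x : x \in `]0, l[ -> v x = A * sin (w * x).
  by move=> xi; apply: vA; move: x xi; exact: subset_itvW.
have iv : \int[leb]_(x in `]0, l[) (A ^+ 2 * sin (w * x) ^+ 2) = 1.
  rewrite -vv inner_itv; apply: eq_Rintegral => x /set_mem xi.
  by rewrite !vAo// -exprMn expr2.
have sl : sin (w * l) = 0.
  have [_ _ vl _] := dv; have := vA l; rewrite vl in_itv/= lexx ltW// => /(_ isT).
  move=> /esym/eqP; rewrite mulf_eq0 => /orP[/eqP A0|/eqP//].
  exfalso; have : \int[leb]_(x in `]0, l[) (0 : R) = 1.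
    by rewrite -iv; apply: eq_Rintegral => x _; rewrite A0 expr0n/= mul0r.
  rewrite Rintegral_cst; last exact: measurable_itv.
  by rewrite mul0r => /esym/eqP; rewrite oner_eq0.
have [ii iE] := integral_sin_sqr l0 w0 sl.
move: iv; rewrite RintegralZl// iE => AE.
exists A; split => //.
  have -> : A ^+ 2 = A ^+ 2 * (l / 2) * (2 / l) by field; rewrite gt_eqF.
  by rewrite AE mul1r.
have [[|n] wl] := sin_eq0_natpi (ltW (mulr_gt0 w0 l0)) sl.
  by have := mulr_gt0 w0 l0; rewrite wl mul0r ltxx.
by exists n.
Qed.

(** The eigenfunctions are sines with a common amplitude.  Their frequencies are
  distinct multiples of [pi / l], since equal frequencies would give proportional,
  hence not orthogonal, eigenfunctions; being ordered, the frequency of index [k]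
  is at least the multiple [k + 1]. *)
Lemma eigen_estimates l (rho : nat -> R) (e : nat -> L2D l) : 0 < l ->
  dirichlet_eigensystem rho e -> exists2 C : R, 0 <= C &
  [/\ forall k x, x \in `]0, l[ -> `|e k x| <= C,
      forall k x y, x \in `]0, l[ -> y \in `]0, l[ ->
        `|e k x - e k y| <= C * Num.sqrt (rho k) * `|x - y|,
      forall k a b, 0 <= a -> a < b -> b <= l ->
        `|\int[leb]_(x in `]a, b[) e k x| <= C / Num.sqrt (rho k) &
      forall k, k.+1%:R * (pi / l) <= Num.sqrt (rho k)].
Proof.
move=> l0 [[rho0 rhoh] ef orth _].
have e1 k : inner (e k) (e k) = 1 by rewrite orth eqxx.
have es k := eigen_sine l0 (rho0 k) (ef k) (e1 k).
have w0 k : 0 < Num.sqrt (rho k) by rewrite sqrtr_gt0.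
pose c : R := Num.sqrt (2 / l).
have Ac A : A ^+ 2 = 2 / l -> `|A| = c by move=> AE; rewrite /c -AE sqrtr_sqr.
have c0 : 0 <= c by exact: sqrtr_ge0.
exists (c * 2); first by rewrite mulr_ge0.
split.
- move=> k x xi; have [A [/Ac AE -> // _]] := es k.
  rewrite normrM AE; have := sin_max (Num.sqrt (rho k) * x).
  by move=> /(ler_wpM2l c0); lra.
- move=> k x y xi yi; have [A [/Ac AE eA _]] := es k.
  rewrite !eA// -mulrBr normrM AE.
  have := sin_lip (Num.sqrt (rho k) * x) (Num.sqrt (rho k) * y).
  rewrite -mulrBr normrM (gtr0_norm (w0 k)) => H.
  have := ler_wpM2l c0 H.
  have : 0 <= c * (Num.sqrt (rho k) * `|x - y|).
    by rewrite !mulr_ge0// ltW.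
  lra.
- move=> k a b a0 ab bl; have [A [/Ac AE eA _]] := es k.
  have -> : \int[leb]_(x in `]a, b[) e k x =
      \int[leb]_(x in `]a, b[) (A * sin (Num.sqrt (rho k) * x)).
    apply: eq_Rintegral => x /set_mem; rewrite /= in_itv/= => /andP[ax xb].
    by rewrite eA// in_itv/= (le_lt_trans a0)//= (lt_le_trans xb).
  rewrite RintegralZl//; last first.
    have cs : continuous (fun x => sin (Num.sqrt (rho k) * x)).
      by move=> x; exact: is_derive_continuous (is_derive_sin_scale _ _).
    have icc : leb.-integrable `[a, b] (EFin \o (fun x => sin (Num.sqrt (rho k) * x))).
      apply: continuous_compact_integrable; first exact: segment_compact.
      exact: continuous_subspaceT.
    by apply: integrableS icc => //; apply: subset_itvW.
  rewrite normrM AE -mulrA ler_wpM2l//; exact: integral_sin_le.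
(* [n k] is the multiple of [pi / l] selected by the mode [k]; it is strictly
   increasing in [k]. *)
- pose n k := xget 0%N [set n | Num.sqrt (rho k) * l = n.+1%:R * pi].
  have nE k : Num.sqrt (rho k) * l = (n k).+1%:R * pi.
    have [A [_ _ [m mE]]] := es k.
    exact: (@xgetPex _ 0%N [set n | Num.sqrt (rho k) * l = n.+1%:R * pi]
              (ex_intro _ m mE)).
  have pi0 := pi_gt0 R.
  have ninj i j : n i = n j -> i = j.
    move=> nij; apply/eqP; apply/negPn/negP => ij.
    have wij : Num.sqrt (rho i) = Num.sqrt (rho j).
      by apply: (mulIf (lt0r_neq0 l0)); rewrite !nE nij.
    have [A [AE eA _]] := es i; have [B [BE eB _]] := es j.
    have B0 : B != 0.
      by apply: contra_eq_neq BE => ->; rewrite expr0n/= eq_sym mulf_neq0// invr_eq0 gt_eqF.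
    have A0 : A != 0.
      by apply: contra_eq_neq AE => ->; rewrite expr0n/= eq_sym mulf_neq0// invr_eq0 gt_eqF.
    have : inner (e i) (e j) = A / B.
      rewrite -[RHS]mulr1 -(e1 j) !inner_itv -RintegralZl//; last first.
        have := L2D_mul_integrable (e j) (e j).
        rewrite -(Lfun1_integrable) => _.
        have /integrableP[m1 m2] := L2D_mul_integrable (e j) (e j).
        apply/integrableP; split; first exact: measurable_funTS.
        apply: le_lt_trans m2; rewrite [leRHS]integral_muD//.
        exact: measurableT_comp.
      apply: eq_Rintegral => x /set_mem xi.
      rewrite eA// eB// wij; field; exact: B0.
    rewrite orth (negbTE ij) => /esym/eqP.
    by rewrite mulf_eq0 invr_eq0 (negbTE A0) (negbTE B0).
  have nmon i j : (i < j)%N -> (n i < n j)%N.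
    move=> ij; rewrite ltn_neqAle; apply/andP; split.
      by apply/eqP => /ninj E; rewrite E ltnn in ij.
    rewrite -ltnS -(ler_nat R) -(ler_pM2r pi0) -!nE.
    by rewrite ler_wpM2r ?(ltW l0)// ler_wsqrtr// rhoh// ltnW.
  move=> k; have nk : (k <= n k)%N.
    elim: k => // k IH; apply: leq_ltn_trans IH (nmon _ _ _).
    exact: ltnSn.
  by rewrite mulrA ler_pdivrMr// nE ler_wpM2r ?(ltW pi0)// ler_nat ltnS.
Qed.

End EigenEstimates.

(** * The solution operator in the eigenbasis *)

Section ContourScaling.
Context {R : realType}.
Local Open Scope complex_scope.
Notation leb := (@lebesgue_measure R).
Implicit Types (D : set R) (G : R -> R[i]) (g : R[i] -> R[i]).

Lemma CintegralZ D G (c : R) : measurable D -> cintegrable D G ->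
  Cintegral D (fun x => G x * c%:C) = Cintegral D G * c%:C.
Proof.
move=> mD [i1 i2]; rewrite /Cintegral.
have -> : \int[leb]_(x in D) complex.Re (G x * c%:C) =
    \int[leb]_(x in D) complex.Re (G x) * c.
  rewrite -RintegralZr//; apply: eq_Rintegral => x _.
  by case: (G x) => a b; rewrite /= mulr0 subr0.
have -> : \int[leb]_(x in D) complex.Im (G x * c%:C) =
    \int[leb]_(x in D) complex.Im (G x) * c.
  rewrite -RintegralZr//; apply: eq_Rintegral => x _.
  by case: (G x) => a b; rewrite /= mulr0 add0r.
by apply/eqP; rewrite eq_complex/= !mulr0 subr0 add0r !eqxx.
Qed.

Lemma contour_integralZ (kappa theta : R) g (c : R) :
  contour_integrable kappa theta g ->
  contour_integral kappa theta (fun z => g z * c%:C) =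
  contour_integral kappa theta g * c%:C.
Proof.
move=> [i1 i2 i3]; rewrite /contour_integral !mulrDl mulNr.
rewrite -!CintegralZ//; congr (- _ + _ + _); apply: eq_Cintegral => x _;
  by rewrite mulrAC.
Qed.

Lemma eq_contour_integral (kappa theta : R) g1 g2 :
  0 <= pi - theta ->
  (forall z, contour kappa theta z -> g1 z = g2 z) ->
  contour_integral kappa theta g1 = contour_integral kappa theta g2.
Proof.
move=> p0 E; rewrite /contour_integral.
have R1 x : `[kappa, +oo[%classic x -> contour kappa theta (polar x (- (pi - theta))).
  by rewrite /= in_itv/= andbT => kx; left; exists x => //; right.
have R2 x : `[kappa, +oo[%classic x -> contour kappa theta (polar x (pi - theta)).
  by rewrite /= in_itv/= andbT => kx; left; exists x => //; left.
have R3 x : `[- (pi - theta), pi - theta]%classic x -> contour kappa theta (polar kappa x).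
  by rewrite /= in_itv/= -ler_norml => kx; right; exists x.
congr (- _ + _ + _); apply: eq_Cintegral => x xi; rewrite E//.
- exact: R1.
- exact: R3.
- exact: R2.
Qed.

End ContourScaling.

Section SolutionOperatorBound.
Context {R : realType}.
Local Open Scope complex_scope.
Variables (l : R) (rho : nat -> R) (e : nat -> L2D l).

Lemma frac_laplacian_coeff (s : R) (v w : L2D l) k :
  dirichlet_eigensystem rho e -> frac_laplacian rho e s v w ->
  inner w (e k) = rho k `^ s * inner v (e k).
Proof.
move=> [_ _ orth _] /(@cvgH_inner _ _ _ _ (e k)) H.
apply/esym; apply: (cvg_unique _ _ H); first exact: norm_hausdorff.
apply: cvg_trans (cvg_cst (rho k `^ s * inner v (e k))).
apply: near_eq_cvg; near=> n.
rewrite (inner_sum_basis orth (fun k => rho k `^ s * inner v (e k))).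
by rewrite ifT//; near: n; exact: nbhs_infty_gt.
Unshelve. all: by try exact: eventually_filter; end_near. Qed.

Lemma resolvent_coeff (s : R) (zeta : R[i]) (v : L2D l) (g : L2D l * L2D l) k :
  dirichlet_eigensystem rho e -> is_resolvent rho e s zeta v g ->
  (zeta + (rho k `^ s)%:C) * (inner g.1 (e k) +i* inner g.2 (e k))
    = (inner v (e k))%:C.
Proof.
move=> eig [a [f1 f2 E1 E2]].
have A1 := frac_laplacian_coeff k eig f1; have A2 := frac_laplacian_coeff k eig f2.
have := eq_inner (e k) E1; have := eq_inner (e k) E2.
rewrite inner0l !innerDl innerNl !innerZl A1 A2 => H2 H1.
case: zeta H1 H2 {E1 E2} => x y /= H1 H2.
apply/eqP; rewrite eq_complex/= addr0; apply/andP; split; apply/eqP.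
  by rewrite -H1; ring.
by rewrite -[RHS]H2; ring.
Qed.

Variables alpha beta s mu lambda kappa theta : R.
Hypothesis beta0 : 0 < beta.
Hypothesis beta_alpha : beta <= alpha.
Hypothesis alpha1 : alpha < 1.
Hypothesis mu0 : 0 < mu.
Hypothesis lambda0 : 0 <= lambda.
Hypothesis kappa0 : 0 < kappa.
Hypothesis theta0 : 0 < theta.
Hypothesis theta_pi : theta < pi / 2.
Hypothesis eig : dirichlet_eigensystem rho e.

Lemma hfun_add_neq0 (z : R[i]) (rr : R) : contour kappa theta z -> 0 < rr ->
  hfun alpha beta mu lambda z + rr%:C != 0.
Proof.
move=> cz rr0.
have phi_pi : pi - theta < pi by rewrite gtrBl.
have p0 := ltW (pi_sub_gt0 theta_pi).
have a0 : 0 < alpha by exact: lt_le_trans beta_alpha.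
suff [r [psi [r0 pp ->]]] : exists r psi : R,
    [/\ 0 < r, `|psi| <= pi - theta & z = polar r psi].
  rewrite hfun_polar//; last exact: le_lt_trans phi_pi.
  have S := hpolar_sector beta0 beta_alpha alpha1 mu0 lambda0 r0 pp phi_pi (ltW rr0).
  apply/eqP => E0; move: S; rewrite E0 ComplexField.Normc.normc0 leNgt.
  rewrite mulr_gt0 ?cos_half_gt0// addr_gt0// mulr_gt0 ?powR_gt0 ?invr_gt0//.
case: cz => [[r kr [->|->]]|[psi pp ->]].
- by exists r, (pi - theta); split; rewrite ?ger0_norm// (lt_le_trans kappa0).
- by exists r, (- (pi - theta)); split; rewrite ?normrN ?ger0_norm// (lt_le_trans kappa0).
- by exists kappa, psi.
Qed.

(** On the mode [e k] the resolvent acts as a scalar, so that testing the weak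
  definition against [e k] gives the scalar contour integral. *)
Lemma solution_operator_coeff S t v k :
  solution_operator alpha beta s mu lambda rho e kappa theta S -> 0 < t ->
  inner (S t v) (e k) =
    relaxation alpha beta mu lambda kappa theta (rho k `^ s) t * inner v (e k).
Proof.
move=> hS t0; have [G [hG /(_ (e k)) E]] := hS t v t0.
have rr0 : 0 < rho k `^ s by rewrite powR_gt0//; case: eig => [[]].
have th01 : 0 <= (0 : R) <= 1 by rewrite lexx ler01.
have q01 : 0 <= (2^-1 : R) <= 1 by rewrite invr_ge0 ler0n invf_le1// ler1n.
have thq : alpha * 0 < 2^-1 :> R by rewrite mulr0 invr_gt0.
have ci : contour_integrable kappa theta (kernel alpha beta mu lambda t (rho k `^ s)).
  by apply: (kernel_integrable (T := t) (th := 0) (q := 2^-1)).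
have phi0 := ltW (pi_sub_gt0 theta_pi).
rewrite (@eq_contour_integral _ _ _ _ (fun z =>
    kernel alpha beta mu lambda t (rho k `^ s) z * (inner v (e k))%:C)) in E => //.
- rewrite contour_integralZ// mulrA in E.
  have ReM (x y : R[i]) (c : R) : y = x * c%:C -> complex.Re y = complex.Re x * c.
    by move=> ->; case: x => a b; rewrite /= mulr0 subr0.
  exact: (ReM _ _ _ E).
- move=> z cz; rewrite /kernel -mulrA; congr (_ * _).
  have := resolvent_coeff k eig (hG z cz) => <-.
  by rewrite mulKf// hfun_add_neq0.
Qed.

(** The operator is diagonal in an orthonormal basis. *)
Lemma solution_operator_norm S t v (M : R) :
  solution_operator alpha beta s mu lambda rho e kappa theta S -> 0 < t ->
  (forall k, `|relaxation alpha beta mu lambda kappa theta (rho k `^ s) t| <= M) ->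
  normH (S t v) <= M * normH v.
Proof.
move=> hS t0 hM; have [_ _ orth comp] := eig.
apply: (normH_le_of_coeff orth comp); first exact: le_trans (hM 0%N).
move=> k; rewrite (solution_operator_coeff v k hS t0) normrM.
by rewrite ler_wpM2r.
Qed.

End SolutionOperatorBound.

(** * Second moments and summation by parts *)

Section SecondMoments.
Context {R : realType} {d : measure_display} {Om : measurableType d}.
Variable P : probability Om R.

Lemma mul_integrable_of_sqr (X Y : Om -> R) (a b : R) :
  measurable_fun setT X -> measurable_fun setT Y ->
  ('E_P[fun om => (X om * X om)%R] = a%:E)%E ->
  ('E_P[fun om => (Y om * Y om)%R] = b%:E)%E ->
  P.-integrable setT (EFin \o (fun om => X om * Y om)).
Proof.
rewrite unlock => mX mY EX EY.
have sq (Z : Om -> R) (z : R) : measurable_fun setT Z ->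
    (\int[P]_om (Z om * Z om)%:E = z%:E)%E ->
    P.-integrable setT (EFin \o (fun om => Z om * Z om)).
  move=> mZ Ez; apply/integrableP; split.
    by apply/measurable_EFinP; exact: measurable_funM.
  under eq_integral do rewrite /= ger0_norm -?expr2 ?sqr_ge0//.
  by under eq_integral do rewrite expr2; rewrite Ez ltry.
have := integrableD measurableT (sq X a mX EX) (sq Y b mY EY).
apply: le_integrable => //; first by apply/measurable_EFinP; exact: measurable_funM.
move=> om _; rewrite /= lee_fin normrM.
rewrite [leRHS]ger0_norm; last by rewrite addr_ge0// -expr2 sqr_ge0.
rewrite -2!expr2 -(real_normK (num_real (X om))) -(real_normK (num_real (Y om))).
have := sqr_ge0 (`|X om| - `|Y om|); rewrite sqrrB.
have : 0 <= `|X om| * `|Y om| by rewrite mulr_ge0.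
lra.
Qed.

Lemma second_moment (I : finType) (X : I -> Om -> R) (K : I -> I -> R)
    (c : I -> R) :
  (forall p, measurable_fun setT (X p)) ->
  (forall p q, ('E_P[fun om => (X p om * X q om)%R] = (K p q)%:E)%E) ->
  ('E_P[fun om => ((\sum_p c p * X p om) ^+ 2)%R] =
    (\sum_p \sum_q c p * c q * K p q)%:E)%E.
Proof.
move=> mX EX.
have iX p q : P.-integrable setT (EFin \o (fun om => X p om * X q om)).
  exact: (mul_integrable_of_sqr (mX p) (mX q) (EX p p) (EX q q)).
have iXc p q : P.-integrable setT
    (fun om => (c p * c q * (X p om * X q om))%:E).
  exact: (integrable_scale (c p * c q) measurableT (iX p q)).
rewrite unlock.
transitivity (\int[P]_om \sum_p \sum_q (c p * c q * (X p om * X q om))%:E)%E.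
  apply: eq_integral => om _; rewrite expr2 mulr_suml -sumEFin.
  apply: eq_bigr => p _; rewrite mulr_sumr -sumEFin; apply: eq_bigr => q _.
  by congr EFin; ring.
rewrite integral_sum//; last by move=> p; exact: integrable_sum.
rewrite -sumEFin; apply: eq_bigr => p _; rewrite integral_sum// -sumEFin.
apply: eq_bigr => q _.
transitivity (\int[P]_om ((c p * c q)%:E * (X p om * X q om)%:E))%E.
  by apply: eq_integral => om _; rewrite -EFinM.
rewrite integralZl//; last exact: (iX p q).
by have := EX p q; rewrite unlock => ->.
Qed.

End SecondMoments.

Section SummationByParts.
Context {R : realType}.
Implicit Types (A : nat -> R) (g : nat -> R).

(** The coefficient of [g i] in the sum of [A i * (g i.+1 - g i)]. *)
Definition nodal A (m i : nat) : R :=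
  (if i is j.+1 then A j else 0) - (if (i < m)%N then A i else 0).

Lemma sum_nodal A g m :
  \sum_(i < m) A i * (g i.+1 - g i) = \sum_(i < m.+1) nodal A m i * g i.
Proof.
rewrite [RHS](_ : _ = \sum_(i < m.+1) (if i : nat is j.+1 then A j else 0) * g i -
    \sum_(i < m.+1) (if (i < m)%N then A i else 0) * g i); last first.
  by rewrite -sumrB; apply: eq_bigr => i _; rewrite /nodal mulrBl.
rewrite big_ord_recl mul0r add0r [X in _ - X]big_ord_recr/= ltnn mul0r addr0.
rewrite -sumrB; apply: eq_bigr => i _.
by rewrite ltn_ord mulrBr.
Qed.

Lemma sum_nodal0 A m : \sum_(i < m.+1) nodal A m i = 0.
Proof.
have := sum_nodal A (fun=> 1) m; under [in LHS]eq_bigr do rewrite subrr mulr0.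
by rewrite big1// => E; rewrite [RHS]E; apply: eq_bigr => i _; rewrite mulr1.
Qed.

Lemma sum_nodal2 A (K : nat -> nat -> R) m :
  \sum_(i < m.+1) \sum_(j < m.+1) nodal A m i * nodal A m j * K i j =
  \sum_(i < m) \sum_(j < m) A i * A j *
     (K i.+1 j.+1 - K i j.+1 - K i.+1 j + K i j).
Proof.
pose g i := \sum_(j < m.+1) nodal A m j * K i j.
transitivity (\sum_(i < m.+1) nodal A m i * g i).
  apply: eq_bigr => i _; rewrite mulr_sumr; apply: eq_bigr => j _; ring.
rewrite -sum_nodal; apply: eq_bigr => i _; rewrite /g.
rewrite -!(sum_nodal A (K _)) -sumrB mulr_sumr; apply: eq_bigr => j _; ring.
Qed.

End SummationByParts.

Section PinnedVariance.
Context {R : realType}.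

(** Recentring a fractional Brownian motion at [c] does not change the variance
  of a combination of its increments, and the covariance of the recentred process
  is at most the product of the standard deviations. *)
Lemma fbm_variance_le (n : nat) (H c : R) (a t : 'I_n -> R) :
  0 <= H <= 2^-1 -> \sum_(i < n) a i = 0 ->
  \sum_(i < n) \sum_(j < n) a i * a j * fbm_cov H (t i) (t j) <=
    (\sum_(i < n) `|a i| * `|t i - c| `^ H) ^+ 2.
Proof.
move=> hH a0.
pose f (s : R) := 2^-1 * (`|s| `^ (2 * H) - `|s - c| `^ (2 * H)).
pose K (s s' : R) := 2^-1 * (`|s - c| `^ (2 * H) + `|s' - c| `^ (2 * H)
  - `|(s - c) - (s' - c)| `^ (2 * H)).
have KE s s' : fbm_cov H s s' = K s s' + f s + f s'.
  rewrite /fbm_cov /K /f (_ : (s - c) - (s' - c) = s - s'); first by lra.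
  by ring.
have -> : \sum_(i < n) \sum_(j < n) a i * a j * fbm_cov H (t i) (t j) =
    \sum_(i < n) \sum_(j < n) a i * a j * K (t i) (t j).
  have E i : \sum_(j < n) a i * a j * fbm_cov H (t i) (t j) =
      \sum_(j < n) a i * a j * K (t i) (t j) + a i * \sum_(j < n) a j * f (t j).
    transitivity (\sum_(j < n) (a i * a j * K (t i) (t j) + a i * f (t i) * a j
        + a i * (a j * f (t j)))).
      by apply: eq_bigr => j _; rewrite KE; ring.
    by rewrite !big_split/= -!mulr_sumr a0 mulr0 addr0.
  by under eq_bigr do rewrite E; rewrite big_split/= -mulr_suml a0 mul0r addr0.
rewrite expr2 mulr_suml; apply: ler_sum => i _; rewrite mulr_sumr.
apply: ler_sum => j _; apply: le_trans (ler_norm _) _.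
have -> : `|a i| * `|t i - c| `^ H * (`|a j| * `|t j - c| `^ H) =
    `|a i * a j| * (`|t i - c| `^ H * `|t j - c| `^ H) by rewrite normrM; ring.
rewrite normrM ler_wpM2l// /K normrM ger0_norm ?invr_ge0// ler_pdivrMl//.
exact: fbm_kernel_bound.
Qed.

End PinnedVariance.

(** * Time averages of a singular convolution kernel *)

Section IndicatorIntegrals.
Context {R : realType}.
Notation leb := (@lebesgue_measure R).
Implicit Types (f : R -> R) (a b c L M : R).

Lemma Rintegral_indic_itv f a b L : 0 <= a -> a < b -> a < L ->
  leb.-integrable `]0, L[ (EFin \o f) ->
  \int[leb]_(x in `]0, L[) (f x * \1_`]a, b]%classic x) =
  \int[leb]_(x in `]a, Num.min b L[) f x.
Proof.
move=> a0 ab aL fi.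
have -> : \int[leb]_(x in `]0, L[) (f x * \1_`]a, b]%classic x) =
    \int[leb]_(x in `]0, L[) (f \_ `]a, b]%classic) x.
  apply: eq_Rintegral => x _; rewrite patchE indicE.
  by case: ifPn => xi; rewrite ?mulr1 ?mulr0.
rewrite -Rintegral_mkcondr; have [bL|Lb] := ltP b L.
  rewrite [in RHS]Rintegral_itv_bndo_bndc.
    congr Rintegral; apply/seteqP; split=> x /=; rewrite !in_itv/=.
      by case.
    move=> /andP[ax xb]; split; rewrite ?ax//.
    by rewrite (le_lt_trans a0)// (le_lt_trans xb).
  apply: integrableS fi => // x /=; rewrite !in_itv/= => /andP[ax xb].
  by rewrite (le_lt_trans a0)// (lt_trans xb).
congr Rintegral; apply/seteqP; split=> x /=; rewrite !in_itv/=.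
  by move=> [/andP[_ ->] /andP[->]].
by move=> /andP[ax xL]; rewrite ax xL (le_lt_trans a0)//= (le_trans (ltW xL)).
Qed.

Lemma Rintegral_indic_out f a b L : L <= a ->
  \int[leb]_(x in `]0, L[) (f x * \1_`]a, b]%classic x) = 0.
Proof.
move=> La; transitivity (\int[leb]_(x in `]0, L[) (0 : R)); last first.
  by rewrite Rintegral_cst// mul0r.
apply: eq_Rintegral => x; rewrite inE/= in_itv/= => /andP[_ xL]; rewrite indicE.
rewrite (_ : x \in _ = false) ?mulr0//; apply/negbTE/negP.
by rewrite inE/= in_itv/= => /andP[ax _];
  have := lt_le_trans ax (le_trans (ltW xL) La); rewrite ltxx.
Qed.

Lemma integrable_cst_oo a b c : leb.-integrable `]a, b[ (EFin \o (fun=> c)).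
Proof.
apply/integrableP; split; first by apply/measurable_EFinP; exact: measurable_cst.
rewrite (@integral_cst _ _ _ leb _ _ `|c|%:E)//= lebesgue_measure_itv/=.
by case: ifP => _; rewrite -?EFinB -?EFinM ?mule0 ltry.
Qed.

Lemma Rintegral_cst_oo a b c : a <= b -> \int[leb]_(x in `]a, b[) c = c * (b - a).
Proof.
move=> ab; rewrite Rintegral_cst//= lebesgue_measure_itv/= lte_fin.
by case: ltP => //= ba; rewrite (_ : b - a = 0)//; lra.
Qed.

Lemma Rintegral_avg f a b c M : a <= b -> 
  leb.-integrable `]a, b[ (EFin \o f) ->
  (forall x, a < x -> x < b -> `|f x - c| <= M) ->
  `|(\int[leb]_(x in `]a, b[) f x) - c * (b - a)| <= M * (b - a).
Proof.
move=> ab fi fM; rewrite -!Rintegral_cst_oo// -RintegralB//; last first.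
  exact: integrable_cst_oo.
apply: le_abs_Rintegral_dom => //; first exact: integrable_cst_oo.
by move=> x; rewrite /= in_itv/= => /andP[ax xb]; exact: fM.
Qed.

End IndicatorIntegrals.

Section TimeVariance.
Context {R : realType}.
Notation leb := (@lebesgue_measure R).
Variables (T H q g0 g1 : R).
Hypothesis (T0 : 0 < T) (q0 : 0 <= q) (qH : q < H) (H12 : H <= 2^-1).
Hypothesis (g00 : 0 <= g0) (g10 : 0 <= g1).

Definition time_kernel_bound (K : R) (U : R -> R) :=
  (forall r, 0 < r -> r <= T -> `|U r| <= K * r `^ (- q)) /\
  (forall r1 r2, 0 < r1 -> r1 <= r2 -> r2 <= T ->
    `|U r1 - U r2| <= K * r1 `^ (- (1 + q)) * (r2 - r1)).

Definition lipschitz_weight (gamma : R -> R) :=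
  (forall v, 0 <= v -> v <= T -> `|gamma v| <= g0) /\
  (forall v w, 0 <= v -> v <= w -> w <= T ->
     `|gamma v - gamma w| <= g1 * (w - v)).

Lemma measurable_fun_locally_lipschitz (a b : R) (f : R -> R) :
  (forall x, a < x -> x < b -> exists2 M, 0 < M & exists2 e, 0 < e & forall y,
     `|x - y| < e -> a < y -> y < b -> `|f x - f y| <= M * `|x - y|) ->
  measurable_fun `]a, b[ f.
Proof.
move=> fl; apply: open_continuous_measurable_fun; first exact: interval_open.
move=> x; rewrite inE/= in_itv/= => /andP[ax xb].
have [M M0 [e e0 fM]] := fl x ax xb.
apply/cvgrPdist_le => eps eps0; near=> y.
have xy : `|x - y| < e.
  by near: y; apply/nbhs_ballP; exists e.
have xy2 : `|x - y| < eps / M.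
  by near: y; apply/nbhs_ballP; exists (eps / M) => //=; exact: divr_gt0.
apply: le_trans (fM y xy _ _) _.
- by near: y; apply: lt_nbhsr.
- by near: y; apply: lt_nbhsl.
- by rewrite mulrC -ler_pdivlMr// ltW.
Unshelve. all: by end_near. Qed.


Section FixedTime.
Variables (gamma U : R -> R) (K t : R).
Hypothesis (hg : lipschitz_weight gamma) (hU : time_kernel_bound K U).
Hypothesis (K0 : 0 <= K) (tT : t <= T).

Let psi (v : R) := U (t - v) * gamma v.

Lemma convolution_kernel_le (v : R) : 0 <= v -> v < t ->
  `|psi v| <= K * g0 * (t - v) `^ (- q).
Proof.
move=> v0 vt; rewrite /psi normrM mulrAC ler_pM//.
- by apply: hU.1; rewrite ?subr_gt0// (le_trans _ tT)// gerBl.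
- by apply: hg.1 => //; exact: le_trans (ltW vt) tT.
Qed.

(** By the product rule; the factor [T] allows the part where [gamma] varies to be
  measured by the more singular power. *)
Lemma convolution_kernel_osc (d v w : R) : 0 < d -> 0 <= v -> 0 <= w ->
  v <= t - d -> w <= t - d ->
  `|psi v - psi w| <= K * (g0 + g1 * T) * d `^ (- (1 + q)) * `|v - w|.
Proof.
move=> d0; wlog vw : v w / v <= w.
  move=> W v0 w0 vt wt; have [vw|/ltW wv] := leP v w; first exact: W.
  by rewrite distrC [`|v - w|]distrC W.
move=> v0 w0 vt wt.
have q1 : 0 <= 1 + q by rewrite addr_ge0.
have dw : d <= t - w by rewrite lerBrDr addrC -lerBrDr.
have tw0 : 0 < t - w by exact: lt_le_trans dw.
have wT : w <= T by rewrite (le_trans wt)// (le_trans _ tT)// gerBl ltW.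
have dT : d <= T by rewrite (le_trans dw)// (le_trans _ tT)// gerBl.
have dd : (t - w) `^ (- (1 + q)) <= d `^ (- (1 + q)).
  by rewrite !powRN lef_pV2 ?posrE ?powR_gt0// ge0_ler_powR ?nnegrE// ltW.
have dd2 : (t - w) `^ (- q) <= T * d `^ (- (1 + q)).
  apply: le_trans (_ : d `^ (- q) <= _).
    by rewrite !powRN lef_pV2 ?posrE ?powR_gt0// ge0_ler_powR ?nnegrE// ltW.
  have -> : d `^ (- q) = d * d `^ (- (1 + q)).
    rewrite -{2}(powRr1 (ltW d0)) -powRD ?(gt_eqF d0) ?implybT//.
    by congr (_ `^ _); rewrite opprD addrA subrr add0r.
  by rewrite ler_wpM2r ?powR_ge0.
have D0 := powR_ge0 d (- (1 + q)).
rewrite distrC [`|v - w|]distrC (ger0_norm (_ : 0 <= w - v)); last by rewrite subr_ge0.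
have -> : psi w - psi v = (U (t - w) - U (t - v)) * gamma w
    + U (t - v) * (gamma w - gamma v) by rewrite /psi; ring.
have -> : K * (g0 + g1 * T) * d `^ (- (1 + q)) * (w - v) =
  K * d `^ (- (1 + q)) * (w - v) * g0 + K * (T * d `^ (- (1 + q))) * (g1 * (w - v)).
  by ring.
apply: le_trans (ler_normD _ _) (lerD _ _); rewrite normrM ler_pM//.
- apply: le_trans (hU.2 _ _ tw0 _ _) _.
  + by rewrite lerD2l lerN2.
  + by rewrite (le_trans _ tT)// gerBl.
  + have -> : t - v - (t - w) = w - v by ring.
    by rewrite ler_wpM2r ?subr_ge0// ler_wpM2l.
- exact: hg.1.
- have tv0 : 0 < t - v by rewrite (lt_le_trans tw0)// lerD2l lerN2.
  apply: le_trans (hU.1 _ tv0 _) _; first by rewrite (le_trans _ tT)// gerBl.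
  rewrite ler_wpM2l// (le_trans _ dd2)// !powRN lef_pV2 ?posrE ?powR_gt0//.
  by rewrite ge0_ler_powR ?nnegrE ?(ltW tw0) ?(ltW tv0)// lerD2l lerN2.
- by rewrite distrC; apply: hg.2.
Qed.

Lemma convolution_kernel_measurable : measurable_fun `]0, t[ psi.
Proof.
apply: measurable_fun_locally_lipschitz => x x0 xt.
have d0 : 0 < (t - x) / 2 by rewrite divr_gt0// subr_gt0.
exists (K * (g0 + g1 * T) * ((t - x) / 2) `^ (- (1 + q)) + 1).
  by rewrite ltr_wpDl// !mulr_ge0 ?powR_ge0// addr_ge0// mulr_ge0// ltW.
exists ((t - x) / 2) => // y xy y0 yt.
apply: le_trans (convolution_kernel_osc d0 (ltW x0) (ltW y0) _ _) _.
- by lra.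
- by move: xy; rewrite ltr_norml => /andP[]; lra.
- by rewrite ler_wpM2r// lerDl.
Qed.

Lemma convolution_kernel_integrable : 
  leb.-integrable `]0, t[ (EFin \o psi).
Proof.
have q1 : 0 <= q < 1 by rewrite q0/= (lt_le_trans qH)// (le_trans H12)// invf_le1// ler1n.
have ib : leb.-integrable `]0, t[ (EFin \o (fun v => K * g0 * (t - v) `^ (- q))).
  by apply: integrable_scale => //; exact: integrable_powR_sing.
apply: integrable_dom ib _ => //; first exact: convolution_kernel_measurable.
move=> v; rewrite /= in_itv/= => /andP[v0 vt]; apply: convolution_kernel_le => //.
exact: ltW.
Qed.

Variable tau : R.
Hypothesis tau0 : 0 < tau.

Definition time_average (i : nat) : R :=
  tau^-1 * \int[leb]_(v in `]0, t[)
    (psi v * \1_`]i%:R * tau, i.+1%:R * tau]%classic v).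

Lemma time_average_out i : t <= i%:R * tau -> time_average i = 0.
Proof. by move=> ti; rewrite /time_average Rintegral_indic_out// mulr0. Qed.

Let step i : i.+1%:R * tau = i%:R * tau + tau.
Proof. by rewrite -natr1 mulrDl mul1r. Qed.

Lemma time_averageE i : i%:R * tau < t -> time_average i =
  tau^-1 * \int[leb]_(v in `]i%:R * tau, Num.min (i.+1%:R * tau) t[) psi v.
Proof.
move=> it; rewrite /time_average Rintegral_indic_itv//.
- by rewrite mulr_ge0// ltW.
- by rewrite step ltrDl.
- exact: convolution_kernel_integrable.
Qed.

(** A cell ending at the singularity is the worst case, and there the average of
  the integrable singularity is of order [tau `^ (- q)]. *)
Lemma time_average_le i : `|time_average i| <= 2 * K * g0 * tau `^ (- q).
Proof.
have R0 : 0 <= 2 * K * g0 * tau `^ (- q) by rewrite !mulr_ge0 ?powR_ge0.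
have [ti|it] := leP t (i%:R * tau); first by rewrite time_average_out// normr0.
rewrite time_averageE//; set a := i%:R * tau; set b := Num.min _ _.
have a0 : 0 <= a by rewrite mulr_ge0// ltW.
have ab : a < b by rewrite lt_min it andbT /a step ltrDl.
have bt : b <= t by rewrite ge_min lexx orbT.
have ba : b - a <= tau by rewrite lerBlDl -step ge_min lexx.
have q12 : q <= 2^-1 by exact: le_trans (ltW qH) H12.
have q1 : 0 <= q < 1 by rewrite q0/= (le_lt_trans q12)// invf_lt1// ltr1n.
have q1' : 0 < 1 - q by rewrite subr_gt0; case/andP: q1.
rewrite normrM ger0_norm ?invr_ge0 ?(ltW tau0)// ler_pdivrMl//.
have ii := integrable_powR_sing a bt q1.
have ib : leb.-integrable `]a, b[ (EFin \o (fun v => K * g0 * (t - v) `^ (- q))).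
  by apply: integrable_scale.
apply: le_trans (le_abs_Rintegral_dom _ ib _) _ => //.
- move=> v; rewrite /= in_itv/= => /andP[av vb]; apply: convolution_kernel_le.
    exact: ltW (le_lt_trans a0 av).
  exact: lt_le_trans bt.
rewrite RintegralZl//.
have -> : tau * (2 * K * g0 * tau `^ (- q)) = K * g0 * (2 * (tau * tau `^ (- q))) by ring.
apply: ler_wpM2l; first exact: mulr_ge0.
apply: le_trans (Rintegral_powR_sing ab bt q1) _.
have -> : tau * tau `^ (- q) = tau `^ (1 - q).
  by rewrite -{1}(powRr1 (ltW tau0)) -powRD// (gt_eqF tau0) implybT.
rewrite mulrC ler_pM ?powR_ge0 ?invr_ge0 ?(ltW q1')//.
  rewrite -[leRHS]invrK lef_pV2 ?posrE ?invr_gt0//.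
  by rewrite lerBrDl -lerBrDr (le_trans q12)// [leRHS](_ : _ = 2^-1)//; field.
by rewrite ge0_ler_powR ?nnegrE ?(ltW q1') ?(ltW tau0)// subr_ge0 ltW.
Qed.

Lemma time_average_near i (c d : R) : 0 < d -> i.+1%:R * tau <= t - d ->
  i%:R * tau <= c -> c <= i.+1%:R * tau ->
  `|time_average i - psi c| <= K * (g0 + g1 * T) * d `^ (- (1 + q)) * tau.
Proof.
move=> d0 itd ic ci; have i0 : 0 <= i%:R * tau by rewrite mulr_ge0// ltW.
have it1 : i.+1%:R * tau < t by rewrite (le_lt_trans itd)// gtrBl.
have it : i%:R * tau < t by rewrite (lt_trans _ it1)// step ltrDl.
have ab : i%:R * tau <= i.+1%:R * tau by rewrite step lerDl ltW.
rewrite time_averageE// (min_idPl (ltW it1)).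
have H1 := @Rintegral_avg _ psi (i%:R * tau) (i.+1%:R * tau) (psi c)
  (K * (g0 + g1 * T) * d `^ (- (1 + q)) * tau) ab.
have E : i.+1%:R * tau - i%:R * tau = tau by rewrite step addrAC subrr add0r.
rewrite E in H1.
rewrite -(ler_pM2r tau0); apply: le_trans (H1 _ _).
- rewrite -[X in _ * X <= _](gtr0_norm tau0) -normrM mulrBl mulrAC mulVf ?gt_eqF//.
  by rewrite mul1r.
- apply: integrableS convolution_kernel_integrable => // x; rewrite /= !in_itv/=.
  by move=> /andP[ax xb]; rewrite (le_lt_trans i0)// (lt_trans xb).
- move=> v iv vi; apply: le_trans (convolution_kernel_osc d0 _ _ _ _) _.
  + exact: ltW (le_lt_trans i0 iv).
  + exact: le_trans ic.
  + exact: le_trans (ltW vi) itd.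
  + exact: le_trans ci itd.
  + apply: ler_wpM2l; first by rewrite !mulr_ge0 ?powR_ge0// addr_ge0// mulr_ge0// ltW.
    by rewrite ler_norml; move: (step i) => Es; apply/andP; split; lra.
Qed.

End FixedTime.
End TimeVariance.

(** * Variance in time *)

Section TimeVarianceSum.
Context {R : realType}.

Lemma sum_indic_le (n : nat) (p : nat -> bool) (c : R) : 0 <= c ->
  (forall i j, p i -> p j -> i = j) ->
  \sum_(i < n) (if p i then c else 0) <= c.
Proof.
move=> c0 pu; have [[j pj]|np] := pselect (exists j : 'I_n, p j); last first.
  rewrite big1// => i _; case: ifP => // pi0.
  by exfalso; apply: np; exists i.
rewrite (bigD1 j)//= pj big1 ?addr0// => i ij; case: ifP => // pi0.
by move: ij; rewrite -(inj_eq val_inj)/= (pu _ _ pi0 pj) eqxx.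
Qed.

Lemma sum_rev_le (g : nat -> R) (n N : nat) : (forall j, 0 <= g j) ->
  \sum_(i < n) (if (i.+2 <= N)%N then g (N - i.+1)%N else 0) <=
  \sum_(1 <= j < N) g j.
Proof.
move=> g0; elim: N n => [|N IH] n; first by rewrite big1 ?big_geq.
case: n => [|n]; first by rewrite big_ord0 sumr_ge0.
rewrite big_ord_recl; case: N IH => [|N] IH.
  by rewrite big_geq// big1 ?addr0// => i _.
rewrite big_nat_recr//= addrC lerD//.
  by apply: le_trans (IH n); apply: ler_sum => i _; rewrite !ltnS subSS.
Qed.


Section Nodes.
Variables (T H q g0 g1 : R).
Hypothesis (T0 : 0 < T) (q0 : 0 <= q) (qH : q < H) (H12 : H <= 2^-1).
Hypothesis (g00 : 0 <= g0) (g10 : 0 <= g1).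
Variables (gamma U : R -> R) (K t : R) (m : nat).
Hypothesis (hg : lipschitz_weight T g0 g1 gamma) (hU : time_kernel_bound T q K U).
Hypothesis (K0 : 0 <= K) (t0 : 0 <= t) (tT : t <= T) (m0 : (0 < m)%N).

Let tau := T / m%:R.
Let A := time_average gamma U t tau.
(* The index of the cell containing [t], where the kernel is singular. *)
Let N := Num.truncn (t / tau).
Let a := H - q.
Let M := 14 * g0 + 6 * (g1 * T).

Let tau0 : 0 < tau. Proof. by rewrite divr_gt0// ltr0n. Qed.
Let tauT : tau <= T.
Proof. by rewrite ler_pdivrMr ?ltr0n// ler_peMr ?ler1n// ltW. Qed.
Let a0 : 0 < a. Proof. by rewrite subr_gt0. Qed.
Let H0 : 0 <= H. Proof. exact: ltW (le_lt_trans q0 qH). Qed.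
Let M0 : 0 <= M.
Proof. by rewrite addr_ge0// !mulr_ge0// ltW. Qed.
Let Nt : N%:R * tau <= t /\ t < N.+1%:R * tau.
Proof.
have /andP[h1 h2] : N%:R <= t / tau < N.+1%:R.
  by apply: truncn_itv; rewrite divr_ge0// ltW.
by rewrite -ler_pdivlMr// h1 -ltr_pdivrMr.
Qed.
Let mtau : m%:R * tau = T.
Proof. by rewrite mulrC divfK// pnatr_eq0 -lt0n. Qed.

Let powH_le (c x : R) : 0 <= x -> 1 <= c -> (c * x) `^ H <= c * x `^ H.
Proof.
move=> x0 c1; have c0 : 0 <= c by exact: le_trans c1.
rewrite (powRM _ c0 x0); apply: ler_wpM2r; first exact: powR_ge0.
by apply: ler1_powR => //; rewrite (le_trans H12)// invf_le1// ler1n.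
Qed.

Let powH_split (x : R) : 0 < x -> x `^ H = x `^ a * x `^ q.
Proof. by move=> x0; rewrite -powRD ?(gt_eqF x0) ?implybT// subrK. Qed.

Let powa_le (x : R) : 0 <= x -> x <= T -> x `^ a <= T `^ a.
Proof. by move=> x0 xT; rewrite ge0_ler_powR ?nnegrE ?(ltW a0)// ltW. Qed.

Let A_le i : `|A i| <= 2 * K * g0 * tau `^ (- q).
Proof. exact: (time_average_le T0 q0 qH H12 g00 g10 hg hU K0 tT tau0). Qed.

Let A_out i : (N < i)%N -> A i = 0.
Proof.
move=> Ni; apply: (time_average_out).
case: Nt => _ /ltW/le_trans; apply; rewrite ler_wpM2r ?(ltW tau0)// ler_nat//.
Qed.

Let nodalE i : nodal A m i = (if i is j.+1 then A j else 0) - A i.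
Proof.
rewrite /nodal; case: ifP => // /negbT; rewrite -leqNgt => mi.
congr (_ - _); apply/esym; apply: time_average_out.
by apply: le_trans tT _; rewrite -mtau ler_wpM2r ?(ltW tau0)// ler_nat.
Qed.

Let term_out i : (N.+1 < i)%N -> nodal A m i = 0.
Proof.
move=> Ni; rewrite nodalE; case: i Ni => // i Ni.
by rewrite !A_out ?subrr// ltnW.
Qed.

Let term_near i : (N <= i.+1)%N -> (i <= N.+1)%N ->
  `|nodal A m i| * `|i%:R * tau - t| `^ H <= K * M * T `^ a.
Proof.
move=> Ni iN; have [Nt1 Nt2] := Nt.
have d2 : `|i%:R * tau - t| <= 2 * tau.
  have iN' : i%:R * tau <= N.+1%:R * tau by rewrite ler_wpM2r ?(ltW tau0)// ler_nat.
  have Ni' : N%:R * tau <= i.+1%:R * tau by rewrite ler_wpM2r ?(ltW tau0)// ler_nat.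
  move: iN' Ni' Nt2 ; rewrite -!natr1 !mulrDl !mul1r.
  by move: Nt1; rewrite ler_norml => *; apply/andP; split; lra.
have n4 : `|nodal A m i| <= 4 * K * g0 * tau `^ (- q).
  rewrite nodalE; apply: le_trans (ler_normB _ _) _.
  have -> : 4 * K * g0 * tau `^ (- q) =
    2 * K * g0 * tau `^ (- q) + 2 * K * g0 * tau `^ (- q) by ring.
  apply: lerD => //; case: (i) => [|j]; last exact: A_le.
  by rewrite normr0 !mulr_ge0 ?powR_ge0.
have w : `|i%:R * tau - t| `^ H <= 2 * (tau `^ a * tau `^ q).
  rewrite -powH_split//; apply: le_trans (powH_le _ _); rewrite ?(ltW tau0) ?ler1n//.
  by rewrite ge0_ler_powR ?nnegrE// mulr_ge0// ltW.
apply: le_trans (ler_pM (normr_ge0 _) (powR_ge0 _ _) n4 w) _.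
have -> : 4 * K * g0 * tau `^ (- q) * (2 * (tau `^ a * tau `^ q)) =
    K * (8 * g0) * tau `^ a * (tau `^ (- q) * tau `^ q) by ring.
rewrite powRN mulVf ?mulr1 ?gt_eqF ?powR_gt0//.
apply: ler_pM; rewrite ?powR_ge0 ?powa_le ?(ltW tau0)// ?mulr_ge0//.
apply: ler_wpM2l => //; rewrite /M.
have : 0 <= g1 * T by rewrite mulr_ge0// ltW.
by have := g00; lra.
Qed.

(* At node 0 there is an average in place of a difference of averages, but the
   singularity is at distance [t]. *)
Let term_first : (1 < N)%N ->
  `|nodal A m 0| * `|0%:R * tau - t| `^ H <= K * M * T `^ a.
Proof.
move=> N1; have [Nt1 _] := Nt.
have t2 : 2 * tau <= t.
  by apply: le_trans Nt1; rewrite ler_wpM2r ?(ltW tau0)// ler_nat.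
have tp : 0 < t by rewrite (lt_le_trans _ t2)// mulr_gt0.
have tau_t : tau < t by rewrite (lt_le_trans _ t2)// ltr_pMl// ltr1n.
rewrite mul0r sub0r normrN (ger0_norm t0) nodalE sub0r normrN.
have q1 : 0 <= q < 1 by rewrite q0/= (lt_le_trans qH)// (le_trans H12)// invf_le1// ler1n.
have tq : (t / 2) `^ (- q) <= 2 * t `^ (- q).
  rewrite powRM ?invr_ge0// mulrC ler_wpM2r ?powR_ge0// powRN.
  rewrite -[2^-1]powR_inv1// -powRrM mulN1r powRN invrK.
  by rewrite ler1_powR ?ler1n//; case/andP: q1 => _ /ltW.
have A0 : `|A 0| <= K * g0 * (2 * t `^ (- q)).
  have tp' : 0%:R * tau < t by rewrite mul0r.
  rewrite /A (time_averageE T0 q0 qH H12 g00 g10 hg hU K0 tT tau0 tp').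
  rewrite mul0r mul1r (min_idPl (ltW tau_t)).
  have ii := convolution_kernel_integrable T0 q0 qH H12 g00 g10 hg hU K0 tT.
  have AV := @Rintegral_avg _ (fun v => U (t - v) * gamma v) 0 tau 0
    (K * g0 * (2 * t `^ (- q))) (ltW tau0).
  rewrite mul0r !subr0 in AV.
  have v0 : 0 <= tau^-1 by rewrite invr_ge0 ltW.
  rewrite normrM (ger0_norm v0) ler_pdivrMl// [leRHS]mulrC; apply: AV.
    apply: integrableS ii => // x; rewrite /= !in_itv/= => /andP[-> xt].
    exact: lt_trans tau_t.
  move=> v vp vt; rewrite subr0.
  apply: le_trans (convolution_kernel_le hg hU tT (ltW vp) (lt_trans vt tau_t)) _.
  rewrite ler_wpM2l ?mulr_ge0// (le_trans _ tq)// !powRN.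
  rewrite lef_pV2 ?posrE ?powR_gt0 ?divr_gt0 ?subr_gt0 ?(lt_trans vt)//.
  rewrite ge0_ler_powR ?nnegrE ?divr_ge0 ?subr_ge0 ?(ltW (lt_trans vt tau_t))//.
  by lra.
apply: le_trans (ler_pM (normr_ge0 _) (powR_ge0 _ _) A0 (lexx _)) _.
rewrite powH_split//.
have -> : K * g0 * (2 * t `^ (- q)) * (t `^ a * t `^ q) =
    K * (2 * g0) * t `^ a * (t `^ (- q) * t `^ q) by ring.
rewrite powRN mulVf ?mulr1 ?gt_eqF ?powR_gt0//.
apply: ler_pM; rewrite ?powR_ge0 ?powa_le// ?mulr_ge0//.
apply: ler_wpM2l => //; rewrite /M.
have : 0 <= g1 * T by rewrite mulr_ge0// ltW.
by have := g00; lra.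
Qed.

(* Neighbouring averages differ by a factor [tau] times the derivative of the
   kernel, of order [- (1 + q)] in the distance to [t]. *)
Let term_far i : (0 < i)%N -> (i.+2 <= N)%N ->
  `|nodal A m i| * `|i%:R * tau - t| `^ H <=
    K * M * (tau `^ a * (N - i.+1)%:R `^ (a - 1)).
Proof.
case: i => // i _ iN; have [Nt1 Nt2] := Nt.
set j : R := (N - i.+2)%:R.
have j1 : 1 <= j by rewrite ler1n subn_gt0.
have j0 : 0 < j by exact: lt_le_trans j1.
have jE : j = N%:R - i.+2%:R by rewrite /j natrB// ltnW.
have d0 : 0 < j * tau by exact: mulr_gt0.
have itd : i.+2%:R * tau <= t - j * tau by rewrite jE mulrBl; lra.
have step k : k.+1%:R * tau = k%:R * tau + tau by rewrite -natr1 mulrDl mul1r.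
have itd' : i.+1%:R * tau <= t - j * tau.
  by apply: le_trans itd; rewrite [leRHS]step lerDl ltW.
have L1 := time_average_near T0 q0 qH H12 g00 g10 hg hU K0 tT tau0 d0 itd
  (lexx _) (_ : i.+1%:R * tau <= i.+2%:R * tau).
have L2 := time_average_near T0 q0 qH H12 g00 g10 hg hU K0 tT tau0 d0 itd'
  (_ : i%:R * tau <= i.+1%:R * tau) (lexx _).
have {}L1 := L1 _; have {}L2 := L2 _.
rewrite [i.+2%:R * tau]step lerDl (ltW tau0) in L1.
rewrite [X in i%:R * tau <= X]step lerDl (ltW tau0) in L2.
have {}L1 := L1 isT; have {}L2 := L2 isT.
set D := K * (g0 + g1 * T) * (j * tau) `^ (- (1 + q)) * tau in L1 L2.
have n2 : `|nodal A m i.+1| <= 2 * D.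
  rewrite nodalE -(subrKA (U (t - i.+1%:R * tau) * gamma (i.+1%:R * tau))).
  rewrite -[X in _ + X]opprB; apply: le_trans (ler_normB _ _) _.
  by move: L1 L2; rewrite -/(A i) -/(A i.+1); lra.
have wle : `|i.+1%:R * tau - t| <= 3 * (j * tau).
  rewrite distrC ger0_norm; last by rewrite subr_ge0 (le_trans itd')// gerBl ltW.
  have jt : tau <= j * tau by rewrite ler_peMl// ltW.
  have : j * tau = N%:R * tau - i.+1%:R * tau - tau.
    by rewrite jE mulrBl (step i.+1); ring.
  by move: Nt2; rewrite (step N); lra.
have w : `|i.+1%:R * tau - t| `^ H <= 3 * (j * tau) `^ H.
  apply: le_trans (powH_le _ _); rewrite ?(ltW d0) ?ler1n//.
  by apply: ge0_ler_powR => //; rewrite nnegrE// mulr_ge0// ltW.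
apply: le_trans (ler_pM (normr_ge0 _) (powR_ge0 _ _) n2 w) _.
have -> : 2 * D * (3 * (j * tau) `^ H) = K * (6 * (g0 + g1 * T)) *
    (tau * ((j * tau) `^ (- (1 + q)) * (j * tau) `^ H)) by rewrite /D; ring.
rewrite -powRD ?(gt_eqF d0) ?implybT//.
have -> : - (1 + q) + H = a - 1 by rewrite /a; ring.
rewrite powRM ?(ltW j0) ?(ltW tau0)//.
have -> : tau * (j `^ (a - 1) * tau `^ (a - 1)) = tau `^ a * j `^ (a - 1).
  have -> : tau `^ a = tau * tau `^ (a - 1).
    by rewrite mulr_powRB1// ltW.
  by ring.
rewrite -/j; apply: ler_wpM2r; first by rewrite mulr_ge0 ?powR_ge0.
by apply: ler_wpM2l => //; rewrite /M; move: g00; lra.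
Qed.

(** The first node and the three nodes around [t] contribute a bounded amount
  each; the others form a Riemann sum of an integrable power of the distance to
  [t], of exponent [a - 1]. *)
Lemma nodal_sum_le :
  \sum_(i < m.+1) `|nodal A m i| * `|i%:R * tau - t| `^ H <=
    K * M * (T `^ a * (4 + a^-1)).
Proof.
have TA := powR_ge0 T a; have a1 : a <= 1.
  by rewrite lerBlDr (le_trans H12)// (le_trans (y := 1)) ?invf_le1 ?ler1n// lerDl.
pose one (p : nat -> bool) (i : nat) : R := if p i then T `^ a else 0.
pose far (i : nat) : R := if (i.+2 <= N)%N
  then tau `^ a * (N - i.+1)%:R `^ (a - 1) else 0.
have bound (i : nat) : `|nodal A m i| * `|i%:R * tau - t| `^ H <= K * M *
    (one (eq_op^~ 0%N) i + one (fun i => i.+1 == N) i + one (eq_op^~ N) i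
     + one (eq_op^~ N.+1) i + far i).
  have o0 p k : 0 <= one p k by rewrite /one; case: ifP.
  have f0 k : 0 <= far k by rewrite /far; case: ifP => // _; rewrite mulr_ge0 ?powR_ge0.
  have KM : 0 <= K * M by rewrite mulr_ge0.
  have [Ni|] := ltnP N.+1 i.
    by rewrite term_out// normr0 mul0r mulr_ge0// !addr_ge0.
  move=> iN; have [iN2|Ni] := leqP i.+2 N.
    case: i iN iN2 => [|i] iN iN2.
      apply: le_trans (term_first iN2) _; apply: ler_wpM2l => //.
      by rewrite {1}/one eqxx -!addrA lerDl !addr_ge0.
    apply: le_trans (term_far _ iN2) _ => //; apply: ler_wpM2l => //.
    by rewrite /far iN2 lerDr !addr_ge0.
  apply: le_trans (term_near Ni iN) _; apply: ler_wpM2l => //.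
  move: iN; rewrite leq_eqVlt => /predU1P[->|].
    by rewrite [one (eq_op^~ N.+1) _]/one eqxx addrAC lerDr !addr_ge0.
  rewrite ltnS leq_eqVlt => /predU1P[->|iN].
    rewrite [one (eq_op^~ N) _]/one eqxx.
    have := o0 (eq_op^~ 0%N) N; have := o0 (fun i => i.+1 == N) N.
    have := o0 (eq_op^~ N.+1) N; have := f0 N; lra.
  have /eqP iE : i.+1 == N by rewrite eqn_leq iN.
  rewrite [one (fun i => i.+1 == N) _]/one iE eqxx.
  have := o0 (eq_op^~ 0%N) i; have := o0 (eq_op^~ N) i.
  have := o0 (eq_op^~ N.+1) i; have := f0 i; lra.
apply: (@le_trans _ _ (\sum_(i < m.+1) K * M *
    (one (eq_op^~ 0%N) i + one (fun i => i.+1 == N) i + one (eq_op^~ N) i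
     + one (eq_op^~ N.+1) i + far i))).
  by apply: ler_sum => i _; exact: bound.
rewrite -mulr_sumr; apply: ler_wpM2l; first by rewrite mulr_ge0.
rewrite !big_split/=.
have s1 : \sum_(i < m.+1) one (eq_op^~ 0%N) i <= T `^ a.
  by apply: (@sum_indic_le m.+1 (eq_op^~ 0%N)) => // i j /eqP-> /eqP->.
have s2 : \sum_(i < m.+1) one (fun i => i.+1 == N) i <= T `^ a.
  by apply: (@sum_indic_le m.+1 (fun i => i.+1 == N)) => // i j /eqP <- /eqP[->].
have s3 : \sum_(i < m.+1) one (eq_op^~ N) i <= T `^ a.
  by apply: (@sum_indic_le m.+1 (eq_op^~ N)) => // i j /eqP-> /eqP->.
have s4 : \sum_(i < m.+1) one (eq_op^~ N.+1) i <= T `^ a.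
  by apply: (@sum_indic_le m.+1 (eq_op^~ N.+1)) => // i j /eqP-> /eqP->.
have s5 : \sum_(i < m.+1) far i <= T `^ a * a^-1.
  have S := @sum_rev_le (fun k => tau `^ a * k%:R `^ (a - 1)) m.+1 N.
  apply: le_trans (S _) _; first by move=> k; rewrite mulr_ge0 ?powR_ge0.
  rewrite -mulr_sumr; apply: le_trans (_ : tau `^ a * (N%:R `^ a / a) <= _).
    rewrite ler_wpM2l ?powR_ge0//.
    apply: le_trans (sum_powR_le N _); last by rewrite a0.
    case: (N) => [|k]; first by rewrite !big_geq.
    by rewrite [leRHS]big_nat_recr//= lerDl powR_ge0.
  rewrite mulrA ler_wpM2r ?invr_ge0 ?(ltW a0)// -powRM ?(ltW tau0)//.
  apply: powa_le; first by rewrite mulr_ge0// ltW.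
  by rewrite mulrC; case: Nt => /le_trans + _; apply.
lra.
Qed.

End Nodes.

(** Uniformity in the time step: summation by parts turns the average of the
  kernel into its total variation, weighted by the distance to the singularity
  to the power [H]; this converges since the singularity is of order [q < H]. *)
Lemma time_variance_bound (T H q g0 g1 : R) :
  0 < T -> 0 <= q -> q < H -> H <= 2^-1 -> 0 <= g0 -> 0 <= g1 ->
  exists2 C, 0 <= C & forall gamma U K t m,
    lipschitz_weight T g0 g1 gamma -> time_kernel_bound T q K U -> 0 <= K ->
    0 <= t -> t <= T -> (0 < m)%N ->
    let tau := T / m%:R in let A := time_average gamma U t tau in
    \sum_(i < m) \sum_(j < m) A i * A j *
      (fbm_cov H (i.+1%:R * tau) (j.+1%:R * tau)
       - fbm_cov H (i%:R * tau) (j.+1%:R * tau)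
       - fbm_cov H (i.+1%:R * tau) (j%:R * tau)
       + fbm_cov H (i%:R * tau) (j%:R * tau)) <= (C * K) ^+ 2.
Proof.
move=> T0 q0 qH H12 g00 g10.
have a0 : 0 < H - q by rewrite subr_gt0.
exists ((14 * g0 + 6 * (g1 * T)) * (T `^ (H - q) * (4 + (H - q)^-1))).
  by rewrite !mulr_ge0 ?addr_ge0 ?mulr_ge0 ?powR_ge0 ?invr_ge0// ltW.
move=> gamma U K t m hg hU K0 t0 tT m0; cbv zeta.
set tau := T / m%:R; set A := time_average gamma U t tau.
rewrite -(sum_nodal2 A (fun i j => fbm_cov H (i%:R * tau) (j%:R * tau))).
have H0 : 0 <= H <= 2^-1 by rewrite H12 andbT (le_trans q0)// ltW.
have V := fbm_variance_le t (a := fun i : 'I_m.+1 => nodal A m i)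
  (fun i : 'I_m.+1 => i%:R * tau) H0 (sum_nodal0 A m).
apply: le_trans V _; rewrite lerXn2r ?nnegrE//.
- by rewrite sumr_ge0// => i _; rewrite mulr_ge0 ?powR_ge0.
- rewrite mulr_ge0//.
  by rewrite !mulr_ge0 ?addr_ge0 ?mulr_ge0 ?powR_ge0 ?invr_ge0// ltW.
apply: le_trans (nodal_sum_le T0 q0 qH H12 g00 g10 hg hU K0 t0 tT m0) _.
by rewrite le_eqVlt; apply/orP; left; apply/eqP; ring.
Qed.

End TimeVarianceSum.

(** * Variance in space: discrete estimate *)

Section SpaceVariance.
Context {R : realType}.

Lemma ler_sum_ord_ge0 (g : nat -> R) (m n : nat) : (forall k, 0 <= g k) ->
  (m <= n)%N -> \sum_(k < m) g k <= \sum_(k < n) g k.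
Proof.
move=> g0 mn; rewrite -!(big_mkord xpredT g) [leRHS](big_cat_nat (n := m))//=.
by rewrite lerDl sumr_ge0.
Qed.

Lemma sum_dist_le (g : nat -> R) (m j : nat) : (forall k, 0 <= g k) -> (j < m)%N ->
  \sum_(k < m) g ((j - k) + (k - j))%N <= 2 * \sum_(k < m) g k.
Proof.
move=> g0 jm.
have L i : \sum_(k < m) (if (k <= i)%N then g (i - k)%N else 0) <= \sum_(k < i.+1) g k.
  elim: i m {jm} => [|i IH] [|n]; try by rewrite big_ord0 sumr_ge0.
    rewrite big_ord_recl big_ord_recl big_ord0 big1 ?addr0// => k _; exact: g0.
  rewrite big_ord_recl [leRHS]big_ord_recr/= subn0 addrC lerD//.
  by apply: le_trans (IH n); apply: ler_sum => k _; rewrite ltnS subSS.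
have U i n : \sum_(k < n) (if (i <= k)%N then g (k - i)%N else 0) <= \sum_(k < n) g k.
  elim: i n => [|i IH] [|n]; try by rewrite big_ord0 sumr_ge0.
    by apply: ler_sum => k _; rewrite subn0.
  rewrite big_ord_recl/= add0r; apply: le_trans (ler_sum_ord_ge0 g0 (leqnSn n)).
  by apply: le_trans (IH n); apply: ler_sum => k _; rewrite ltnS subSS.
have -> : 2 * \sum_(k < m) g k = \sum_(k < m) g k + \sum_(k < m) g k by ring.
apply: le_trans (lerD (le_trans (L j) (ler_sum_ord_ge0 g0 jm)) (U j m)).
rewrite -big_split/=; apply: ler_sum => k _.
have [kj|jk] := leqP k j.
  rewrite (_ : (k - j)%N = 0%N) ?addn0 ?lerDl; last by apply/eqP; rewrite subn_eq0.
  by case: ifP.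
rewrite (ltnW jk) add0r (_ : (j - k)%N = 0%N) ?add0n//.
by apply/eqP; rewrite subn_eq0 ltnW.
Qed.

Variables (p sg : R).
Hypothesis (p0 : 0 < p) (sg0 : 0 <= sg) (psg : p + sg < 1).

Definition incr (n : nat) : R := n.+1%:R `^ p - n%:R `^ p.

(** Minus twice the covariance of two unit increments at distance [n] of a
  fractional Brownian motion of index [p / 2].  The diagonal is treated apart, which
  makes 0 a convenient value at [n = 0]. *)
Definition weight (n : nat) : R := if n is k.+1 then incr k - incr k.+1 else 0.

Let p1 : 0 <= p <= 1.
Proof. by rewrite ltW//= (le_trans _ (ltW psg))// lerDl. Qed.

Let sg1 : 0 <= sg <= 1.
Proof. by rewrite sg0 (le_trans _ (ltW psg))// lerDr ltW. Qed.

(** Concavity of the power [p], seen through the tangent inequality on both sides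
  of the middle point. *)
Lemma weight_ge0 n : 0 <= weight n.
Proof.
case: n => [//|n]; rewrite /weight /incr.
have x0 : 0 < n.+1%:R :> R by rewrite ltr0n.
have V0 : 0 <= n.+1%:R^-1 :> R by rewrite invr_ge0.
have V1 : n.+1%:R^-1 <= 1 :> R by rewrite invf_le1// ler1n.
have T1 := @powR_le_tangent R (1 + n.+1%:R^-1) p (addr_ge0 ler01 V0) p1.
have := @powR_le_tangent R (1 - n.+1%:R^-1) p; rewrite subr_ge0 => /(_ V1 p1) T2.
have E1 : n.+2%:R = n.+1%:R * (1 + n.+1%:R^-1) :> R.
  by rewrite mulrDr mulr1 mulfV ?gt_eqF// natr1.
have E2 : n%:R = n.+1%:R * (1 - n.+1%:R^-1) :> R.
  by rewrite mulrBr mulr1 mulfV ?gt_eqF// -[n.+1%:R]natr1 addrK.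
have P0 := powR_ge0 (n.+1%:R : R) p.
have := ler_wpM2l P0 T1; have := ler_wpM2l P0 T2.
have F1 : n.+1%:R `^ p * (1 + n.+1%:R^-1) `^ p = n.+2%:R `^ p :> R.
  by rewrite E1 powRM// addr_ge0.
have F2 : n.+1%:R `^ p * (1 - n.+1%:R^-1) `^ p = n%:R `^ p :> R.
  by rewrite [in RHS]E2 powRM// subr_ge0.
rewrite F1 F2; clear.
move: (n.+2%:R `^ p) (n.+1%:R `^ p) (n%:R `^ p) (n.+1%:R^-1) => a b c v; lra.
Qed.

Lemma incr_le n : (0 < n)%N -> incr n <= n%:R `^ (p - 1).
Proof. by move=> n0; rewrite /incr -natr1; apply: powR_succ_sub; rewrite ?ltr0n. Qed.

Lemma incr_ge0 n : 0 <= incr n.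
Proof.
by rewrite subr_ge0; apply: ge0_ler_powR; rewrite ?nnegrE ?ler0n ?ler_nat ?(ltW p0).
Qed.

Let delta := 1 - (p + sg).

(** Abel summation moves the difference from the weight to the power [sg], which
  leaves terms of order [p + sg - 2 < - 1]. *)
Lemma sum_weight_le m :
  \sum_(n < m) weight n * n%:R `^ sg <= 2 + delta^-1.
Proof.
have d0 : 0 < delta by rewrite subr_gt0.
have d1 : delta <= 1 by rewrite gerBl addr_ge0// ltW.
have W k : \sum_(n < k.+2) weight n * n%:R `^ sg <=
    1 + \sum_(1 <= n < k.+1) n%:R `^ (- 1 - delta)
     - incr k.+1 * k.+1%:R `^ sg.
  elim: k => [|k IH].
    rewrite 2!big_ord_recl big_ord0 big_geq// addr0 mul0r add0r addr0.
    by rewrite /bump/= /incr !powR1 powR0 ?gt_eqF//; lra.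
  rewrite big_ord_recr/= [\sum_(1 <= n < k.+2) _]big_nat_recr//=.
  have : incr k.+1 * (k.+2%:R `^ sg - k.+1%:R `^ sg) <= k.+1%:R `^ (- 1 - delta).
    have -> : - 1 - delta = (p - 1) + (sg - 1) by rewrite /delta; ring.
    rewrite powRD ?pnatr_eq0 ?implybT//.
    apply: ler_pM; rewrite ?incr_ge0 ?incr_le//.
      by rewrite subr_ge0; apply: ge0_ler_powR; rewrite ?nnegrE ?ler0n ?ler_nat ?sg0.
    by rewrite -[k.+2%:R]natr1; apply: powR_succ_sub; rewrite ?ltr0n.
  move: IH; rewrite /weight; lra.
have D0 : 0 <= delta^-1 by rewrite invr_ge0 ltW.
case: m => [|[|m]].
- by rewrite big_ord0 addr_ge0.
- by rewrite big_ord_recl big_ord0 mul0r addr0 addr_ge0.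
apply: le_trans (W m) _.
have := mulr_ge0 (incr_ge0 m.+1) (powR_ge0 (m.+1%:R : R) sg).
have := @sum_powR_neg_le R delta m.+1; rewrite d0 d1 => /(_ isT).
lra.
Qed.

Variable l : R.
Hypothesis l0 : 0 < l.

Let R1 (x y : R) := fbm_cov (p / 2) x y.

Let R1E (x y : R) : R1 x y = 2^-1 * (`|x| `^ p + `|y| `^ p - `|x - y| `^ p).
Proof. by rewrite /R1 /fbm_cov (_ : 2 * (p / 2) = p)//; field. Qed.

(** For an index at most 1/2 distinct increments are negatively correlated;
  writing a product as half of the sum of the squares minus the square of the
  difference, the diagonal part telescopes and the rest is a discrete fractional
  seminorm of the coefficients. *)
Lemma space_variance_le (B : nat -> R) (m : nat) (M0 M1 : R) :
  (0 < m)%N -> 0 <= M0 -> 0 <= M1 ->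
  let h := l / m%:R in
  (forall j, (j < m)%N -> `|B j| <= M0) ->
  (forall j k, (j < m)%N -> (k < m)%N -> j != k ->
    (B j - B k) ^+ 2 <= M1 * (h * ((j - k) + (k - j))%:R) `^ sg) ->
  \sum_(j < m) \sum_(k < m) B j * B k *
    (R1 (j.+1%:R * h) (k.+1%:R * h) - R1 (j%:R * h) (k.+1%:R * h)
     - R1 (j.+1%:R * h) (k%:R * h) + R1 (j%:R * h) (k%:R * h)) <=
  M0 ^+ 2 * l `^ p + M1 * (l * (2 + delta^-1)) * h `^ (p + sg - 1).
Proof.
move=> m0 M00 M10 h BM0 BM1.
have h0 : 0 < h by rewrite divr_gt0// ltr0n.
have mh : m%:R * h = l by rewrite mulrC divfK// pnatr_eq0 -lt0n.
pose Q (j k : nat) := R1 (j.+1%:R * h) (k.+1%:R * h) - R1 (j%:R * h) (k.+1%:R * h)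
     - R1 (j.+1%:R * h) (k%:R * h) + R1 (j%:R * h) (k%:R * h).
have QE j k : Q j k = 2^-1 * h `^ p *
    (`|j%:R - k%:R - 1| `^ p + `|j%:R - k%:R + 1| `^ p - 2 * `|j%:R - k%:R| `^ p).
  have E (a b : R) : `|a * h - b * h| `^ p = `|a - b| `^ p * h `^ p.
    by rewrite -mulrBl normrM (gtr0_norm h0) powRM// ltW.
  rewrite /Q !R1E !E -!natr1.
  have -> : j%:R + 1 - (k%:R + 1) = j%:R - k%:R :> R by ring.
  have -> : j%:R - (k%:R + 1) = j%:R - k%:R - 1 :> R by ring.
  have -> : j%:R + 1 - k%:R = j%:R - k%:R + 1 :> R by ring.
  by ring.
have QC j k : Q j k = Q k j.
  rewrite !QE; congr (_ * _).
  have -> : k%:R - j%:R - 1 = - (j%:R - k%:R + 1) :> R by ring.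
  have -> : k%:R - j%:R + 1 = - (j%:R - k%:R - 1) :> R by ring.
  have -> : k%:R - j%:R = - (j%:R - k%:R) :> R by ring.
  by rewrite !normrN [X in X - _]addrC.
have QW j k : j != k -> - Q j k = 2^-1 * h `^ p * weight ((j - k) + (k - j)).
  wlog kj : j k / (k < j)%N.
    move=> W jk; have [|jk'|jk'] := ltngtP k j.
    - by move=> kj; exact: W.
    - by rewrite QC addnC; apply: W => //; rewrite eq_sym.
    - by rewrite jk' eqxx in jk.
  move=> _; have -> : (k - j)%N = 0%N by apply/eqP; rewrite subn_eq0 ltnW.
  rewrite addn0 QE -natrB ?(ltnW kj)//.
  case E : (j - k)%N => [|n]; first by move: kj; rewrite -subn_gt0 E.
  rewrite -[n.+1%:R]natr1 addrK natr1 [n.+1%:R + 1]natr1 !ger0_norm ?ler0n//.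
  by rewrite /weight /incr; ring.
have BB (a b c : R) : a * b * c = 2^-1 * (a ^+ 2 * c) + 2^-1 * (b ^+ 2 * c)
    + 2^-1 * (- c * (a - b) ^+ 2) by field.
(* The row sums telescope and are nonnegative. *)
pose rs (j : nat) := \sum_(k < m) Q j k.
have -> : \sum_(j < m) \sum_(k < m) B j * B k * Q j k =
    \sum_(j < m) B j ^+ 2 * rs j
    + 2^-1 * \sum_(j < m) \sum_(k < m) (- Q j k * (B j - B k) ^+ 2).
  under eq_bigr do under eq_bigr do rewrite BB.
  under eq_bigr do rewrite !big_split/=.
  rewrite !big_split/=; congr (_ + _); last first.
    by rewrite mulr_sumr; apply: eq_bigr => j _; rewrite mulr_sumr.
  have -> : \sum_(j < m) \sum_(k < m) 2^-1 * (B k ^+ 2 * Q j k) =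
      \sum_(j < m) \sum_(k < m) 2^-1 * (B j ^+ 2 * Q j k).
    rewrite exchange_big/=; apply: eq_bigr => j _; apply: eq_bigr => k _.
    by rewrite QC.
  rewrite -big_split/=; apply: eq_bigr => j _.
  by rewrite -big_split/= /rs mulr_sumr; apply: eq_bigr => k _; field.
apply: lerD.
  have R10 x : R1 x 0 = 0.
    by rewrite R1E normr0 powR0 ?gt_eqF// subr0 addr0 subrr mulr0.
  have rsE j : rs j = R1 (j.+1%:R * h) l - R1 (j%:R * h) l.
    have Tl := telescope_sumr (fun k => R1 (j.+1%:R * h) (k%:R * h)
       - R1 (j%:R * h) (k%:R * h)) (leq0n m).
    rewrite mh mul0r !R10 subrr subr0 big_mkord in Tl.
    by rewrite -Tl /rs; apply: eq_bigr => k _; rewrite /Q; ring.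
  have rs0 j : (j < m)%N -> 0 <= rs j.
    move=> jm; rewrite rsE !R1E.
    have jh : j%:R * h <= j.+1%:R * h by rewrite ler_wpM2r ?(ltW h0)// ler_nat.
    have jl : j.+1%:R * h <= l by rewrite -mh ler_wpM2r ?(ltW h0)// ler_nat.
    have j0 : 0 <= j%:R * h by rewrite mulr_ge0// ltW.
    have j1 : 0 <= j.+1%:R * h by rewrite mulr_ge0// ltW.
    rewrite !(ger0_norm j0) (ger0_norm j1) ![`|_ - l|]distrC.
    rewrite !(@ger0_norm _ (l - _)) ?subr_ge0//; last exact: le_trans jl.
    have A1 : (j%:R * h) `^ p <= (j.+1%:R * h) `^ p.
      by apply: ge0_ler_powR; rewrite ?nnegrE ?(ltW p0).
    have A2 : (l - j.+1%:R * h) `^ p <= (l - j%:R * h) `^ p.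
      apply: ge0_ler_powR; rewrite ?nnegrE ?(ltW p0) ?subr_ge0 ?lerD2l ?lerN2//.
      exact: le_trans jl.
    lra.
  apply: le_trans (_ : \sum_(j < m) M0 ^+ 2 * rs j <= _).
    apply: ler_sum => j _; apply: ler_wpM2r; first exact: rs0.
    rewrite -real_normK ?num_real//; apply: lerXn2r; rewrite ?nnegrE//.
    exact: BM0.
  rewrite -mulr_sumr; apply: ler_wpM2l; first exact: sqr_ge0.
  under eq_bigr do rewrite rsE.
  rewrite -(big_mkord xpredT (fun j => R1 (j.+1%:R * h) l - R1 (j%:R * h) l)).
  rewrite (telescope_sumr (fun j => R1 (j%:R * h) l))// mh mul0r.
  rewrite !R1E subrr normr0 powR0 ?gt_eqF// sub0r normrN (gtr0_norm l0).
  by rewrite add0r subrr mulr0 !subr0; lra.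
have hp (x y : R) : h `^ (x + y) = h `^ x * h `^ y.
  by rewrite powRD// (gt_eqF h0) implybT.
have S := sum_weight_le m.
pose c := 2^-1 * h `^ p * (M1 * h `^ sg).
have c0 : 0 <= c by rewrite !mulr_ge0 ?powR_ge0.
have T1 (j k : 'I_m) : - Q j k * (B j - B k) ^+ 2 <=
    c * (weight ((j - k) + (k - j)) * ((j - k) + (k - j))%:R `^ sg).
  have [->|jk] := eqVneq j k.
    by rewrite subrr expr0n/= mulr0 subnn/= mul0r mulr0.
  rewrite QW//.
  have -> : c * (weight (j - k + (k - j)) * (j - k + (k - j))%:R `^ sg) =
    2^-1 * h `^ p * weight (j - k + (k - j)) *
     (M1 * (h `^ sg * (j - k + (k - j))%:R `^ sg)) by rewrite /c; ring.
  rewrite -powRM ?(ltW h0)//; apply: ler_wpM2l; last exact: BM1.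
  by rewrite !mulr_ge0 ?powR_ge0 ?weight_ge0.
have T2 (j : 'I_m) : \sum_(k < m) (- Q j k * (B j - B k) ^+ 2) <=
    c * (2 * (2 + delta^-1)).
  apply: le_trans (ler_sum _ (fun k _ => T1 j k)) _.
  rewrite -mulr_sumr; apply: ler_wpM2l => //.
  have G := @sum_dist_le (fun n => weight n * n%:R `^ sg) m j.
  apply: le_trans (G _ (ltn_ord j)) _.
    by move=> n; rewrite mulr_ge0 ?weight_ge0 ?powR_ge0.
  by rewrite ler_wpM2l.
apply: le_trans (_ : 2^-1 * \sum_(j < m) c * (2 * (2 + delta^-1)) <= _).
  by apply: ler_wpM2l => //; apply: ler_sum.
rewrite sumr_const card_ord -[_ *+ m]mulr_natl hp hp powRN powRr1 ?(ltW h0)//.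
pose X := M1 * m%:R * (2 + delta^-1) * (h `^ p * h `^ sg).
have d0 : 0 < delta by rewrite subr_gt0.
have X0 : 0 <= X.
  by rewrite /X !mulr_ge0 ?powR_ge0// addr_ge0// invr_ge0 ltW.
have -> : 2^-1 * (m%:R * (c * (2 * (2 + delta^-1)))) = 2^-1 * X.
  by rewrite /c /X; field; rewrite gt_eqF.
have -> : M1 * (l * (2 + delta^-1)) * (h `^ p * h `^ sg * h^-1) = X.
  by rewrite -{1}mh /X; field; rewrite !gt_eqF.
by rewrite ler_piMl// invf_le1// ler1n.
Qed.

End SpaceVariance.

(** * Variance in space: averages of an eigenfunction *)

Section SpaceAverages.
Context {R : realType}.
Notation leb := (@lebesgue_measure R).
Variables (l : R) (v : L2D l) (C w : R).
Hypothesis (l0 : 0 < l) (C0 : 0 <= C) (w0 : 0 < w).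
Hypothesis v_le : forall x : R, x \in `]0, l[ -> `|v x| <= C.
Hypothesis v_lip : forall x y : R, x \in `]0, l[ -> y \in `]0, l[ ->
  `|v x - v y| <= C * w * `|x - y|.
Hypothesis v_int : forall a b : R, 0 <= a -> a < b -> b <= l ->
  `|\int[leb]_(x in `]a, b[) v x| <= C / w.

Definition space_average (h : R) (j : nat) : R :=
  h^-1 * \int[leb]_(y in `]0, l[) (v y * \1_`]j%:R * h, j.+1%:R * h]%classic y).

Lemma L2D_integrable_itv : leb.-integrable `]0, l[ (EFin \o v).
Proof.
have /integrableP[m1 m2] := L2D_integrable v.
apply/integrableP; split; first exact: measurable_funTS.
by apply: le_lt_trans m2; rewrite [leRHS]integral_muD//; exact: measurableT_comp.
Qed.

Variable m : nat.
Hypothesis m0 : (0 < m)%N.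
Let h := l / m%:R.
Let h0 : 0 < h. Proof. by rewrite divr_gt0// ltr0n. Qed.
Let mh : m%:R * h = l.
Proof. by rewrite mulrC divfK// pnatr_eq0 -lt0n. Qed.

Let step j : j.+1%:R * h = j%:R * h + h.
Proof. by rewrite -natr1 mulrDl mul1r. Qed.

Let jh0 j : 0 <= j%:R * h. Proof. by rewrite mulr_ge0// ltW. Qed.

Let jhl j : (j < m)%N -> j.+1%:R * h <= l.
Proof. by move=> jm; rewrite -mh ler_wpM2r ?(ltW h0)// ler_nat. Qed.

Let jhlt j : j%:R * h < j.+1%:R * h. Proof. by rewrite step ltrDl. Qed.

Let in_cell j x : (j < m)%N -> j%:R * h < x -> x < j.+1%:R * h -> x \in `]0, l[.
Proof.
move=> jm jx xj; rewrite in_itv/= (le_lt_trans (jh0 j))//=.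
exact: lt_le_trans (jhl jm).
Qed.

Lemma space_averageE j : (j < m)%N -> space_average h j =
  h^-1 * \int[leb]_(y in `]j%:R * h, j.+1%:R * h[) v y.
Proof.
move=> jm; rewrite /space_average Rintegral_indic_itv//; last first.
- exact: L2D_integrable_itv.
- exact: lt_le_trans (jhlt j) (jhl jm).
by rewrite (min_idPl (jhl jm)).
Qed.

Lemma space_average_near j c M : (j < m)%N ->
  (forall x, j%:R * h < x -> x < j.+1%:R * h -> `|v x - c| <= M) ->
  `|space_average h j - c| <= M.
Proof.
move=> jm vM; rewrite space_averageE// -(ler_pM2r h0).
have AV := @Rintegral_avg _ v (j%:R * h) (j.+1%:R * h) c M (ltW (jhlt j)).
have E : j.+1%:R * h - j%:R * h = h by rewrite step addrAC subrr add0r.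
rewrite E in AV; rewrite -[X in _ * X <= _](gtr0_norm h0) -normrM mulrBl.
rewrite mulrAC mulVf ?gt_eqF// mul1r; apply: AV => //.
apply: integrableS L2D_integrable_itv => // x; rewrite /= !in_itv/=.
by move=> /andP[jx xj]; have := in_cell jm jx xj; rewrite in_itv.
Qed.

Lemma space_average_le j : (j < m)%N -> `|space_average h j| <= C.
Proof.
move=> jm; rewrite -[space_average h j]subr0; apply: space_average_near => // x jx xj.
by rewrite subr0; apply: v_le; exact: in_cell xj.
Qed.

Lemma space_average_decay j : (j < m)%N -> `|space_average h j| <= h^-1 * (C / w).
Proof.
move=> jm; have V0 : 0 <= h^-1 by rewrite invr_ge0 ltW.
rewrite space_averageE// normrM (ger0_norm V0) ler_wpM2l//.
exact: v_int (jh0 j) (jhlt j) (jhl jm).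
Qed.

Lemma sqr_min1_le (x sg : R) : 0 <= x -> 0 <= sg <= 1 ->
  Num.min 1 x ^+ 2 <= x `^ sg.
Proof.
move=> x0 /andP[s0 s1]; have [x1|x1] := leP 1 x.
  by rewrite expr1n -(powRr0 x) ler_powR.
have [->|xn0] := eqVneq x 0; first by rewrite expr0n powR_ge0.
have xp : 0 < x by rewrite lt_def xn0.
apply: le_trans (_ : x <= _).
  by rewrite expr2 ler_piMl// ltW.
by apply: ger1_powR => //; rewrite xp ltW.
Qed.

(** The difference is bounded both by the sup norm and by the distance times the
  frequency; the power [sg] interpolates between the two. *)
Lemma space_average_dist j k sg : (j < m)%N -> (k < m)%N -> j != k ->
  0 <= sg <= 1 ->
  (space_average h j - space_average h k) ^+ 2 <=
    9 * C ^+ 2 * w `^ sg * (h * ((j - k) + (k - j))%:R) `^ sg.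
Proof.
move=> jm km jk hsg.
set n : nat := ((j - k) + (k - j))%N.
have n1 : 1 <= n%:R :> R.
  by rewrite ler1n lt0n /n addn_eq0 !subn_eq0 -eqn_leq.
have nE : `|j%:R - k%:R| = n%:R :> R.
  rewrite /n; have [kj|/ltnW kj] := leqP k j.
    by rewrite (_ : (k - j)%N = 0%N) ?addn0 ?natrB ?ger0_norm ?subr_ge0 ?ler_nat//;
      apply/eqP; rewrite subn_eq0.
  rewrite (_ : (j - k)%N = 0%N) ?add0n ?natrB ?ler0_norm ?opprB ?subr_le0 ?ler_nat//.
  by apply/eqP; rewrite subn_eq0.
(* Averages are compared through the values at the midpoints. *)
pose c (i : nat) := i%:R * h + h / 2.
have cin i : i%:R * h < c i /\ c i < i.+1%:R * h.
  by rewrite step /c; split; move: (h0); lra.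
have near i : (i < m)%N -> `|space_average h i - v (c i)| <= C * w * h.
  move=> im; apply: space_average_near => // x ix xi.
  apply: le_trans (v_lip _ _) _.
  - exact: in_cell xi.
  - by have [] := cin i; exact: in_cell.
  - apply: ler_wpM2l; first by rewrite mulr_ge0// ltW.
    rewrite ler_norml; move: xi; rewrite step /c => xi.
    by apply/andP; split; move: (h0); lra.
have wh0 : 0 <= w * h by rewrite mulr_ge0// ltW.
have X0 : 0 <= w * (h * n%:R) by rewrite mulrA mulr_ge0// ler0n.
have L1 : `|space_average h j - space_average h k| <= 3 * C * (w * (h * n%:R)).
  have := near j jm; have := near k km; rewrite distrC => Nk Nj.
  have Vjk : `|v (c j) - v (c k)| <= C * w * (h * n%:R).
    apply: le_trans (v_lip _ _) _.
    - by have [] := cin j; exact: in_cell.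
    - by have [] := cin k; exact: in_cell.
    - apply: ler_wpM2l; first by rewrite mulr_ge0// ltW.
      have -> : c j - c k = h * (j%:R - k%:R) by rewrite /c; ring.
      by rewrite normrM nE (gtr0_norm h0).
  have Ch : C * w * h <= C * (w * (h * n%:R)).
    rewrite -mulrA; apply: ler_wpM2l => //; rewrite mulrA.
    by rewrite ler_peMr.
  have := ler_distD (v (c j)) (space_average h j) (space_average h k).
  have := ler_distD (v (c k)) (v (c j)) (space_average h k).
  by rewrite -mulrA in Vjk; lra.
have L2 : `|space_average h j - space_average h k| <= 3 * C.
  apply: le_trans (ler_normB _ _) _.
  by have := space_average_le jm; have := space_average_le km; move: (C0); lra.
have L : `|space_average h j - space_average h k| <=
    3 * C * Num.min 1 (w * (h * n%:R)).
  have [x1|x1] := leP 1 (w * (h * n%:R)); first by rewrite mulr1.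
  exact: L1.
have C3 : 0 <= 3 * C by rewrite mulr_ge0.
rewrite -real_normK ?num_real//.
apply: le_trans (_ : (3 * C * Num.min 1 (w * (h * n%:R))) ^+ 2 <= _).
  apply: lerXn2r; rewrite ?nnegrE// mulr_ge0// le_min ler01 X0//.
rewrite exprMn -[_ * w `^ sg * _]mulrA -powRM ?(ltW w0)//; last first.
  by rewrite mulr_ge0// ltW.
apply: ler_pM; rewrite ?sqr_ge0//.
  by rewrite le_eqVlt; apply/orP; left; apply/eqP; ring.
exact: sqr_min1_le.
Qed.

End SpaceAverages.

Section SpaceVarianceModes.
Context {R : realType}.

(** The bounded part of [space_variance_le] is absorbed into the other one, since
  the frequencies are bounded below and the mesh size is bounded above. *)
Lemma space_variance_mode (l H sg c Ce : R) :
  0 < l -> 0 < H -> 0 <= sg -> 2 * H + sg < 1 -> 0 < c -> 0 <= Ce ->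
  exists2 D : R, 0 <= D & forall (v : L2D l) (w : R) (m : nat),
    c <= w -> (0 < m)%N ->
    (forall x : R, x \in `]0, l[ -> `|v x| <= Ce) ->
    (forall x y : R, x \in `]0, l[ -> y \in `]0, l[ ->
       `|v x - v y| <= Ce * w * `|x - y|) ->
    let h := l / m%:R in let B := space_average v h in
    \sum_(j < m) \sum_(k < m) B j * B k *
      (fbm_cov H (j.+1%:R * h) (k.+1%:R * h) - fbm_cov H (j%:R * h) (k.+1%:R * h)
       - fbm_cov H (j.+1%:R * h) (k%:R * h) + fbm_cov H (j%:R * h) (k%:R * h)) <=
    D * w `^ sg * h `^ (2 * H + sg - 1).
Proof.
move=> l0 H0 sg0 Hs c0 Ce0.
have p0 : 0 < 2 * H by rewrite mulr_gt0.
pose p := 2 * H; pose S := l * (2 + (1 - (p + sg))^-1).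
pose D1 := Ce ^+ 2 * l `^ p * (c `^ (- sg) * l `^ (- (p + sg - 1))).
have S0 : 0 <= S.
  have ? := ltW l0; have ? := ltW Hs.
  by rewrite /S mulr_ge0// addr_ge0// invr_ge0 subr_ge0.
exists (D1 + 9 * Ce ^+ 2 * S).
  by apply: addr_ge0; do ![exact: powR_ge0 | exact: sqr_ge0 | by [] | apply: mulr_ge0].
move=> v w m cw m0 v1 v2; cbv zeta.
set h := l / m%:R; set B := space_average v h.
have w0 : 0 < w by exact: lt_le_trans cw.
have h0 : 0 < h by rewrite divr_gt0// ltr0n.
have hl : h <= l by rewrite ler_pdivrMr ?ltr0n// ler_peMr ?ler1n// ltW.
have sg1 : 0 <= sg <= 1.
  by rewrite sg0/= (le_trans _ (ltW Hs))// lerDr ltW.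
have := @space_variance_le R (2 * H) sg p0 sg0 Hs l l0 B m Ce (9 * Ce ^+ 2 * w `^ sg).
rewrite (_ : 2 * H / 2 = H); last by field.
move=> /(_ m0 Ce0); rewrite !mulr_ge0 ?sqr_ge0 ?powR_ge0// => /(_ isT) V.
apply: le_trans (V _ _) _.
- move=> j jm; exact: space_average_le.
- move=> j k jm km jk; exact: space_average_dist.
have one1 : 1 <= c `^ (- sg) * w `^ sg.
  rewrite powRN mulrC ler_pdivlMr ?powR_gt0// mul1r.
  by apply: ge0_ler_powR; rewrite ?nnegrE// ltW.
have one2 : 1 <= l `^ (- (p + sg - 1)) * h `^ (p + sg - 1).
  have e0 : 0 <= 1 - (p + sg) by rewrite subr_ge0 ltW.
  have -> : - (p + sg - 1) = 1 - (p + sg) by ring.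
  have -> : p + sg - 1 = - (1 - (p + sg)) by ring.
  rewrite powRN ler_pdivlMr ?powR_gt0// mul1r.
  by apply: ge0_ler_powR; rewrite ?nnegrE// ltW.
have P0 : 0 <= Ce ^+ 2 * l `^ p by rewrite mulr_ge0 ?sqr_ge0 ?powR_ge0.
have K1 : Ce ^+ 2 * l `^ p <= D1 * w `^ sg * h `^ (p + sg - 1).
  have -> : D1 * w `^ sg * h `^ (p + sg - 1) = Ce ^+ 2 * l `^ p *
    ((c `^ (- sg) * w `^ sg) * (l `^ (- (p + sg - 1)) * h `^ (p + sg - 1))).
    by rewrite /D1; ring.
  rewrite ler_peMr// -[X in X <= _]mulr1; apply: ler_pM => //.
have -> : (D1 + 9 * Ce ^+ 2 * S) * w `^ sg * h `^ (2 * H + sg - 1) =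
    D1 * w `^ sg * h `^ (p + sg - 1)
    + 9 * Ce ^+ 2 * S * w `^ sg * h `^ (p + sg - 1) by rewrite /p; ring.
apply: lerD; first exact: K1.
by rewrite le_eqVlt /S /p; apply/orP; left; apply/eqP; ring.
Qed.

End SpaceVarianceModes.

(** * Exchange of limits and integrals *)

Section L2Convergence.
Context {dd : measure_display} {T : measurableType dd} {R : realType}.
Variable mu : {measure set T -> \bar R}.
Implicit Types (D : set T).

Lemma Rintegral_sum D (n : nat) (f : 'I_n -> T -> R) : measurable D ->
  (forall i, mu.-integrable D (EFin \o f i)) ->
  mu.-integrable D (EFin \o (fun x => \sum_(i < n) f i x)) /\
  \int[mu]_(x in D) (\sum_(i < n) f i x) = \sum_(i < n) \int[mu]_(x in D) f i x.
Proof.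
move=> mD; elim: n f => [|n IH] f fi.
  split; last first.
    rewrite big_ord0; under eq_Rintegral do rewrite big_ord0.
    by rewrite Rintegral_cst// mul0r.
  apply: (eq_integrable mD (cst 0%E)); last exact: integrable0.
  by move=> x _; rewrite /= big_ord0.
have [i1 E1] := IH (fun i => f (widen_ord (leqnSn n) i)) (fun i => fi _).
split.
  have := integrableD mD i1 (fi ord_max); apply: eq_integrable => // x _.
  by rewrite /= big_ord_recr/= EFinD.
rewrite big_ord_recr/= -E1 -RintegralD//.
by apply: eq_Rintegral => x _; rewrite big_ord_recr.
Qed.

Lemma integrable_cst_fin D (c : R) : measurable D -> (mu D < +oo)%E ->
  mu.-integrable D (EFin \o (fun=> c)).
Proof.
move=> mD fD; apply/integrableP; split.
  by apply/measurable_EFinP; exact: measurable_cst.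
by rewrite (integral_cst mu mD `|c|%:E) lte_mul_pinfty.
Qed.

(** Young's inequality with a parameter proportional to the tolerance takes the
  place of the Cauchy-Schwarz inequality. *)
Lemma L2_cvg_Rintegral D (f_ : nat -> T -> R) (f g : T -> R) :
  measurable D -> (mu D < +oo)%E ->
  (forall n, mu.-integrable D (EFin \o f_ n)) ->
  measurable_fun D f -> measurable_fun D g -> (forall x, `|g x| <= 1) ->
  (\int[mu]_(x in D) ((f_ n x - f x) ^+ 2)%R%:E)%E @[n --> \oo] --> 0%E ->
  mu.-integrable D (EFin \o (fun x => f x * g x)) /\
  (\int[mu]_(x in D) (f_ n x * g x)) @[n --> \oo] --> \int[mu]_(x in D) (f x * g x).
Proof.
move=> mD fD f_i mf mg g1 cv.
have m_ n : measurable_fun D (f_ n).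
  by apply/measurable_EFinP; case/integrableP: (f_i n).
have sq_i n b : (\int[mu]_(x in D) ((f_ n x - f x) ^+ 2)%R%:E < b%:E)%E ->
    mu.-integrable D (EFin \o (fun x => (f_ n x - f x) ^+ 2)).
  move=> lt; apply/integrableP; split.
    by apply/measurable_EFinP; apply: measurable_funX; exact: measurable_funB.
  under eq_integral do rewrite /= ger0_norm ?sqr_ge0//.
  exact: lt_trans lt (ltry _).
have small (b : R) : 0 < b -> \forall n \near \oo,
    (\int[mu]_(x in D) ((f_ n x - f x) ^+ 2)%R%:E < b%:E)%E.
  move=> b0; have [fin cv0] := (fine_cvgP _ _).1 cv.
  have lt0 := @cvgr0_norm_lt _ _ _ _ _ _ cv0 b b0.
  move: fin lt0 => [N1 _ h1] [N2 _ h2].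
  exists (maxn N1 N2) => // n /=; rewrite geq_max => /andP[/h1 /= nf /h2 /= ltn].
  by rewrite -(fineK nf) lte_fin; exact: le_lt_trans (ler_norm _) ltn.
have i1 := integrable_cst_fin 1 mD fD.
have [n0 _ /(_ n0 (leqnn _)) I0] := small 1 ltr01.
have fi : mu.-integrable D (EFin \o f).
  have ib := integrableD mD (integrable_norm (f_i n0)) (integrableD mD i1 (sq_i _ _ I0)).
  have {}ib : mu.-integrable D
      (EFin \o (fun x => `|f_ n0 x| + (1 + (f_ n0 x - f x) ^+ 2))).
    exact: ib.
  apply: integrable_dom ib _ => // x _.
  have E : `|f x| <= `|f_ n0 x| + `|f_ n0 x - f x|.
    apply: le_trans (ler_normB _ _); rewrite opprB [_ + (_ - _)]addrC subrK.
    exact: lexx.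
  apply: le_trans E _; rewrite lerD2l.
  rewrite -[X in _ <= 1 + X]real_normK ?num_real//.
  have := sqr_ge0 (`|f_ n0 x - f x| - 1); rewrite sqrrB1.
  have := normr_ge0 (f_ n0 x - f x); lra.
have mul_i (k : T -> R) : mu.-integrable D (EFin \o k) ->
    mu.-integrable D (EFin \o (fun x => k x * g x)).
  move=> ki; have ni := integrable_norm ki.
  apply: integrable_dom ni _ => //.
    apply: measurable_funM => //.
    by apply/measurable_EFinP; case/integrableP: ki.
  by move=> x _ /=; rewrite normrM ler_piMr.
split; first exact: mul_i.
pose L := fine (mu D); have L0 : 0 <= L by exact: fine_ge0.
apply/cvgrPdist_le => e e0.
pose eta := e / (L + 1).
have L1 : 0 < L + 1 by rewrite ltr_wpDl.
have eta0 : 0 < eta by rewrite divr_gt0.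
have [N _ HN] := small (e * eta) (mulr_gt0 e0 eta0).
exists N => // n /= Nn; have In := HN n Nn; have si := sq_i _ _ In.
rewrite -RintegralB//; [|exact: mul_i|exact: mul_i].
have ib : mu.-integrable D (EFin \o (fun x => eta / 2 + (2 * eta)^-1 * (f_ n x - f x) ^+ 2)).
  have := integrableD mD (integrable_cst_fin (eta / 2) mD fD)
    (integrable_scale (2 * eta)^-1 mD si).
  exact.
apply: le_trans (le_abs_Rintegral_dom mD ib _) _.
  move=> x _; rewrite -mulrBl normrM; apply: le_trans (ler_piMr _ (g1 x)) _ => //.
  rewrite distrC -[(_ - _) ^+ 2]real_normK ?num_real//.
  set y := `|_|; have := sqr_ge0 (y - eta) => H.
  rewrite -(ler_pM2l (_ : 0 < 2 * eta)); last by rewrite mulr_gt0.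
  have -> : 2 * eta * (eta / 2 + (2 * eta)^-1 * y ^+ 2) = eta ^+ 2 + y ^+ 2.
    by field; rewrite gt_eqF.
  by move: H; rewrite sqrrB; lra.
rewrite RintegralD//; first last.
- exact: integrable_scale.
- exact: integrable_cst_fin.
rewrite Rintegral_cst// RintegralZl// -/L.
have IR : \int[mu]_(x in D) (f_ n x - f x) ^+ 2 <= e * eta.
  rewrite /Rintegral -lee_fin fineK; last exact: integrable_fin_num.
  exact: ltW.
have A1 : eta / 2 * L <= e / 2.
  have -> : e = eta * (L + 1) by rewrite /eta; field; rewrite gt_eqF.
  by move: eta0; lra.
have A2 : (2 * eta)^-1 * \int[mu]_(x in D) (f_ n x - f x) ^+ 2 <= e / 2.
  apply: le_trans (_ : (2 * eta)^-1 * (e * eta) <= _).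
    by rewrite ler_wpM2l// invr_ge0 mulr_ge0// ltW.
  by rewrite le_eqVlt; apply/orP; left; apply/eqP; field; rewrite gt_eqF.
lra.
Qed.

End L2Convergence.

Section FrequencySums.
Context {R : realType}.

(** Frequencies growing at least linearly have summable powers of every order
  below -1. *)
Lemma sum_freq_powR_le (w : nat -> R) (c d : R) : 0 < c -> 0 < d ->
  (forall k, k.+1%:R * c <= w k) ->
  exists2 S : R, 0 <= S & forall n, \sum_(k < n) w k `^ (- (1 + d)) <= S.
Proof.
move=> c0 d0 cw; pose d1 := Num.min d 1.
have d10 : 0 < d1 by rewrite lt_min d0 ltr01.
have d11 : d1 <= 1 by rewrite ge_min lexx orbT.
have S0 : 0 <= 1 + d1^-1 by rewrite addr_ge0// invr_ge0 ltW.
exists (c `^ (- (1 + d)) * (1 + d1^-1)); first by rewrite mulr_ge0 ?powR_ge0.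
move=> n; apply: le_trans (_ : c `^ (- (1 + d)) *
    \sum_(k < n) k.+1%:R `^ (- 1 - d1) <= _); last first.
  apply: ler_wpM2l; first exact: powR_ge0.
  rewrite -(big_mkord xpredT (fun k => k.+1%:R `^ (- 1 - d1))).
  rewrite -(big_add1 _ _ 0 n.+1 xpredT (fun k => k%:R `^ (- 1 - d1))).
  by apply: sum_powR_neg_le; rewrite d10.
rewrite mulr_sumr; apply: ler_sum => k _.
have k0 : 0 < k.+1%:R :> R by rewrite ltr0n.
apply: le_trans (_ : (k.+1%:R * c) `^ (- (1 + d)) <= _).
  have wp : 0 < w k by apply: lt_le_trans (cw k); rewrite mulr_gt0.
  rewrite !powRN lef_pV2 ?posrE ?powR_gt0 ?mulr_gt0//.
  apply: ge0_ler_powR; rewrite ?nnegrE ?(ltW wp) ?cw//.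
    by rewrite addr_ge0// ltW.
  by rewrite mulr_ge0// ltW.
rewrite powRM ?(ltW c0) ?(ltW k0)// mulrC ler_wpM2l ?powR_ge0//.
apply: ler_powR; first by rewrite ler1n.
by rewrite opprD lerD2l lerN2 ge_min lexx.
Qed.

End FrequencySums.

(** * Modal expansion of the noise term *)

Section DominatedConvergence.
Context {dd : measure_display} {T : measurableType dd} {R : realType}.
Variable mu : {measure set T -> \bar R}.

Lemma Rintegral_dominated (D : set T) (f_ : nat -> T -> R) (f b : T -> R) :
  measurable D -> (forall n, measurable_fun D (f_ n)) ->
  (forall x, D x -> f_ n x @[n --> \oo] --> f x) ->
  mu.-integrable D (EFin \o b) -> (forall n x, D x -> `|f_ n x| <= b x) ->
  mu.-integrable D (EFin \o f) /\
  \int[mu]_(x in D) f_ n x @[n --> \oo] --> \int[mu]_(x in D) f x.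
Proof.
move=> mD mf_ cf ib fb.
have mf : measurable_fun D f by exact: measurable_fun_cvg mf_ cf.
have [||fi _ C] := @dominated_convergence _ _ _ mu D mD (fun n => EFin \o f_ n)
  (EFin \o f) (EFin \o b) (fun n => (measurable_EFinP _ _).2 (mf_ n))
  ((measurable_EFinP _ _).2 mf) _ ib.
- apply: aeW => x Dx; apply: cvg_EFin; first exact: nearW.
  exact: cf.
- by apply: aeW => x n Dx; rewrite /= lee_fin fb.
split=> //; apply: fine_cvg.
by rewrite /Rintegral fineK//; exact: integrable_fin_num.
Qed.

Lemma cvg_sum_ord (n : nat) (f : 'I_n -> nat -> R) (a : 'I_n -> R) :
  (forall i, f i k @[k --> \oo] --> a i) ->
  (\sum_(i < n) f i k) @[k --> \oo] --> \sum_(i < n) a i.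
Proof.
elim: n f a => [|n IH] f a fa.
  by rewrite big_ord0; under eq_fun do rewrite big_ord0; exact: cvg_cst.
rewrite big_ord_recr/=; under eq_fun do rewrite big_ord_recr/=.
by apply: cvgD => //; apply: IH => i; exact: fa.
Qed.

End DominatedConvergence.

Section ModalExpansion.
Context {R : realType}.
Notation leb := (@lebesgue_measure R).
Variables (l T : R) (e : nat -> L2D l) (w : nat -> R) (u : nat -> R -> R).
Variables (F : R -> R -> R -> R) (gamma : R -> R).
Variables (c Ce a K0 q H g0 g1 : R).
Hypothesis (l0 : 0 < l) (T0 : 0 < T) (c0 : 0 < c) (Ce0 : 0 <= Ce) (a0 : 0 < a).
Hypothesis (K00 : 0 <= K0) (q0 : 0 <= q) (qH : q < H) (H12 : H <= 2^-1).
Hypothesis (g00 : 0 <= g0) (g10 : 0 <= g1).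
Hypothesis hg : lipschitz_weight T g0 g1 gamma.
Hypothesis w_ge : forall k, k.+1%:R * c <= w k.
Hypothesis hu : forall k, time_kernel_bound T q (K0 * w k `^ (- a)) (u k).
Hypothesis e_le : forall k (x : R), x \in `]0, l[ -> `|e k x| <= Ce.
Hypothesis e_int : forall k (b1 b2 : R), 0 <= b1 -> b1 < b2 -> b2 <= l ->
  `|\int[leb]_(x in `]b1, b2[) e k x| <= Ce / w k.
Hypothesis F_meas : measurable_fun
    ([set` `]0, +oo[] `*` [set` `]0, l[] `*` [set` `]0, l[]
      : set (measurableTypeR R * measurableTypeR R * measurableTypeR R))
    (fun p : measurableTypeR R * measurableTypeR R * measurableTypeR R =>
       F p.1.1 p.1.2 p.2).
Hypothesis F_cvg : forall t x : R, 0 < t -> x \in `]0, l[ ->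
    (\int[muD l]_y
       ((\sum_(k < n) u k t * e k x * e k y - F t x y) ^+ 2)%R%:E)%E
      @[n --> \oo] --> 0%E.

Let w0 k : 0 < w k.
Proof. by apply: lt_le_trans (w_ge k); rewrite mulr_gt0. Qed.

Lemma kernel_section_measurable r x : 0 < r -> x \in `]0, l[ ->
  measurable_fun `]0, l[ (F r x).
Proof.
move=> r0 x0.
pose g (y : measurableTypeR R) : measurableTypeR R * measurableTypeR R * measurableTypeR R
  := ((r, x), y).
have mg : measurable_fun [set` `]0, l[] g.
  apply/measurable_funTS/measurable_fun_pair => //.
apply: (measurable_comp _ _ F_meas mg).
  by apply: measurableX => //; apply: measurableX.
by move=> _ [y y0 <-]; split => //; split => //; rewrite /= in_itv/= r0.
Qed.

Definition cell_mass k h (j : nat) : R :=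
  \int[leb]_(y in `]0, l[) (e k y * \1_`]j%:R * h, j.+1%:R * h]%classic y).

Lemma indic_le1 (A : set R) (x : R) : `|\1_A x| <= 1 :> R.
Proof. by rewrite indicE; case: (_ \in _); rewrite ?normr1 ?normr0. Qed.

Let cell_meas (b1 b2 : R) (D : set R) :
  measurable_fun D (\1_`]b1, b2]%classic : R -> R).
Proof. exact: measurable_indic. Qed.

(** For fixed [x] the series of the Green kernel converges in mean square in [y],
  which is enough to integrate it over a cell. *)
Lemma kernel_cell r x h j : 0 < r -> x \in `]0, l[ ->
  leb.-integrable `]0, l[
    (EFin \o (fun y => F r x y * \1_`]j%:R * h, j.+1%:R * h]%classic y)) /\
  (\sum_(k < n) u k r * e k x * cell_mass k h j) @[n --> \oo] -->
    \int[leb]_(y in `]0, l[) (F r x y * \1_`]j%:R * h, j.+1%:R * h]%classic y).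
Proof.
move=> r0 x0.
have ei k : leb.-integrable `]0, l[ (EFin \o e k) by exact: L2D_integrable_itv.
have fi n : leb.-integrable `]0, l[
    (EFin \o (fun y => \sum_(k < n) u k r * e k x * e k y)).
  apply: (Rintegral_sum _ _).1 => // k; exact: integrable_scale.
have lf : (leb `]0%R, l[%classic < +oo)%E.
  by rewrite lebesgue_measure_itv/= lte_fin l0 -EFinB ltry.
have [|Fi FC] := @L2_cvg_Rintegral _ _ _ leb `]0, l[%classic
  (fun n y => \sum_(k < n) u k r * e k x * e k y) (F r x)
  (\1_`]j%:R * h, j.+1%:R * h]%classic) (measurable_itv _) lf fi
  (kernel_section_measurable r0 x0) (@cell_meas _ _ _) (@indic_le1 _).
  apply: (@squeeze_cvge _ _ _ _ (fun=> 0%E) _ (fun n => (\int[muD l]_y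
       ((\sum_(k < n) u k r * e k x * e k y - F r x y) ^+ 2)%R%:E)%E)).
  - apply: nearW => n; apply/andP; split.
      by apply: integral_ge0 => y _; rewrite lee_fin sqr_ge0.
    by apply: ge0_integral_muD_ge => y; rewrite lee_fin sqr_ge0.
  - exact: cvg_cst.
  - exact: F_cvg.
split=> //; apply: cvg_trans FC; apply: near_eq_cvg; apply: nearW => n.
have mul_i k : leb.-integrable `]0, l[
    (EFin \o (fun y => e k y * \1_`]j%:R * h, j.+1%:R * h]%classic y)).
  apply: integrable_dom (integrable_norm (ei k)) _ => //.
    apply: measurable_funM; last exact: cell_meas.
    by apply: measurable_funTS; exact: measurable_L2D.
  by move=> y _; rewrite normrM ler_piMr// indic_le1.
apply/esym; transitivity (\int[leb]_(y in `]0, l[) (\sum_(k < n) u k r * e k x *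
    (e k y * \1_`]j%:R * h, j.+1%:R * h]%classic y))).
  rewrite (Rintegral_sum _ _).2//; last first.
    by move=> k; apply: integrable_scale.
  by apply: eq_bigr => k _; rewrite RintegralZl.
by apply: eq_Rintegral => y _; rewrite mulr_suml; apply: eq_bigr => k _; rewrite mulrA.
Qed.


Variables (m m' : nat) (t : R).
Hypothesis (m_gt0 : (0 < m)%N) (m'_gt0 : (0 < m')%N) (t0 : 0 <= t) (tT : t <= T).
Let tau := T / m%:R.
Let h := l / m'%:R.
Let tau0 : 0 < tau. Proof. by rewrite divr_gt0// ltr0n. Qed.
Let h0 : 0 < h. Proof. by rewrite divr_gt0// ltr0n. Qed.
Let A k i := time_average gamma (u k) t tau i.
Let B k j := space_average (e k) h j.

Let cell_massE k j : cell_mass k h j = h * B k j.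
Proof. by rewrite /B /space_average mulrA mulfV ?gt_eqF// mul1r. Qed.

Let B_decay k j : (j < m')%N -> `|h * B k j| <= Ce / w k.
Proof.
move=> jm; rewrite normrM (gtr0_norm h0) -ler_pdivlMl//.
apply: space_average_decay => //; exact: e_int.
Qed.

Let in_t (v : R) : `]0, t[%classic v -> 0 <= v /\ v < t.
Proof. by rewrite /= in_itv/= => /andP[/ltW]. Qed.

Let ker_i k : leb.-integrable `]0, t[ (EFin \o (fun v => u k (t - v) * gamma v)).
Proof.
apply: (convolution_kernel_integrable T0 q0 qH H12 g00 g10 hg (hu k) _ tT).
by rewrite mulr_ge0 ?powR_ge0.
Qed.

Let ker_ind_i k (b1 b2 : R) : leb.-integrable `]0, t[
  (EFin \o (fun v => u k (t - v) * gamma v * \1_`]b1, b2]%classic v)).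
Proof.
apply: integrable_dom (integrable_norm (ker_i k)) _ => //.
  apply: measurable_funM; last exact: cell_meas.
  by apply/measurable_EFinP; case/integrableP: (ker_i k).
by move=> v _; rewrite /= normrM ler_piMr// indic_le1.
Qed.

Let freq_sum : exists2 S : R, 0 <= S &
  forall n, \sum_(k < n) w k `^ (- (1 + a)) <= S.
Proof. exact: sum_freq_powR_le c0 a0 w_ge. Qed.

Let freq_mul k : (w k)^-1 * w k `^ (- a) = w k `^ (- (1 + a)).
Proof.
rewrite -[(w k)^-1]powR_inv1 ?(ltW (w0 k))// -powRD ?(gt_eqF (w0 k)) ?implybT//.
by rewrite opprD.
Qed.

(** The section integrals of the Green kernel are sums of the mode series, and
  dominated convergence in time applies because cell integrals of the
  eigenfunctions gain one power of the frequency. *)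
Lemma cell_convolution x i j : x \in `]0, l[ -> (j < m')%N ->
  let phi r := \int[leb]_(y in `]0, l[)
     (F r x y * \1_`]j%:R * h, j.+1%:R * h]%classic y) in
  leb.-integrable `]0, t[ (EFin \o (fun v =>
    phi (t - v) * gamma v * \1_`]i%:R * tau, i.+1%:R * tau]%classic v)) /\
  (\sum_(k < n) e k x * (h * B k j) * (tau * A k i)) @[n --> \oo] -->
    \int[leb]_(v in `]0, t[)
      (phi (t - v) * gamma v * \1_`]i%:R * tau, i.+1%:R * tau]%classic v).
Proof.
move=> x0 jm phi; have [S S0 hS] := freq_sum.
have q1 : 0 <= q < 1.
  by rewrite q0/= (lt_le_trans qH)// (le_trans H12)// invf_le1// ler1n.
pose I := \1_`]i%:R * tau, i.+1%:R * tau]%classic : R -> R.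
pose f_ n v := \sum_(k < n) e k x * (h * B k j) * (u k (t - v) * gamma v * I v).
pose b v := Ce * Ce * K0 * g0 * S * (t - v) `^ (- q).
have ib : leb.-integrable `]0, t[ (EFin \o b).
  apply: integrable_scale => //; exact: integrable_powR_sing.
have fi n : leb.-integrable `]0, t[ (EFin \o f_ n) /\
    \int[leb]_(v in `]0, t[) f_ n v =
    \sum_(k < n) e k x * (h * B k j) * (tau * A k i).
  have ki (k : 'I_n) : leb.-integrable `]0, t[
      (EFin \o (fun v => e k x * (h * B k j) * (u k (t - v) * gamma v * I v))).
    apply: integrable_scale => //; exact: ker_ind_i.
  have [f1 f2] := @Rintegral_sum _ _ _ leb `]0, t[%classic n
    (fun k v => e k x * (h * B k j) * (u k (t - v) * gamma v * I v))
    (measurable_itv _) ki.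
  split=> //; rewrite f2; apply: eq_bigr => k _; rewrite RintegralZl//; last first.
    exact: ker_ind_i.
  by congr (_ * _); rewrite /A /time_average mulrA mulfV ?gt_eqF// mul1r.
have [|||] := @Rintegral_dominated _ _ _ leb `]0, t[%classic f_
    (fun v => phi (t - v) * gamma v * I v) b (measurable_itv _) _ _ ib _.
- by move=> n; apply/measurable_EFinP; case/integrableP: (fi n).1.
- move=> v /in_t[v0 vt]; have r0 : 0 < t - v by rewrite subr_gt0.
  have [_ C] := kernel_cell h j r0 x0.
  have CM : ((\sum_(k < n) u k (t - v) * e k x * cell_mass k h j) * (gamma v * I v))
      @[n --> \oo] --> phi (t - v) * (gamma v * I v) by apply: cvgMl; exact: C.
  rewrite -mulrA; apply: cvg_trans CM.
  apply: near_eq_cvg; apply: nearW => n; rewrite mulr_suml; apply: eq_bigr => k _.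
  by rewrite cell_massE; ring.
- move=> n v vin; have [v0 vt] := in_t vin.
  apply: le_trans (ler_norm_sum _ _ _) _.
  apply: le_trans (_ : \sum_(k < n) Ce * Ce * K0 * g0 * (t - v) `^ (- q) *
     w k `^ (- (1 + a)) <= _); last first.
    rewrite -mulr_sumr /b -[leRHS]mulrA [S * _]mulrC mulrA ler_wpM2l//.
    by rewrite !mulr_ge0 ?powR_ge0.
  apply: ler_sum => k _; rewrite 2!normrM.
  have E1 := e_le k x0; have E2 := B_decay k jm.
  have E3 : `|u k (t - v) * gamma v * I v| <=
      K0 * w k `^ (- a) * g0 * (t - v) `^ (- q).
    rewrite normrM; apply: le_trans (ler_piMr _ (indic_le1 _ _)) _ => //.
    exact: (convolution_kernel_le hg (hu k) tT).
  have E12 := ler_pM (normr_ge0 _) (normr_ge0 _) E1 E2.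
  apply: le_trans (ler_pM _ (normr_ge0 _) E12 E3) _; first exact: mulr_ge0.
  rewrite -freq_mul le_eqVlt; apply/orP; left; apply/eqP; ring.
move=> FI FC; split => //; apply: cvg_trans FC; apply: near_eq_cvg.
by apply: nearW => n; rewrite (fi n).2.
Qed.


Section Noise.
Context {d : measure_display} {Om : measurableType d}.
Variable P : probability Om R.
Variable W : R -> R -> {RV P >-> R}.

Definition mode_noise (k : nat) (om : Om) : R :=
  \sum_(i < m) \sum_(j < m') A k i * B k j *
    cell_noise W (mesh_cell l T m m' i j) om.

Let value (om : Om) (x : R) : R := \int[leb]_(v in `]0, t[)
   \int[leb]_(y in `]0, l[) (F (t - v) x y * gamma v * wong_zakai l T W m m' om y v).

(** As the approximate noise is constant on cells, the value is a finite
  combination of cell convolutions. *)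
Lemma noise_value_cvg om x : x \in `]0, l[ ->
  (\sum_(k < n) mode_noise k om * e k x) @[n --> \oo] --> value om x.
Proof.
move=> x0.
pose kap (i j : nat) := (tau * h)^-1 * cell_noise W (mesh_cell l T m m' i j) om.
pose phi (j : nat) r := \int[leb]_(y in `]0, l[)
     (F r x y * \1_`]j%:R * h, j.+1%:R * h]%classic y).
pose I (i : nat) := \1_`]i%:R * tau, i.+1%:R * tau]%classic : R -> R.
have CC i (j : 'I_m') := cell_convolution i x0 (ltn_ord j).
have inner_eq v : `]0, t[%classic v ->
    \int[leb]_(y in `]0, l[) (F (t - v) x y * gamma v * wong_zakai l T W m m' om y v)
    = \sum_(i < m) \sum_(j < m') kap i j * (phi j (t - v) * gamma v * I i v).
  move=> /in_t[v0 vt]; have r0 : 0 < t - v by rewrite subr_gt0.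
  have KI i j : leb.-integrable `]0, l[ (EFin \o (fun y => kap i j * gamma v * I i v *
      (F (t - v) x y * \1_`]j%:R * h, j.+1%:R * h]%classic y))).
    apply: integrable_scale => //; exact: (kernel_cell h j r0 x0).1.
  have RS (i : 'I_m) := @Rintegral_sum _ _ _ leb `]0, l[%classic m'
    (fun j y => kap i j * gamma v * I i v *
      (F (t - v) x y * \1_`]j%:R * h, j.+1%:R * h]%classic y))
    (measurable_itv _) (fun j => KI i j).
  transitivity (\int[leb]_(y in `]0, l[) (\sum_(i < m) \sum_(j < m')
     kap i j * gamma v * I i v *
      (F (t - v) x y * \1_`]j%:R * h, j.+1%:R * h]%classic y))).
    apply: eq_Rintegral => y _; rewrite /wong_zakai mulr_sumr.
    apply: eq_bigr => i _; rewrite mulr_sumr; apply: eq_bigr => j _.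
    by rewrite /kap /mesh_cell /cell_indic -/tau -/h /I; ring.
  rewrite (Rintegral_sum _ (fun i => (RS i).1)).2//.
  apply: eq_bigr => i _; rewrite (RS i).2; apply: eq_bigr => j _.
  rewrite RintegralZl//; last exact: (kernel_cell h j r0 x0).1.
  by rewrite -/(phi j (t - v)); ring.
have KI i (j : 'I_m') : leb.-integrable `]0, t[ (EFin \o (fun v => kap i j *
    (phi j (t - v) * gamma v * I i v))).
  apply: integrable_scale => //; exact: (CC i j).1.
have RS (i : 'I_m) := @Rintegral_sum _ _ _ leb `]0, t[%classic m'
    (fun j v => kap i j * (phi j (t - v) * gamma v * I i v))
    (measurable_itv _) (fun j => KI i j).
have -> : value om x = \sum_(i < m) \sum_(j < m') kap i j *
    \int[leb]_(v in `]0, t[) (phi j (t - v) * gamma v * I i v).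
  transitivity (\int[leb]_(v in `]0, t[) (\sum_(i < m) \sum_(j < m')
      kap i j * (phi j (t - v) * gamma v * I i v))).
    by apply: eq_Rintegral => v /set_mem vin; exact: inner_eq.
  rewrite (Rintegral_sum _ (fun i => (RS i).1)).2//.
  apply: eq_bigr => i _; rewrite (RS i).2; apply: eq_bigr => j _.
  by rewrite RintegralZl//; exact: (CC i j).1.
have C : (\sum_(i < m) \sum_(j < m') kap i j *
    \sum_(k < n) e k x * (h * B k j) * (tau * A k i)) @[n --> \oo] -->
  \sum_(i < m) \sum_(j < m') kap i j *
    \int[leb]_(v in `]0, t[) (phi j (t - v) * gamma v * I i v).
  apply: (@cvg_sum_ord R m (fun i n => \sum_(j < m') kap i j *
    \sum_(k < n) e k x * (h * B k j) * (tau * A k i))) => i.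
  apply: (@cvg_sum_ord R m' (fun j n => kap i j *
    \sum_(k < n) e k x * (h * B k j) * (tau * A k i))) => j.
  by apply: cvgMr; exact: (CC i j).2.
apply: cvg_trans C; apply: near_eq_cvg; apply: nearW => n.
transitivity (\sum_(i < m) \sum_(k < n) \sum_(j < m') kap i j *
    (e k x * (h * B k j) * (tau * A k i))).
  apply: eq_bigr => i _; rewrite exchange_big/=; apply: eq_bigr => j _.
  by rewrite mulr_sumr.
rewrite exchange_big/=; apply: eq_bigr => k _.
rewrite /mode_noise mulr_suml; apply: eq_bigr => i _; rewrite mulr_suml.
by apply: eq_bigr => j _; rewrite /kap; field; rewrite !gt_eqF.
Qed.

(** The constant depends on the outcome and on the mesh; the bound only provides
  the dominating function for [noise_coeff]. *)
Lemma mode_noise_decay om : exists2 C : R, 0 <= C & forall k,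
  `|mode_noise k om| <= C * w k `^ (- (1 + a)).
Proof.
pose N (i j : nat) := `|cell_noise W (mesh_cell l T m m' i j) om|.
exists (\sum_(i < m) \sum_(j < m')
  (2 * K0 * g0 * tau `^ (- q)) * (h^-1 * Ce) * N i j).
  apply: sumr_ge0 => i _; apply: sumr_ge0 => j _.
  have ? : 0 <= h^-1 by rewrite invr_ge0 ltW.
  by do ![exact: powR_ge0 | exact: normr_ge0 | by [] | apply: mulr_ge0].
move=> k; rewrite mulr_suml; apply: le_trans (ler_norm_sum _ _ _) _.
apply: ler_sum => i _; rewrite mulr_suml; apply: le_trans (ler_norm_sum _ _ _) _.
apply: ler_sum => j _; rewrite 2!normrM.
have KK : 0 <= K0 * w k `^ (- a) by rewrite mulr_ge0 ?powR_ge0.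
have EA : `|A k i| <= 2 * (K0 * w k `^ (- a)) * g0 * tau `^ (- q).
  exact: (time_average_le T0 q0 qH H12 g00 g10 hg (hu k) KK tT tau0).
have EB : `|B k j| <= h^-1 * (Ce / w k).
  by apply: space_average_decay => //; exact: e_int.
apply: le_trans (ler_wpM2r (normr_ge0 _) (ler_pM (normr_ge0 _) (normr_ge0 _) EA EB)) _.
rewrite -freq_mul le_eqVlt; apply/orP; left; apply/eqP; rewrite /N; ring.
Qed.

Hypothesis orth : forall i j, inner (e i) (e j) = (i == j)%:R.

(** The noise term is known pointwise in [x] as the sum of a series; the series
  is dominated, so its coefficients can be read off. *)
Lemma noise_coeff om (Z : L2D l) k :
  {ae muD l, forall x, Z x = value om x} -> inner Z (e k) = mode_noise k om.
Proof.
move=> ZE; have [C C0 hC] := mode_noise_decay om; have [S S0 hS] := freq_sum.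
pose Sn n : L2D l := \sum_(k < n) mode_noise k om *: e k.
have SnE n x : Sn n x = \sum_(k < n) mode_noise k om * e k x.
  rewrite /Sn; elim: n => [|n IH]; first by rewrite !big_ord0.
  by rewrite !big_ord_recr/= -IH.
have D0 : (muD l).-integrable `]0, l[ (EFin \o (fun=> Ce * (C * S) * Ce)).
  apply: integrable_cst_fin => //; apply: le_lt_trans (muD_fin l).
  by apply: le_measure; rewrite ?inE.
have [|||VI VC] := @Rintegral_dominated _ _ _ (muD l) `]0, l[%classic
    (fun n x => Sn n x * e k x) (fun x => value om x * e k x)
    (fun=> Ce * (C * S) * Ce) (measurable_itv _) _ _ D0 _.
- move=> n; apply: measurable_funTS; apply: measurable_funM; exact: measurable_L2D.
- move=> x x0; apply: cvgMl; under eq_fun do rewrite SnE.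
  exact: noise_value_cvg.
- move=> n x x0; rewrite normrM; apply: ler_pM => //; last exact: e_le.
  rewrite SnE; apply: le_trans (ler_norm_sum _ _ _) _.
  apply: le_trans (_ : \sum_(k < n) Ce * (C * w k `^ (- (1 + a))) <= _); last first.
    by rewrite -mulr_sumr -mulr_sumr; apply: ler_wpM2l => //; apply: ler_wpM2l.
  apply: ler_sum => i _; rewrite normrM mulrC; apply: ler_pM => //; exact: e_le.
have muDE (v v' : L2D l) : inner v v' = \int[muD l]_(x in `]0, l[) (v x * v' x).
  rewrite inner_itv /Rintegral -integral_muD_itv//.
have ZV : inner Z (e k) = \int[muD l]_(x in `]0, l[) (value om x * e k x).
  rewrite muDE; congr fine; apply: ae_eq_integral => //.
  - apply/measurable_EFinP; apply: measurable_funTS.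
    by apply: measurable_funM; exact: measurable_L2D.
  - by case/integrableP: VI.
  - by apply: filterS ZE => x /= -> _.
rewrite ZV; apply/esym; apply: (cvg_unique _ _ VC); first exact: norm_hausdorff.
apply: cvg_trans (cvg_cst (mode_noise k om)).
apply: near_eq_cvg; near=> n; rewrite -muDE.
rewrite (inner_sum_basis orth (fun k => mode_noise k om)) ifT//.
by near: n; exact: nbhs_infty_gt.
Unshelve. all: by try exact: eventually_filter; end_near. Qed.

End Noise.
End ModalExpansion.

(** * Variance of tensor combinations of increments *)

Section SheetVariance.
Context {R : realType} {d : measure_display} {Om : measurableType d}.
Variable P : probability Om R.
Variables (l T H1 H2 : R) (W : R -> R -> {RV P >-> R}).
Hypothesis (l0 : 0 < l) (T0 : 0 < T).
Hypothesis hW : fractional_brownian_sheet l T H1 H2 W.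

Definition increment_cov (H tau : R) (i j : nat) : R :=
  fbm_cov H (i.+1%:R * tau) (j.+1%:R * tau) - fbm_cov H (i%:R * tau) (j.+1%:R * tau)
  - fbm_cov H (i.+1%:R * tau) (j%:R * tau) + fbm_cov H (i%:R * tau) (j%:R * tau).

Variables (m m' : nat).
Hypothesis (m_gt0 : (0 < m)%N) (m'_gt0 : (0 < m')%N).
Let tau := T / m%:R.
Let h := l / m'%:R.

Lemma mesh_in (L : R) (n k : nat) : 0 < L -> (0 < n)%N -> (k <= n)%N ->
  k%:R * (L / n%:R) \in `[0, L].
Proof.
move=> L0 n0 kn; rewrite in_itv/= mulr_ge0 ?divr_ge0 ?ler0n ?(ltW L0)//=.
by rewrite mulrA ler_pdivrMr ?ltr0n// mulrC ler_pM2l// ler_nat.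
Qed.

Variables (A B : nat -> R).

Lemma sum_cell_noise om :
  \sum_(i < m) \sum_(j < m') A i * B j * cell_noise W (mesh_cell l T m m' i j) om =
  \sum_(p : 'I_m.+1 * 'I_m'.+1)
    nodal A m p.1 * nodal B m' p.2 * W (p.2%:R * h) (p.1%:R * tau) om.
Proof.
pose G (i j : nat) := W (j%:R * h) (i%:R * tau) om.
pose g i := \sum_(j < m'.+1) nodal B m' j * G i j.
rewrite -(pair_bigA _ (fun (i : 'I_m.+1) (j : 'I_m'.+1) =>
  nodal A m i * nodal B m' j * G i j))/=.
transitivity (\sum_(i < m) A i * (g i.+1 - g i)).
  apply: eq_bigr => i _; rewrite /g -!(sum_nodal B (G _)) -sumrB mulr_sumr.
  apply: eq_bigr => j _; rewrite /mesh_cell /cell_noise -/tau -/h /G; ring.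
rewrite sum_nodal; apply: eq_bigr => i _; rewrite /g mulr_sumr.
by apply: eq_bigr => j _; rewrite mulrA.
Qed.

Let sum_fact (n n' : nat) (a : nat -> R) (b : nat -> R) (K1 K2 : nat -> nat -> R) :
  \sum_(p : 'I_n * 'I_n') \sum_(p' : 'I_n * 'I_n')
    (a p.1 * b p.2) * (a p'.1 * b p'.2) * (K1 p.2 p'.2 * K2 p.1 p'.1) =
  (\sum_(i < n) \sum_(i' < n) a i * a i' * K2 i i') *
  (\sum_(j < n') \sum_(j' < n') b j * b j' * K1 j j').
Proof.
rewrite -(pair_bigA _ (fun (i : 'I_n) (j : 'I_n') => \sum_(p' : 'I_n * 'I_n')
    (a i * b j) * (a p'.1 * b p'.2) * (K1 j p'.2 * K2 i p'.1)))/=.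
rewrite mulr_suml; apply: eq_bigr => i _.
rewrite mulr_sumr; apply: eq_bigr => j _.
rewrite -(pair_bigA _ (fun (i' : 'I_n) (j' : 'I_n') =>
    (a i * b j) * (a i' * b j') * (K1 j j' * K2 i i')))/=.
rewrite mulr_suml; apply: eq_bigr => i' _.
by rewrite mulr_sumr; apply: eq_bigr => j' _; ring.
Qed.

(** The covariance of the sheet is a product, so that the variance of a
  tensor-product combination of its increments factorizes. *)
Lemma sheet_variance :
  ('E_P[fun om => ((\sum_(i < m) \sum_(j < m') A i * B j *
      cell_noise W (mesh_cell l T m m' i j) om) ^+ 2)%R] =
   ((\sum_(i < m) \sum_(j < m) A i * A j * increment_cov H2 tau i j) *
    (\sum_(i < m') \sum_(j < m') B i * B j * increment_cov H1 h i j))%:E)%E.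
Proof.
have -> : (fun om => ((\sum_(i < m) \sum_(j < m') A i * B j *
      cell_noise W (mesh_cell l T m m' i j) om) ^+ 2)%R) =
    (fun om => (\sum_(p : 'I_m.+1 * 'I_m'.+1)
    nodal A m p.1 * nodal B m' p.2 * W (p.2%:R * h) (p.1%:R * tau) om) ^+ 2).
  by apply/funext => om; rewrite sum_cell_noise.
have := @second_moment R _ _ P ('I_m.+1 * 'I_m'.+1)%type
  (fun p om => W (p.2%:R * h) (p.1%:R * tau) om)
  (fun p p' => fbm_cov H1 (p.2%:R * h) (p'.2%:R * h)
     * fbm_cov H2 (p.1%:R * tau) (p'.1%:R * tau))
  (fun p => nodal A m p.1 * nodal B m' p.2).
move=> ->.
- congr EFin; rewrite (@sum_fact m.+1 m'.+1 (nodal A m) (nodal B m')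
    (fun j j' => fbm_cov H1 (j%:R * h) (j'%:R * h))
    (fun i i' => fbm_cov H2 (i%:R * tau) (i'%:R * tau))).
  congr (_ * _).
    exact: (sum_nodal2 A (fun i i' => fbm_cov H2 (i%:R * tau) (i'%:R * tau))).
  exact: (sum_nodal2 B (fun j j' => fbm_cov H1 (j%:R * h) (j'%:R * h))).
- by move=> p; exact: measurable_funPT.
- move=> [i j] [i' j'] /=; apply: hW.2; apply: mesh_in => //;
    by rewrite -ltnS.
Qed.

(** At the final time the sheet is, up to a constant factor, a fractional Brownian
  motion in space, and the quadratic form is the variance of a combination of its
  increments. *)
Lemma space_variance_ge0 :
  0 <= \sum_(i < m') \sum_(j < m') B i * B j * increment_cov H1 h i j.
Proof.
have mesh (k : 'I_m'.+1) : k%:R * h \in `[0, l].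
  by apply: mesh_in => //; rewrite -ltnS.
have TT : T \in `[0, T] by rewrite in_itv/= lexx ltW.
have P0 : (0 <= 'E_P[fun om => ((\sum_(p < m'.+1)
    nodal B m' p * W (p%:R * h) T om) ^+ 2)%R])%E.
  by rewrite unlock; apply: integral_ge0 => om _; rewrite lee_fin sqr_ge0.
rewrite (@second_moment R _ _ P 'I_m'.+1 (fun p om => W (p%:R * h) T om)
  (fun p p' => fbm_cov H1 (p%:R * h) (p'%:R * h) * fbm_cov H2 T T)
  (fun p => nodal B m' p)) in P0; first last.
- by move=> i j; exact: hW.2.
- by move=> p; exact: measurable_funPT.
rewrite lee_fin in P0.
have T2 : 0 < fbm_cov H2 T T.
  rewrite /fbm_cov subrr normr0 (gtr0_norm T0).
  have [->|H20] := eqVneq (2 * H2) 0; first by rewrite !powRr0; lra.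
  rewrite (powR0 H20) subr0; have := powR_gt0 (2 * H2) T0; lra.
have := P0; under eq_bigr do under eq_bigr do rewrite mulrA.
under eq_bigr do rewrite -mulr_suml.
rewrite -mulr_suml pmulr_lge0//.
by rewrite (sum_nodal2 B (fun j j' => fbm_cov H1 (j%:R * h) (j'%:R * h))).
Qed.

End SheetVariance.

(** * Second moment of the noise term *)

Section ModalSecondMoment.
Context {R : realType} {d : measure_display} {Om : measurableType d}.
Variable P : probability Om R.
Variables (l : R) (e : nat -> L2D l).
Hypothesis orth : forall i j, inner (e i) (e j) = (i == j)%:R.
Hypothesis complete :
  forall v, cvgH (fun n => \sum_(k < n) inner v (e k) *: e k) v.

(** Measurability is given for pairings only, and Parseval's identity recovers the
  norm from them. *)
Lemma measurable_normH_sqr (X : Om -> L2D l) :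
  (forall w, measurable_fun setT (fun om => inner (X om) w)) ->
  measurable_fun setT (fun om => normH (X om) ^+ 2).
Proof.
move=> mX; apply: (measurable_fun_cvg (h := 
    fun n om => \sum_(k < n) inner (X om) (e k) ^+ 2)).
  by move=> n; apply: measurable_sum => k; exact: measurable_funX.
by move=> om _; exact: (@parseval _ _ e orth complete).
Qed.

Lemma normH_second_moment_le (X : Om -> L2D l) (V : nat -> R) (S : R) :
  (forall w, measurable_fun setT (fun om => inner (X om) w)) ->
  (forall k, ('E_P[fun om => (inner (X om) (e k) ^+ 2)%R] <= (V k)%:E)%E) ->
  (forall n, \sum_(k < n) V k <= S) ->
  ('E_P[fun om => (normH (X om) ^+ 2)%R] <= S%:E)%E.
Proof.
move=> mX EX VS.
pose g n om := (\sum_(k < n) inner (X om) (e k) ^+ 2)%:E.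
have mg n : measurable_fun setT (g n).
  by apply/measurable_EFinP; apply: measurable_sum => k; exact: measurable_funX.
have g0 n om : setT om -> (0 <= g n om)%E.
  by move=> _; rewrite lee_fin sumr_ge0// => k _; exact: sqr_ge0.
have gnd om : setT om -> {homo g ^~ om : p q / (p <= q)%N >-> (p <= q)%E}.
  move=> _ p q pq; rewrite lee_fin.
  rewrite -!(big_mkord xpredT (fun k => inner (X om) (e k) ^+ 2)).
  rewrite [leRHS](big_cat_nat (n := p))//= lerDl sumr_ge0// => k _; exact: sqr_ge0.
have glim om : limn (g ^~ om) = (normH (X om) ^+ 2)%:E.
  apply/cvg_lim => //; apply: cvg_EFin; first exact: nearW.
  exact: (@parseval _ _ e orth complete).
have := @cvg_monotone_convergence _ _ _ P _ measurableT g mg g0 gnd.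
rewrite (_ : (fun x => limn (g^~ x)) = fun om => (normH (X om) ^+ 2)%:E); last first.
  by apply/funext.
rewrite unlock => C; rewrite -(cvg_lim _ C)//.
apply: lime_le; first by apply/cvg_ex; eexists; exact: C.
apply: nearW => n.
rewrite /g; under eq_integral do rewrite -sumEFin.
rewrite ge0_integral_sum//; last 2 first.
- by move=> k; apply/measurable_EFinP; exact: measurable_funX.
- by move=> k om _; rewrite lee_fin sqr_ge0.
apply: le_trans (_ : (\sum_(k < n) V k)%:E <= _)%E; last by rewrite lee_fin.
rewrite -sumEFin; apply: lee_sum => k _.
by have := EX k; rewrite unlock.
Qed.

End ModalSecondMoment.

Section NoiseSecondMoment.
Context {R : realType} {d : measure_display} {Om : measurableType d}.
Variable P : probability Om R.
Variables (l T H1 H2 : R) (W : R -> R -> {RV P >-> R}).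
Variables (e : nat -> L2D l) (w : nat -> R) (u : nat -> R -> R).
Variables (F : R -> R -> R -> R) (gamma : R -> R).
Variables (c Ce a K0 q g0 g1 sg : R).
Hypothesis (l0 : 0 < l) (T0 : 0 < T) (c0 : 0 < c) (Ce0 : 0 <= Ce).
Hypothesis (H10 : 0 < H1) (H20 : H2 <= 2^-1).
Hypothesis (K00 : 0 <= K0) (q0 : 0 <= q) (qH : q < H2).
Hypothesis (g00 : 0 <= g0) (g10 : 0 <= g1).
Hypothesis (sg0 : 0 <= sg) (sgH : 2 * H1 + sg < 1) (sga : 1 + sg < 2 * a).
Hypothesis hW : fractional_brownian_sheet l T H1 H2 W.
Hypothesis hg : lipschitz_weight T g0 g1 gamma.
Hypothesis w_ge : forall k, k.+1%:R * c <= w k.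
Hypothesis hu : forall k, time_kernel_bound T q (K0 * w k `^ (- a)) (u k).
Hypothesis e_le : forall k (x : R), x \in `]0, l[ -> `|e k x| <= Ce.
Hypothesis e_lip : forall k (x y : R), x \in `]0, l[ -> y \in `]0, l[ ->
  `|e k x - e k y| <= Ce * w k * `|x - y|.
Hypothesis e_int : forall k (b1 b2 : R), 0 <= b1 -> b1 < b2 -> b2 <= l ->
  `|\int[@lebesgue_measure R]_(y in `]b1, b2[) e k y| <= Ce / w k.
Hypothesis orth : forall i j, inner (e i) (e j) = (i == j)%:R.
Hypothesis complete :
  forall v, cvgH (fun n => \sum_(k < n) inner v (e k) *: e k) v.
Hypothesis F_meas : measurable_fun
    ([set` `]0, +oo[] `*` [set` `]0, l[] `*` [set` `]0, l[]
      : set (measurableTypeR R * measurableTypeR R * measurableTypeR R))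
    (fun p : measurableTypeR R * measurableTypeR R * measurableTypeR R =>
       F p.1.1 p.1.2 p.2).
Hypothesis F_cvg : forall t x : R, 0 < t -> x \in `]0, l[ ->
    (\int[muD l]_y
       ((\sum_(k < n) u k t * e k x * e k y - F t x y) ^+ 2)%R%:E)%E
      @[n --> \oo] --> 0%E.

Let w0 k : 0 < w k.
Proof. by apply: lt_le_trans (w_ge k); rewrite mulr_gt0. Qed.

(** The coefficient of each mode has a variance that factorizes into a time part,
  of order [w k `^ (- 2 * a)], and a space part, of order [w k `^ sg] times the power
  of the mesh size; the modes are summable because [2 * a - sg > 1]. *)
Lemma wong_zakai_second_moment : exists2 D : R, 0 <= D &
  forall m m' t (Z : Om -> L2D l), (0 < m)%N -> (0 < m')%N ->
    0 <= t -> t <= T -> L2Om P Z ->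
    wong_zakai_convolution T F gamma W m m' t Z ->
    ('E_P[fun om => (normH (Z om) ^+ 2)%R] <=
      (D * (l / m'%:R) `^ (2 * H1 + sg - 1))%:E)%E.
Proof.
have a0 : 0 < a by have := sg0; have := sga; lra.
have dd : 0 < 2 * a - sg - 1 by have := sga; lra.
have [Ct Ct0 hCt] := time_variance_bound T0 q0 qH H20 g00 g10.
have [Dx Dx0 hDx] := space_variance_mode l0 H10 sg0 sgH c0 Ce0.
have [S S0 hS] := sum_freq_powR_le c0 dd w_ge.
exists ((Ct * K0) ^+ 2 * Dx * S); first by rewrite !mulr_ge0 ?sqr_ge0.
move=> m m' t Z m0 m'0 t0 tT [mZ EZ] hZ.
set h := l / m'%:R; set Q := h `^ (2 * H1 + sg - 1).
have Q0 : 0 <= Q by exact: powR_ge0.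
apply: (@normH_second_moment_le _ _ _ P _ e orth complete Z
  (fun k => (Ct * K0) ^+ 2 * Dx * Q * w k `^ (- (1 + (2 * a - sg - 1))))) => //.
- move=> k; pose N := mode_noise T e u gamma m m' t W k.
  have mN : measurable_fun setT N.
    apply: measurable_sum => i; apply: measurable_sum => j.
    apply: measurable_funM; first exact: measurable_cst.
    rewrite /cell_noise /mesh_cell.
    apply: measurable_funD; last exact: measurable_funPT.
    by do 2![apply: measurable_funB; last exact: measurable_funPT];
      exact: measurable_funPT.
  have -> : ('E_P[fun om => (inner (Z om) (e k) ^+ 2)%R] =
             'E_P[fun om => (N om ^+ 2)%R])%E.
    rewrite unlock; apply: ae_eq_integral => //.
    + by apply/measurable_EFinP; exact: measurable_funX.
    + by apply/measurable_EFinP; exact: measurable_funX.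
    apply: filterS hZ => om Zom _; congr (_ ^+ 2)%:E.
    exact: (noise_coeff l0 T0 c0 Ce0 a0 K00 q0 qH H20 g00 g10 hg w_ge hu e_le
      e_int F_meas F_cvg m0 m'0 tT).
  rewrite /N /mode_noise (sheet_variance l0 T0 hW m0 m'0) lee_fin.
  have KK : 0 <= K0 * w k `^ (- a) by rewrite mulr_ge0 ?powR_ge0.
  have Vt := hCt gamma (u k) _ t m hg (hu k) KK t0 tT m0.
  have cw : c <= w k.
    by apply: le_trans (w_ge k); rewrite ler_peMl ?(ltW c0)// ler1n.
  have Vx := hDx (e k) (w k) m' cw m'0 (e_le k) (@e_lip k).
  have V0 := space_variance_ge0 l0 T0 hW m'0 (space_average (e k) h).
  apply: le_trans (ler_wpM2r V0 Vt) _.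
  apply: le_trans (ler_wpM2l (sqr_ge0 _) Vx) _.
  rewrite -/h -/Q le_eqVlt; apply/orP; left; apply/eqP.
  have -> : w k `^ (- (1 + (2 * a - sg - 1))) = w k `^ (- a) * w k `^ (- a) * w k `^ sg.
    by rewrite -!powRD ?(gt_eqF (w0 k)) ?implybT//; congr (_ `^ _); ring.
  ring.
move=> n; rewrite -mulr_sumr.
have -> : (Ct * K0) ^+ 2 * Dx * S * Q = (Ct * K0) ^+ 2 * Dx * Q * S by ring.
by apply: ler_wpM2l => //; rewrite !mulr_ge0 ?sqr_ge0.
Qed.

End NoiseSecondMoment.

(** * A weighted singular kernel and the time weight *)

Section WeightedKernel.
Context {R : realType}.
Notation leb := (@lebesgue_measure R).

Lemma integrable_weighted_kernel (q La t : R) : 0 <= q < 1 ->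
  leb.-integrable `]0, t[ (EFin \o (fun v => (t - v) `^ (- q) * expR (La * v))).
Proof.
move=> q01.
have [t0|t0] := leP t 0.
  by rewrite set_itv_ge -?leNgt ?bnd_simp//; exact: integrable_set0.
have I0 := integrable_powR_sing 0 (lexx t) q01.
have I1 : leb.-integrable `]0, t[
    (EFin \o (fun v => expR (`|La| * t) * (t - v) `^ (- q))).
  by apply: integrable_scale.
apply: (integrable_dom _ _ I1) => //.
  apply: measurable_funM; first exact: measurable_powR_sub.
  apply: measurable_funTS; apply: (measurableT_comp (@measurable_expR R)).
  apply: measurable_funM => //.
move=> v; rewrite /= in_itv/= => /andP[v0 vt].
rewrite normrM [`|_ `^ _|]ger0_norm ?powR_ge0// mulrC.
rewrite ler_wpM2r ?powR_ge0// ger0_norm ?expR_ge0// ler_expR.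
apply: le_trans (ler_norm _) _; rewrite normrM (gtr0_norm v0).
by apply: ler_wpM2l => //; exact: ltW.
Qed.

(** An exponential weight of large rate makes the weakly singular Volterra
  kernel a contraction: part of the decay of the exponential is traded for an
  integrable power, and the rest yields a negative power of the rate. *)
Lemma weighted_kernel_small (k q T d : R) : 0 <= k -> 0 <= q < 1 -> 0 < T -> 0 < d ->
  exists2 La : R, 0 < La & forall t, 0 <= t -> t <= T ->
    k * \int[leb]_(v in `]0, t[) ((t - v) `^ (- q) * expR (La * v))
      <= d * expR (La * t).
Proof.
move=> k0 q01 T0 d0; have /andP[q0 q1] := q01.
(* Half of the room left by [q] below 1. *)
pose p := (1 - q) / 2; have p0 : 0 < p by rewrite /p; lra.
have qp : 0 <= q + p < 1 by rewrite /p; lra.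
have qp1 : q + p < 1 by case/andP: qp.
pose G := T `^ (1 - (q + p)) / (1 - (q + p)).
have G0 : 0 <= G.
  by rewrite divr_ge0 ?powR_ge0// subr_ge0 ltW.
pose eta := d / (4 * k * G + 1).
have kG : 0 < 4 * k * G + 1 by have := mulr_ge0 k0 G0; lra.
have eta0 : 0 < eta by rewrite divr_gt0.
pose La := eta `^ (- p^-1); have La0 : 0 < La by exact: powR_gt0.
have LaE : La `^ (- p) = eta.
  by rewrite /La -powRrM mulrNN mulVf ?gt_eqF// powRr1// ltW.
exists La => // t t0 tT.
have [t00|t00] := eqVneq t 0.
  rewrite t00 set_itv_ge ?bnd_simp ?ltxx// Rintegral_set0 mulr0.
  by rewrite mulr_ge0 ?expR_ge0// ltW.
have {t00}t0 : 0 < t by rewrite lt_neqAle eq_sym t00.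
have I1 : leb.-integrable `]0, t[
    (EFin \o (fun v => 4 * eta * expR (La * t) * (t - v) `^ (- (q + p)))).
  by apply: integrable_scale => //; exact: integrable_powR_sing.
have B : `|\int[leb]_(v in `]0, t[) ((t - v) `^ (- q) * expR (La * v))| <=
    \int[leb]_(v in `]0, t[) (4 * eta * expR (La * t) * (t - v) `^ (- (q + p))).
  apply: le_abs_Rintegral_dom => // v; rewrite /= in_itv/= => /andP[v0 vt].
  have tv : 0 < t - v by rewrite subr_gt0.
  rewrite ger0_norm ?mulr_ge0 ?powR_ge0 ?expR_ge0//.
  have -> : La * v = La * t + - (La * (t - v)) by ring.
  rewrite expRD; have p2 : 0 <= p <= 2 by rewrite /p; lra.
  have E := expRN_le_powR (mulr_gt0 La0 tv) p2.
  apply: le_trans (ler_wpM2l (powR_ge0 _ _) (ler_wpM2l (expR_ge0 _) E)) _.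
  rewrite powRM ?(ltW La0) ?(ltW tv)// LaE.
  have -> : (t - v) `^ (- (q + p)) = (t - v) `^ (- q) * (t - v) `^ (- p).
    by rewrite -powRD ?(gt_eqF tv) ?implybT// opprD.
  by rewrite le_eqVlt; apply/orP; left; apply/eqP; ring.
have {}B := le_trans (ler_norm _) B.
apply: le_trans (ler_wpM2l k0 B) _.
rewrite RintegralZl//; last exact: integrable_powR_sing.
have E : \int[leb]_(v in `]0, t[) (t - v) `^ (- (q + p)) <= G.
  apply: le_trans (Rintegral_powR_sing t0 (lexx t) qp) _.
  rewrite ler_wpM2r ?invr_ge0 ?subr_ge0 ?(ltW qp1)// subr0.
  by rewrite ge0_ler_powR ?nnegrE ?subr_ge0 ?(ltW qp1) ?(ltW t0) ?(ltW T0).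
have C0 : 0 <= k * (4 * eta * expR (La * t)).
  by do ![exact: expR_ge0 | exact: ltW | by [] | apply: mulr_ge0].
rewrite mulrA; apply: le_trans (ler_wpM2l C0 E) _.
rewrite (_ : _ * G = (4 * k * G) * eta * expR (La * t)); last ring.
rewrite ler_wpM2r ?expR_ge0// /eta mulrCA ler_piMr ?(ltW d0)//.
by rewrite ler_pdivrMr// mul1r lerDl.
Qed.

End WeightedKernel.

Section C1Weight.
Context {R : realType}.

Let within_bounded (T : R) (f : R -> R) : 0 < T ->
  {within `[0, T], continuous f} ->
  exists2 M : R, 0 <= M & forall v, v \in `[0, T] -> `|f v| <= M.
Proof.
move=> T0 fc.
have nc : {within `[0, T], continuous (fun v => `|f v|)}.
  by move=> x; apply: continuous_comp; [exact: fc | exact: norm_continuous].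
have [x _ hx] := EVT_max (ltW T0) nc.
by exists `|f x|.
Qed.

Lemma C1_lipschitz_weight (T : R) (gamma : R -> R) : 0 < T -> C1_on T gamma ->
  exists g0 g1 : R, [/\ 0 <= g0, 0 <= g1 & lipschitz_weight T g0 g1 gamma].
Proof.
move=> T0 [gc [dg dgc gd]].
have [g0 g00 G0] := within_bounded T0 gc; have [g1 g10 G1] := within_bounded T0 dgc.
exists g0, g1; split=> //; split.
  by move=> v v0 vT; apply: G0; rewrite in_itv/= v0.
move=> v x v0 vx xT; rewrite (distrC (gamma v)).
have sub (y : R) : y \in `]v, x[ -> y \in `]0, T[.
  rewrite !in_itv/= => /andP[vy yx].
  by rewrite (le_lt_trans v0 vy) (lt_le_trans yx xT).
have A1 (y : R) : y \in `]v, x[ -> is_derive y (1 : R) gamma (dg y).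
  by move=> /sub; exact: gd.
have A2 : {within `[v, x], continuous gamma}.
  apply: continuous_subspaceW gc => y /=; rewrite !in_itv/= => /andP[vy yx].
  by rewrite (le_trans v0 vy) (le_trans yx xT).
have A3 (y : R) : y \in `]v, x[ -> `|dg y| <= g1.
  by move=> /sub yT; apply: G1; apply: subset_itv_oo_cc.
have L := lipschitz_of_derive vx A1 A2 A3.
exact: L.
Qed.

End C1Weight.

(** * Mean-square continuous processes *)

Section MeanSquare.
Context {R : realType} {d : measure_display} {Om : measurableType d}.
Variable P : probability Om R.
Variables (l : R) (e : nat -> L2D l).
Hypothesis orth : forall i j, inner (e i) (e j) = (i == j)%:R.
Hypothesis complete :
  forall v, cvgH (fun n => \sum_(k < n) inner v (e k) *: e k) v.
Implicit Types X Y : Om -> L2D l.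

Definition mean_sqr X : R := \int[P]_om (normH (X om) ^+ 2).

Lemma mean_sqr_ge0 X : 0 <= mean_sqr X.
Proof. by apply: Rintegral_ge0 => om _; exact: sqr_ge0. Qed.

Lemma L2Om_integrable X : L2Om P X ->
  P.-integrable setT (EFin \o (fun om => normH (X om) ^+ 2)).
Proof.
move=> [mX EX]; apply/integrableP; split.
  by apply/measurable_EFinP; exact: (measurable_normH_sqr orth complete).
under eq_integral do rewrite /= ger0_norm ?sqr_ge0//.
by rewrite unlock in EX.
Qed.

Lemma mean_sqrE X : L2Om P X ->
  ('E_P[fun om => (normH (X om) ^+ 2)%R] = (mean_sqr X)%:E)%E.
Proof.
move=> LX; rewrite unlock /mean_sqr /Rintegral fineK//.
exact: integrable_fin_num (L2Om_integrable LX).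
Qed.

(** Convexity of the square makes the second moment of any field that is
  pointwise controlled by two others finite and controlled by theirs. *)
Lemma mean_sqr_le2 X Y (Z : Om -> L2D l) : L2Om P X -> L2Om P Y ->
  {ae P, forall om, normH (Z om) ^+ 2 <=
    2 * normH (X om) ^+ 2 + 2 * normH (Y om) ^+ 2} ->
  (forall w : L2D l, measurable_fun setT (fun om => inner (Z om) w)) ->
  ('E_P[fun om => (normH (Z om) ^+ 2)%R] <=
    (2 * mean_sqr X + 2 * mean_sqr Y)%:E)%E.
Proof.
move=> LX LY le mZ.
have IX := integrable_scale 2 measurableT (L2Om_integrable LX).
have IY := integrable_scale 2 measurableT (L2Om_integrable LY).
have -> : (2 * mean_sqr X + 2 * mean_sqr Y)%:E = (\int[P]_om
   (2 * normH (X om) ^+ 2 + 2 * normH (Y om) ^+ 2)%:E)%E.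
  rewrite /mean_sqr -!RintegralZl//; try exact: L2Om_integrable.
  rewrite -RintegralD// /Rintegral fineK//.
  by apply: integrable_fin_num => //; exact: (integrableD measurableT IX IY).
rewrite unlock; apply: ae_ge0_le_integral => //.
- by move=> om _; rewrite lee_fin sqr_ge0.
- by apply/measurable_EFinP; exact: (measurable_normH_sqr orth complete).
- by move=> om _; rewrite lee_fin addr_ge0// mulr_ge0 ?sqr_ge0.
- by apply/measurable_EFinP; apply: measurable_funD; apply: measurable_funM => //;
    apply: (measurable_normH_sqr orth complete); [exact: LX.1|exact: LY.1].
- by apply: filterS le => om E _; rewrite lee_fin.
Qed.

Lemma L2OmB X Y : L2Om P X -> L2Om P Y -> L2Om P (fun om => X om - Y om).
Proof.
move=> LX LY; have mB w : measurable_fun setT (fun om => inner (X om - Y om) w).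
  apply: (eq_measurable_fun (fun om => inner (X om) w - inner (Y om) w)).
    by move=> om _; rewrite innerBl.
  by apply: measurable_funB; [exact: LX.1|exact: LY.1].
split=> //; apply: le_lt_trans (mean_sqr_le2 LX LY _ mB) (ltry _).
by apply: nearW => om; exact: normH_sub_sqr_le.
Qed.

(** Local boundedness from mean-square continuity, and compactness of the time
  interval. *)
Lemma continuous_L2Om_bounded (T : R) (u : R -> Om -> L2D l) :
  continuous_L2Om P T u ->
  exists2 M : R, 0 <= M & forall t, t \in `[0, T] -> mean_sqr (u t) <= M.
Proof.
move=> [Lu cu].
have loc t0 : `[0, T]%classic t0 -> \forall t \near t0 & M \near +oo,
    t \in `[0, T] -> mean_sqr (u t) <= M.
  move=> t0T; have /fine_cvgP[_ /cvgrPdist_lt/(_ 1 ltr01) near1] := cu t0 t0T.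
  pose B := 2 + 2 * mean_sqr (u t0).
  exists ([set t | t \in `[0, T] -> mean_sqr (u t - u t0) < 1], [set M | B <= M]).
    split; last by apply: nbhs_pinfty_ge; rewrite num_real.
    move: near1; apply: filterS => t /=.
    rewrite sub0r normrN unlock => S; apply: le_lt_trans (ler_norm _) _; exact: S.
  move=> [t M]/= [small BM] tT; apply: le_trans BM.
  rewrite -lee_fin -(mean_sqrE (Lu t tT)).
  have LB := L2OmB (Lu t tT) (Lu t0 t0T).
  apply: le_trans (mean_sqr_le2 LB (Lu t0 t0T) _ (Lu t tT).1) _.
    by apply: nearW => om; rewrite -{1}(subrK (u t0 om) (u t om)) normH_add_sqr_le.
  rewrite lee_fin /B lerD2r -[leRHS]mulr1 ler_pM2l//; apply: ltW; exact: (small tT).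
have /compact_near_coveringP cov := @segment_compact R 0 T.
have near_all := cov R (nbhs +oo) (fun M t => t \in `[0, T] -> mean_sqr (u t) <= M) _ loc.
have [M [M0 hM]] : exists M, 0 <= M /\ forall t, t \in `[0, T] -> mean_sqr (u t) <= M.
  near +oo_R => M; exists M; split.
    by near: M; apply: nbhs_pinfty_ge; rewrite num_real.
  have h : `[0, T]%classic `<=` (fun t => t \in `[0, T] -> mean_sqr (u t) <= M).
    by near: M; exact: near_all.
  by move=> t tT; exact: h.
by exists M.
Unshelve. all: by end_near. Qed.

End MeanSquare.

(** * A singular Gronwall argument *)

Section MildGronwall.
Context {R : realType} {d : measure_display} {Om : measurableType d}.
Variable P : probability Om R.
Variables (l : R) (e : nat -> L2D l).
Hypothesis orth : forall i j, inner (e i) (e j) = (i == j)%:R.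
Hypothesis complete :
  forall v, cvgH (fun n => \sum_(k < n) inner v (e k) *: e k) v.
Notation leb := (@lebesgue_measure R).

Let affine_moment (c0 c1 c2 : R) (X Y : Om -> L2D l) : L2Om P X -> L2Om P Y ->
  let b om := c0 + c1 * normH (X om) ^+ 2 + c2 * normH (Y om) ^+ 2 in
  P.-integrable setT (EFin \o b) /\
  \int[P]_om b om = c0 + c1 * mean_sqr P X + c2 * mean_sqr P Y.
Proof.
move=> LX LY b.
have I0 : P.-integrable setT (EFin \o cst c0).
  by apply: finite_measure_integrable_cst.
have IX := L2Om_integrable orth complete LX.
have IY := L2Om_integrable orth complete LY.
have I1 := integrable_scale c1 measurableT IX.
have I2 := integrable_scale c2 measurableT IY.
have I01 : P.-integrable setT (EFin \o (fun om => c0 + c1 * normH (X om) ^+ 2)).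
  exact: (integrableD measurableT I0 I1).
split; first exact: (integrableD measurableT I01 I2).
rewrite RintegralD// RintegralD// !RintegralZl// Rintegral_cst//.
by have P1 : P setT = 1%E := probability_setT P; rewrite /= P1 mulr1.
Qed.

Variables (T K q cf : R) (S : R -> L2D l -> L2D l) (f : L2D l -> L2D l).
Hypothesis (T0 : 0 < T) (K0 : 0 <= K) (q01 : 0 <= q < 1) (cf0 : 0 <= cf).
Hypothesis S_le : forall r v, 0 < r -> r <= T ->
  normH (S r v) <= K * r `^ (- q) * normH v.
Hypothesis f_le : forall v, normH (f v) <= cf * (1 + normH v).

Let young (A x y : R) : 0 < A ->
  (1 + x) * y <= A + A * x ^+ 2 + (2 * A)^-1 * y ^+ 2.
Proof.
move=> A0; pose z := y / A; have -> : y = A * z by rewrite /z mulrC divfK// gt_eqF.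
have -> : (2 * A)^-1 * (A * z) ^+ 2 = A * (z ^+ 2 / 2).
  by field; rewrite gt_eqF.
have -> : (1 + x) * (A * z) = A * ((1 + x) * z) by ring.
rewrite -[X in X + _ * x ^+ 2 + _]mulr1 -!mulrDr ler_pM2l//.
by have := sqr_ge0 (1 + x - z); have := sqr_ge0 (1 - x); lra.
Qed.

(** Testing the Duhamel integral [J] against itself and splitting the product
  by Young's inequality with a time-dependent parameter, matched to the
  exponential growth allowed for the solution, lets the integral of
  [weighted_kernel_small] appear. *)
Let duhamel_le (La M : R) (u : R -> Om -> L2D l) (t : R) (J : Om -> L2D l) :
  0 < La -> 0 <= M -> 0 <= t -> t <= T ->
  (forall v, v \in `[0, T] -> L2Om P (u v)) ->
  (forall v, v \in `[0, T] -> mean_sqr P (u v) <= M * expR (La * v) ^+ 2) ->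
  K * cf * \int[leb]_(v in `]0, t[) ((t - v) `^ (- q) * expR (La * v))
    <= 8^-1 * expR (La * t) ->
  L2Om_integral P `]0, t[ (fun v om => S (t - v) (f (u v om))) J ->
  mean_sqr P J <= (1 + M) / 4 * expR (La * t) ^+ 2.
Proof.
move=> La0 M0 t0 tT Lu uM kerS [LJ testJ].
have [_ JE] := testJ J LJ.
set j := mean_sqr P J; have j0 : 0 <= j by exact: mean_sqr_ge0.
have {}JE : j = \int[leb]_(v in `]0, t[)
    \int[P]_om inner (S (t - v) (f (u v om))) (J om).
  by rewrite -JE; apply: eq_Rintegral => om _; rewrite normH_sqr.
set E := expR (La * t); have E0 : 0 < E by exact: expR_gt0.
pose G := E * (1 + M) + j / (2 * E).
have G0 : 0 <= G.
  have E2 : 0 <= E by exact: ltW.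
  by rewrite /G; do ![by [] | apply: addr_ge0 | apply: mulr_ge0 | rewrite invr_ge0].
have inner_le v : `]0, t[%classic v ->
    `|\int[P]_om inner (S (t - v) (f (u v om))) (J om)| <=
    G * (K * cf) * ((t - v) `^ (- q) * expR (La * v)).
  rewrite /= in_itv/= => /andP[v0 vt].
  have vT : v \in `[0, T] by rewrite in_itv/= (ltW v0) (ltW (lt_le_trans vt tT)).
  have r0 : 0 < t - v by rewrite subr_gt0.
  have rT : t - v <= T by rewrite lerBlDr (le_trans tT)// lerDl ltW.
  set x := expR (La * v); have x0 : 0 < x by exact: expR_gt0.
  have x1 : 1 <= x by rewrite -[leLHS]expR0 ler_expR mulr_ge0// ltW.
  (* The Young parameter: [A * x] does not depend on [v]. *)
  pose A := E / x; have A0 : 0 < A by rewrite divr_gt0.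
  pose kr := K * (t - v) `^ (- q) * cf.
  have kr0 : 0 <= kr by rewrite !mulr_ge0 ?powR_ge0.
  have [ib bE] := affine_moment (kr * A) (kr * A) (kr * (2 * A)^-1) (Lu v vT) LJ.
  apply: le_trans (le_abs_Rintegral_dom measurableT ib _) _.
    move=> om _; apply: le_trans (cauchy_schwarz _ _) _.
    have Sf := S_le (f (u v om)) r0 rT.
    have krf : normH (S (t - v) (f (u v om))) <= kr * (1 + normH (u v om)).
      apply: le_trans Sf _; rewrite /kr -[leRHS]mulrA.
      by apply: ler_wpM2l; rewrite ?mulr_ge0 ?powR_ge0.
    apply: le_trans (ler_wpM2r (normH_ge0 _) krf) _.
    rewrite -[leLHS]mulrA [leRHS](_ : _ = kr * (A + A * normH (u v om) ^+ 2
      + (2 * A)^-1 * normH (J om) ^+ 2)); last by ring.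
    by apply: ler_wpM2l => //; exact: young.
  rewrite bE.
  have Xv := uM v vT; rewrite -/x in Xv.
  have AX : A * mean_sqr P (u v) <= E * M * x.
    apply: le_trans (ler_wpM2l (ltW A0) Xv) _.
    by rewrite /A le_eqVlt; apply/orP; left; apply/eqP; field; rewrite gt_eqF.
  have A1 : A <= E * x.
    by rewrite /A ler_pM2l//; apply: (le_trans _ x1); rewrite invf_le1.
  have Aj : (2 * A)^-1 * j = j / (2 * E) * x.
    by rewrite /A; field; rewrite !gt_eqF.
  rewrite [leLHS](_ : _ = kr * (A + A * mean_sqr P (u v) + (2 * A)^-1 * j)); last first.
    by rewrite /j; ring.
  rewrite Aj.
  rewrite [leRHS](_ : _ = kr * (G * x)); last by rewrite /kr /G; ring.
  apply: ler_wpM2l => //; rewrite /G; lra.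
have iker : leb.-integrable `]0, t[ (EFin \o (fun v =>
    G * (K * cf) * ((t - v) `^ (- q) * expR (La * v)))).
  by apply: integrable_scale => //; exact: integrable_weighted_kernel.
have jle : j <= G * (8^-1 * E).
  rewrite {1}JE; apply: le_trans (ler_norm _) _.
  apply: le_trans (le_abs_Rintegral_dom (mu := leb) (measurable_itv _) iker inner_le) _.
  rewrite RintegralZl//; last exact: integrable_weighted_kernel.
  by rewrite -mulrA; exact: ler_wpM2l.
have : G * (8^-1 * E) = ((1 + M) * E ^+ 2) / 8 + j / 16.
  by rewrite /G; field; rewrite gt_eqF.
move: jle => /[swap] ->.
have : 0 <= (1 + M) * E ^+ 2 by rewrite mulr_ge0 ?sqr_ge0 ?addr_ge0.
lra.
Qed.

(** A singular Gronwall inequality in disguise: the exponentially weighted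
  supremum of the second moments is at most half of itself plus the noise. *)
Lemma mild_mean_sqr_bound : exists2 B : R, 0 <= B &
  forall (conv : R -> (Om -> L2D l) -> Prop) (u : R -> Om -> L2D l) (z : R),
    mild_solution P T S f conv u -> 0 <= z ->
    (forall t Z, t \in `[0, T] -> L2Om P Z -> conv t Z ->
      ('E_P[fun om => (normH (Z om) ^+ 2)%R] <= z%:E)%E) ->
    forall t, t \in `[0, T] -> mean_sqr P (u t) <= B * (1 + z).
Proof.
have k0 : 0 <= K * cf by exact: mulr_ge0.
have d0 : 0 < 8^-1 :> R by rewrite invr_gt0.
have [La La0 kerS] := weighted_kernel_small k0 q01 T0 d0.
exists (4 * expR (La * T) ^+ 2); first by rewrite mulr_ge0 ?sqr_ge0.
move=> conv u z [cu mild] z0 convz.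
have Lu t : t \in `[0, T] -> L2Om P (u t) by exact: cu.1.
have step M : 0 <= M ->
    (forall v, v \in `[0, T] -> mean_sqr P (u v) <= M * expR (La * v) ^+ 2) ->
    forall t, t \in `[0, T] ->
      mean_sqr P (u t) <= ((1 + M) / 2 + 2 * z) * expR (La * t) ^+ 2.
  move=> M0 uM t tT; have [J [Z [intJ LZ cZ uE]]] := mild t tT.
  have LJ := intJ.1.
  have /andP[t0 tT'] : 0 <= t <= T by move: tT; rewrite in_itv.
  have Jle := duhamel_le La0 M0 t0 tT' Lu uM (kerS t t0 tT') intJ.
  have Zle : mean_sqr P Z <= z.
    by rewrite -lee_fin -(mean_sqrE orth complete LZ); exact: convz cZ.
  have uJZ : mean_sqr P (u t) <= 2 * mean_sqr P J + 2 * mean_sqr P Z.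
    rewrite -lee_fin -(mean_sqrE orth complete (Lu t tT)).
    apply: (mean_sqr_le2 orth complete LJ LZ _ (Lu t tT).1).
    by apply: filterS uE => om /eqH_normH ->; exact: normH_add_sqr_le.
  apply: le_trans uJZ _.
  have E1 : 1 <= expR (La * t) ^+ 2.
    by rewrite exprn_ege1// -[leLHS]expR0 ler_expR mulr_ge0// ltW.
  have zE : z <= z * expR (La * t) ^+ 2 by rewrite ler_peMr.
  move: Jle Zle zE; set E2 := expR _ ^+ 2; lra.
have [M1 M10 hM1] := continuous_L2Om_bounded orth complete cu.
pose Y := [set y | exists2 t, t \in `[0, T] &
  y = mean_sqr P (u t) * (expR (La * t) ^+ 2)^-1].
have E20 t : 0 < expR (La * t) ^+ 2 by rewrite exprn_gt0 ?expR_gt0.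
have T0T : 0 \in `[0, T] by rewrite in_itv/= lexx ltW.
have Yne : Y !=set0 by exists (mean_sqr P (u 0) * (expR (La * 0) ^+ 2)^-1), 0.
have Yub : ubound Y M1.
  move=> _ [t tT ->]; rewrite ler_pdivrMr//; apply: le_trans (hM1 t tT) _.
  rewrite ler_peMr// exprn_ege1// -[leLHS]expR0 ler_expR mulr_ge0 ?(ltW La0)//.
  by move: tT; rewrite in_itv => /andP[].
have hsup : has_sup Y by split=> //; exists M1.
pose M := sup Y.
have leM t : t \in `[0, T] -> mean_sqr P (u t) <= M * expR (La * t) ^+ 2.
  move=> tT; rewrite -ler_pdivrMr//.
  by apply: (sup_upper_bound hsup); exists t.
have M0 : 0 <= M.
  have := le_trans (mean_sqr_ge0 P (u 0)) (leM 0 T0T).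
  by rewrite pmulr_lge0.
have M_le : M <= (1 + M) / 2 + 2 * z.
  apply: ge_sup => // _ [t tT ->]; rewrite ler_pdivrMr//.
  exact: step.
have {}M_le : M <= 4 * (1 + z) by have := z0; lra.
move=> t tT; apply: le_trans (leM t tT) _.
have -> : 4 * expR (La * T) ^+ 2 * (1 + z) = 4 * (1 + z) * expR (La * T) ^+ 2 by ring.
apply: (ler_pM M0 (ltW (E20 t)) M_le).
rewrite ler_pXn2r ?nnegrE ?expR_ge0// ler_expR ler_pM2l//.
by move: tT; rewrite in_itv => /andP[].
Qed.

End MildGronwall.

(** * The error estimate *)

(** The share [th] of the resolvent decay given to the spectral parameter must be
  large enough for the modes of the noise to be summable, and small enough for the
  time kernel, of singularity [q > alpha * th], to be integrable against a noise of
  index [H2]. *)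
Lemma modal_exponents {R : realType} (alpha s H1 H2 sigma eps : R) :
  0 < alpha -> 0 < s -> 0 < H1 -> 0 < H2 -> H2 <= 2^-1 -> (1 - H1) / 2 < s ->
  0 <= 2 * sigma ->
  2 * sigma < Num.min (1 - 2 * H1)
                (Num.min (4 * s * H2 / alpha - 1) ((1 + eps) / 2)) ->
  exists th q : R, [/\ 0 <= th <= 1, 1 + 2 * sigma < 2 * (2 * s * th),
    alpha * th < q, 0 < q & q < H2].
Proof.
move=> al0 s0 H10 H20 H2h hs sg0; rewrite !lt_min => /and3P[sg1 sg2 _].
pose lo := (1 + 2 * sigma) / (4 * s); pose hi := Num.min 1 (H2 / alpha).
have s40 : 0 < 4 * s by rewrite mulr_gt0.
have lo0 : 0 < lo by rewrite divr_gt0//; lra.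
have lohi : lo < hi.
  rewrite lt_min; apply/andP; split.
    by rewrite ltr_pdivrMr// mul1r; lra.
  rewrite ltr_pdivrMr// [ltRHS](_ : _ = 4 * s * H2 / alpha); last by ring.
  lra.
pose th := (lo + hi) / 2.
have [th1 th2] : lo < th /\ th < hi by rewrite /th; split; lra.
have /andP[th3 th4] : (th < 1) && (th < H2 / alpha) by rewrite -lt_min.
have ath : alpha * th < H2 by rewrite mulrC -ltr_pdivlMr.
have th0 : 0 < th by exact: lt_trans th1.
exists th, ((alpha * th + H2) / 2); split.
- by rewrite (ltW th0) (ltW th3).
- by move: th1; rewrite /lo ltr_pdivrMr//; lra.
- lra.
- have : 0 < alpha * th by rewrite mulr_gt0.
  lra.
- lra.
Qed.

Theorem theorem4p2 (R : realType) (l T : R) (hl : 0 < l) (hT : 0 < T)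
    (alpha beta s mu lambda H1 H2 : R)
    (hbeta : 0 < beta) (hbetaalpha : beta <= alpha) (halpha : alpha < 1)
    (hs0 : 0 < s) (hs1 : s < 1) (hmu : 0 < mu) (hlambda : 0 <= lambda)
    (hH1 : 0 < H1) (hH1' : H1 <= 1 / 2) (hH2 : 0 < H2) (hH2' : H2 <= 1 / 2)
    (gamma : R -> R) (hgamma : C1_on T gamma) (hgamma0 : gamma 0 = 0)
    (rho : nat -> R) (e : nat -> L2D l) (heig : dirichlet_eigensystem rho e)
    (kappa theta : R) (hkappa : 0 < kappa)
    (htheta : 0 < theta) (htheta' : theta < pi / 2)
    (S : R -> L2D l -> L2D l)
    (hS : solution_operator alpha beta s mu lambda rho e kappa theta S)
    (F : R -> R -> R -> R)
    (hF : green_kernel alpha beta s mu lambda rho e kappa theta F)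
    (d : measure_display) (Om : measurableType d) (P : probability Om R)
    (W : R -> R -> {RV P >-> R})
    (hW : fractional_brownian_sheet l T H1 H2 W)
    (f : L2D l -> L2D l) (cf : R) (hcf : 0 < cf)
    (hf_growth : forall u : L2D l, normH (f u) <= cf * (1 + normH u))
    (hf_lip : forall u v : L2D l, normH (f u - f v) <= cf * normH (u - v))
    (hs : (1 - H1) / 2 < s)
    (hH : 0 < 2 * H2 + (H1 - 1) * alpha) :
  exists eps0 : R, 0 < eps0 /\
  forall eps sigma : R, 0 < eps -> eps < eps0 ->
    0 <= 2 * sigma ->
    2 * sigma < Num.min (1 - 2 * H1)
                  (Num.min (4 * s * H2 / alpha - 1) ((1 + eps) / 2)) ->
  forall u : R -> Om -> L2D l,
    mild_solution P T S f (noise_convolution T F gamma W) u ->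
  exists c : R,
    forall m m' : nat, (0 < m)%N -> (0 < m')%N ->
    forall uW : R -> Om -> L2D l,
      mild_solution P T S f (wong_zakai_convolution T F gamma W m m') uW ->
    forall t : R, t \in `[0, T] ->
      let tau := T / m%:R in
      let h := l / m'%:R in
      ('E_P[fun om => (normH (u t om - uW t om) ^+ 2)%R] <=
        (c * (h `^ (2 * sigma + 2 * H1 - 1)
              + h `^ (2 * H1 - 1)
                * tau `^ (2 * H2 - alpha / (2 * s) - eps)))%R%:E)%E.
Proof.
exists 1; split=> // eps sigma eps0 eps1 sg0 sgmin u hu.
have al0 : 0 < alpha by exact: lt_le_trans hbetaalpha.
have H2h : H2 <= 2^-1 by move: hH2'; lra.
have [th [q [th01 hth athq q0 qH2]]] :=
  modal_exponents al0 hs0 hH1 hH2 H2h hs sg0 sgmin.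
have q01 : 0 <= q < 1 by rewrite (ltW q0)/=; lra.
have q01' : 0 <= q <= 1 by rewrite (ltW q0)/=; lra.
have sgH : 2 * H1 + 2 * sigma < 1.
  by move: sgmin; rewrite lt_min => /andP[? _]; lra.
have [g0 [g1 [g00 g10 hg]]] := C1_lipschitz_weight hT hgamma.
have [[rho0 _] _ orth complete] := heig.
have rs0 k : 0 < rho k `^ s by exact: powR_gt0.
have [Ce Ce0 [e_le e_lip e_int w_ge]] := eigen_estimates hl heig.
have [C C0 hC] := relaxation_bounds hbeta hbetaalpha halpha hmu hlambda hkappa
  htheta htheta' hT th01 athq q01'.
(* With [th = 0] the bound is uniform in the modes, and controls [S]. *)
have th00 : 0 <= (0 : R) <= 1 by rewrite lexx ler01.
have a0q : alpha * 0 < q by rewrite mulr0.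
have [K K0 hK] := relaxation_bounds hbeta hbetaalpha halpha hmu hlambda hkappa
  htheta htheta' hT th00 a0q q01'.
have S_le r v : 0 < r -> r <= T -> normH (S r v) <= K * r `^ (- q) * normH v.
  move=> r0 rT; apply: (solution_operator_norm hbeta hbetaalpha halpha hmu
    hlambda hkappa htheta htheta' heig v hS r0) => k.
  by have := (hK _ (rs0 k)).1 r r0 rT; rewrite oppr0 powRr0 mulr1.
pose w k := Num.sqrt (rho k).
have wE k : (rho k `^ s) `^ (- th) = w k `^ (- (2 * s * th)).
  rewrite /w -powR12_sqrt ?(ltW (rho0 k))// -!powRrM; congr (_ `^ _); by field.
have pil : 0 < pi / l by rewrite divr_gt0// pi_gt0.
have hU : forall k, time_kernel_bound T q (C * w k `^ (- (2 * s * th)))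
    (ufun alpha beta s mu lambda rho kappa theta k).
  by move=> k; rewrite -wE; exact: (hC _ (rs0 k)).
have [D D0 hD] := wong_zakai_second_moment hl hT pil Ce0 hH1 H2h C0 (ltW q0) qH2
  g00 g10 sg0 sgH hth hW hg w_ge hU e_le e_lip e_int orth complete hF.1 hF.2.
have [B B0 hB] := mild_mean_sqr_bound P orth complete hT K0 q01 (ltW hcf) S_le
  hf_growth.
have [Mu Mu0 hMu] := continuous_L2Om_bounded orth complete hu.1.
set p := 2 * sigma + 2 * H1 - 1.
have pE : 2 * H1 + 2 * sigma - 1 = p by rewrite /p; ring.
have p0 : p < 0 by rewrite -pE; lra.
have lp0 : 0 < l `^ p by exact: powR_gt0.
exists ((2 * Mu + 2 * B) / l `^ p + 2 * B * D) => m m' m0 m'0 uW huW t tT; cbv zeta.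
set tau := T / m%:R; set h := l / m'%:R.
have h0 : 0 < h by rewrite divr_gt0// ltr0n.
(* The exponent is negative and the mesh size is at most [l]. *)
have hp : l `^ p <= h `^ p.
  rewrite -[p]opprK !(powRN _ (- p)) lef_pV2 ?posrE ?powR_gt0//.
  apply: ge0_ler_powR; rewrite ?nnegrE ?oppr_ge0 ?(ltW p0) ?(ltW hl) ?(ltW h0)//.
  by rewrite /h ler_pdivrMr ?ltr0n// ler_peMr ?(ltW hl)// ler1n.
have uW_le : mean_sqr P (uW t) <= B * (1 + D * h `^ p).
  apply: (hB _ uW _ huW _ _ t tT); first by rewrite mulr_ge0 ?powR_ge0.
  move=> t1 Z; rewrite in_itv/= => /andP[t10 t1T] LZ cZ; rewrite -pE.
  exact: hD cZ.
have Lu : L2Om P (u t) by exact: hu.1.1.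
have LuW : L2Om P (uW t) by exact: huW.1.1.
apply: le_trans (mean_sqr_le2 orth complete Lu LuW _ (L2OmB orth complete Lu LuW).1) _.
  by apply: nearW => om; exact: normH_sub_sqr_le.
rewrite lee_fin; set Q := _ * tau `^ _; have Q0 : 0 <= Q by rewrite mulr_ge0 ?powR_ge0.
set c := _ + 2 * B * D.
have c0 : 0 <= c.
  by rewrite /c; do ![exact: ltW | by [] | apply: addr_ge0 | apply: mulr_ge0 | rewrite invr_ge0].
apply: le_trans (_ : c * h `^ p <= _); last by apply: ler_wpM2l => //; rewrite lerDl.
have E1 : 2 * Mu + 2 * B <= (2 * Mu + 2 * B) / l `^ p * h `^ p.
  rewrite -mulrA ler_peMr//; first lra.
  by rewrite mulrC ler_pdivlMr// mul1r.
have := hMu t tT; rewrite /c mulrDl; lra.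
Qed.
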